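(* Let $\varepsilon>0$ be a sufficiently small constant. There is an algorithm that, given a Correlation Clustering instance $(V,E^+\uplus E^-)$ with $n=|V|$, runs in time $n^{\mathrm{poly}(1/\varepsilon)}$ and outputs a feasible solution $\big((z_S)_{\emptyset\neq S\subseteq V},(x_{uv})_{uv\in\binom V2}\big)$ of the cluster LP, described by the list of its non-zero coordinates, such that $\mathrm{obj}(x)\le(1+\varepsilon)\,\mathrm{opt}$, where $\mathrm{opt}$ is the cost of an optimum clustering of the instance.
   Context: A Correlation Clustering instance consists of a finite vertex set $V$ and a partition $E^+\uplus E^-=\binom V2$ of the unordered pairs of distinct vertices into $+$edges and $-$edges. A clustering is a partition of $V$; its cost is the number of $+$edges whose endpoints lie in different parts plus the number of $-$edges whose endpoints lie in the same part. $\mathrm{opt}$ is the minimum cost over all clusterings. For $x\in[0,1]^{\binom V2}$, $\mathrm{obj}(x)=\sum_{uv\in E^+}x_{uv}+\sum_{uv\in E^-}(1-x_{uv})$. The cluster LP has a variable $z_S$ for every nonempty $S\subseteq V$ and a variable $x_{uv}$ for every $uv\in\binom V2$; it minimizes $\mathrm{obj}(x)$ subject to $\sum_{S\ni u}z_S=1$ for all $u\in V$, $\sum_{S\supseteq\{u,v\}}z_S=1-x_{uv}$ for all $uv\in\binom V2$, and $z_S\ge0$ for all nonempty $S$. *)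

(* Defs.v *)
From HB Require Import structures.
From mathcomp Require Import all_boot all_order all_algebra.
From mathcomp Require Import reals.
Set Implicit Arguments. Unset Strict Implicit. Unset Printing Implicit Defensive.
Import Order.TTheory GRing.Theory Num.Theory.

(* Model of computation: deterministic single-tape Turing machines with a    *)
(* one-sided infinite tape.  Tape alphabet 'I_(k+3): 0 = blank, 1 = bit      *)
(* false, 2 = bit true, other symbols are work symbols.  Finitely many       *)
(* states 'I_(m+1).  tm_delta returning None means "halt".                   *)

Inductive move := MoveL | MoveR | MoveS.

Record TM := mkTM {
  tm_nstates : nat;
  tm_nsyms : nat;
  tm_start : 'I_tm_nstates.+1;
  tm_delta : 'I_tm_nstates.+1 -> 'I_tm_nsyms.+3 ->
             option ('I_tm_nstates.+1 * 'I_tm_nsyms.+3 * move)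
}.

Definition tm_state (M : TM) := 'I_(tm_nstates M).+1.
Definition tm_symbol (M : TM) := 'I_(tm_nsyms M).+3.

Definition blank_sym (k : nat) : 'I_k.+3 := ord0.
Definition sym_of_bool (k : nat) (b : bool) : 'I_k.+3 :=
  if b then inord 2 else inord 1.

Definition config (M : TM) : Type :=
  (tm_state M * (nat -> tm_symbol M) * nat)%type.

Definition tm_step (M : TM) (c : config M) : option (config M) :=
  let: (q, tp, h) := c in
  match @tm_delta M q (tp h) with
  | None => None
  | Some (q', s, m) =>
      Some (q', (fun i => if i == h then s else tp i),
            match m with MoveL => h.-1 | MoveR => h.+1 | MoveS => h end)
  end.

Definition tm_halted (M : TM) (c : config M) : bool :=
  let: (q, tp, h) := c in
  if @tm_delta M q (tp h) is None then true else false.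

Fixpoint tm_run (M : TM) (t : nat) (c : config M) : config M :=
  match t with
  | 0 => c
  | t'.+1 => match tm_step c with None => c | Some c' => tm_run t' c' end
  end.

Definition tm_init (M : TM) (inp : seq bool) : config M :=
  (@tm_start M,
   (fun i => nth (blank_sym _) [seq sym_of_bool (tm_nsyms M) b | b <- inp] i),
   0).

Definition tape_holds (M : TM) (tp : nat -> tm_symbol M) (out : seq bool) :=
  (forall i, i < size out -> tp i = sym_of_bool _ (nth false out i)) /\
  tp (size out) = blank_sym _.

Definition tm_computes_within (M : TM) (inp : seq bool) (T : nat)
    (out : seq bool) : Prop :=
  exists t, t <= T /\
    let c := @tm_run M t (@tm_init M inp) in
    @tm_halted M c /\ @tape_holds M c.1.2 out.

Fixpoint bits_fuel (fuel k : nat) : seq bool :=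
  match fuel with
  | 0 => [::]
  | f.+1 => if k is 0 then [::] else odd k :: bits_fuel f k./2
  end.
Definition bits (k : nat) : seq bool := bits_fuel k k.

(* prefix-free binary code for naturals *)
Definition enc_nat (k : nat) : seq bool :=
  flatten [seq [:: true; b] | b <- bits k] ++ [:: false].

Definition enc_int (z : int) : seq bool :=
  match z with Posz k => false :: enc_nat k | Negz k => true :: enc_nat k end.

Definition enc_rat (q : rat) : seq bool :=
  enc_int (numq q) ++ enc_int (denq q).

Definition enc_list (l : seq (seq bool)) : seq bool :=
  flatten [seq true :: s | s <- l] ++ [:: false].

(* Correlation Clustering instance on V = 'I_n: plus u v = true iff uv is a
   +edge (for u <> v); the encoding lists n in unary, then the n*n matrix. *)
Definition enc_instance (n : nat) (plus : 'I_n -> 'I_n -> bool) : seq bool :=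
  nseq n true ++ false ::
  flatten [seq [seq plus i j | j <- enum 'I_n] | i <- enum 'I_n].

(* An LP solution described by the list of its non-zero coordinates:
   zl lists pairs (S, z_S), xl lists triples (u, v, x_uv) with u < v. *)
Definition enc_zentry (n : nat) (e : {set 'I_n} * rat) : seq bool :=
  [seq i \in e.1 | i <- enum 'I_n] ++ enc_rat e.2.

Definition enc_xentry (n : nat) (e : 'I_n * 'I_n * rat) : seq bool :=
  enc_nat e.1.1 ++ enc_nat e.1.2 ++ enc_rat e.2.

Definition enc_solution (n : nat) (zl : seq ({set 'I_n} * rat))
    (xl : seq ('I_n * 'I_n * rat)) : seq bool :=
  enc_list [seq enc_zentry e | e <- zl] ++ enc_list [seq enc_xentry e | e <- xl].

Local Open Scope ring_scope.

Definition cc_cost (n : nat) (plus : 'I_n -> 'I_n -> bool)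
    (P : {set {set 'I_n}}) : nat :=
  (\sum_(u : 'I_n) \sum_(v : 'I_n | (u < v)%N)
     ((plus u v && (pblock P u != pblock P v)) ||
      (~~ plus u v && (pblock P u == pblock P v))) : nat)%N.

(* opt = minimum cost over all clusterings (n*n exceeds every cost) *)
Definition cc_opt (n : nat) (plus : 'I_n -> 'I_n -> bool) : nat :=
  \big[minn/(n * n)%N]_(P : {set {set 'I_n}} | partition P [set: 'I_n])
     cc_cost plus P.

Definition zval (n : nat) (zl : seq ({set 'I_n} * rat)) (S : {set 'I_n}) : rat :=
  \sum_(e <- zl | e.1 == S) e.2.

Definition xval (n : nat) (xl : seq ('I_n * 'I_n * rat)) (u v : 'I_n) : rat :=
  \sum_(e <- xl | (e.1.1 == u) && (e.1.2 == v)) e.2.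

Definition nonzero_list (n : nat) (zl : seq ({set 'I_n} * rat))
    (xl : seq ('I_n * 'I_n * rat)) : Prop :=
  uniq [seq e.1 | e : {set 'I_n} * rat <- zl] /\
  all (fun e : {set 'I_n} * rat => (e.1 != set0) && (e.2 != 0)) zl /\
  uniq [seq e.1 | e : 'I_n * 'I_n * rat <- xl] /\
  all (fun e : 'I_n * 'I_n * rat => (e.1.1 < e.1.2)%N && (e.2 != 0)) xl.

Definition cluster_LP_feasible (n : nat) (zl : seq ({set 'I_n} * rat))
    (xl : seq ('I_n * 'I_n * rat)) : Prop :=
  (forall S : {set 'I_n}, S != set0 -> 0 <= zval zl S) /\
  (forall u : 'I_n, \sum_(S : {set 'I_n} | u \in S) zval zl S = 1) /\
  (forall u v : 'I_n, (u < v)%N ->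
     \sum_(S : {set 'I_n} | (u \in S) && (v \in S)) zval zl S = 1 - xval xl u v).

Definition cc_obj (n : nat) (plus : 'I_n -> 'I_n -> bool)
    (xl : seq ('I_n * 'I_n * rat)) : rat :=
  \sum_(u : 'I_n) \sum_(v : 'I_n | (u < v)%N)
     (if plus u v then xval xl u v else 1 - xval xl u v).

(* Main.v *)
(* Let [N[u]] be the closed neighbourhood of [u] in the + graph, and let
   [cost2 S] be the sum over [u] in [S] of [|N[u] Δ S|].  If every vertex lies
   in exactly [N] of the sets [F_t], then giving each set the weight
   (multiplicity / [N]) is feasible for the cluster LP, and [2 N obj(x)] is the
   sum of the [cost2 F_t].

   The sets come from online gradient ascent on vertex prices [p]: each round
   takes a set [S_t] of small [cost2 S - p(S)], and the price of a vertex drops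
   when it is covered.  Telescoping the squared imbalance of the cover bounds
   the total cost; a surplus is truncated, a deficit is filled by singletons,
   and AM-GM charges this repair to the same square.

   It suffices that [S_t] beats every class [C] of an optimal clustering up to
   an error [cost2 C / Q].  Such a set is found among [(n + 4) ^ poly(Q)]
   explicit candidates: a few guessed roots determine a core [K] in [C] and a
   set [D] of undecided vertices; [D] is cut into [kappa] chunks, and the
   vertices of a chunk are kept or dropped by the sign of a gradient estimated
   from [kappa ^ 2] guessed samples of the cluster built so far.

   The algorithm is one fixed program with nested bounded loops, compiled to a
   Turing machine; its degree does not depend on [Q], which enters only through
   the number [(n + 4) ^ poly(Q)] of candidates. *)
Require Import Defs.
From HB Require Import structures.
From mathcomp Require Import all_boot all_order all_algebra.
From mathcomp Require Import zify ring lra.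
From mathcomp Require Import reals.
From Stdlib Require Import FunctionalExtensionality.
Set Implicit Arguments. Unset Strict Implicit. Unset Printing Implicit Defensive.
Import Order.TTheory GRing.Theory Num.Theory.

(** * Structured programs on a tape *)

(** Rounding a set [D] of undecided vertices errs by about [|D| ^ 2 / kappa], which is harmless only
    when [|D| ^ 2] is at most [poly(Q)] times [cost2 C]. This forces three regimes for a class of
    size [s]. Above [2 Q s ^ 2], the class may be broken into singletons. Down to [s ^ 2 / 100], an
    undecided set of size [poly(Q) s] is affordable. Below that, the class is nearly a clique, and
    one neighbourhood settles all but [9 cost2 C / s] vertices. What is proved for [C] is a bound on
    [|C|] times the least candidate value. The weight [|C|] allows [C] to be compared with several
    candidates at once, for instance a main part and single vertices, and the weights of all classes
    sum to [n]. Nothing is random: kinds, roots, sizes and samples are the digits of an index, every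
    index is tried, and averaging shows that a good one exists. The regret bound leaves an additive
    error. It becomes multiplicative because the optimum is at least 1 unless the + graph is
    transitive, in which case the classes are known exactly. *)

Section TapePrograms.
Variable k : nat.
Notation sym := 'I_k.+3.

Inductive tcmd :=
| TAct (f : sym -> sym) (mv : move)
| TSeq (c1 c2 : tcmd)
| TIf (P : pred sym) (c1 c2 : tcmd)
| TWhile (P : pred sym) (c : tcmd).

Definition put (tp : nat -> sym) (h : nat) (s : sym) : nat -> sym :=
  fun i => if i == h then s else tp i.

Definition shift (mv : move) (h : nat) : nat :=
  match mv with MoveL => h.-1 | MoveR => h.+1 | MoveS => h end.

(** The times are exact for the code below: a test is one step, and the first branch of a
    conditional and each loop iteration end with a second, unconditional jump. *)
Inductive texec : tcmd -> (nat -> sym) -> nat -> (nat -> sym) -> nat -> nat -> Prop :=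
| XAct f mv tp h : texec (TAct f mv) tp h (put tp h (f (tp h))) (shift mv h) 1
| XSeq c1 c2 tp h tp1 h1 tp2 h2 t1 t2 :
    texec c1 tp h tp1 h1 t1 -> texec c2 tp1 h1 tp2 h2 t2 ->
    texec (TSeq c1 c2) tp h tp2 h2 (t1 + t2)
| XIfT (P : pred sym) c1 c2 tp h tp1 h1 t :
    P (tp h) -> texec c1 tp h tp1 h1 t -> texec (TIf P c1 c2) tp h tp1 h1 (t + 2)
| XIfF (P : pred sym) c1 c2 tp h tp1 h1 t :
    P (tp h) = false -> texec c2 tp h tp1 h1 t ->
    texec (TIf P c1 c2) tp h tp1 h1 (t + 1)
| XWhF (P : pred sym) c tp h : P (tp h) = false -> texec (TWhile P c) tp h tp h 1
| XWhT (P : pred sym) c tp h tp1 h1 tp2 h2 t1 t2 :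
    P (tp h) -> texec c tp h tp1 h1 t1 -> texec (TWhile P c) tp1 h1 tp2 h2 t2 ->
    texec (TWhile P c) tp h tp2 h2 (t1 + t2 + 2).

(* [IBr P j] falls through when [P] holds of the scanned symbol and jumps to
   address [j] otherwise. *)
Inductive instr := IAct (f : sym -> sym) (mv : move) | IBr (P : pred sym) (j : nat).

Fixpoint codelen (c : tcmd) : nat :=
  match c with
  | TAct _ _ => 1
  | TSeq c1 c2 => codelen c1 + codelen c2
  | TIf _ c1 c2 => codelen c1 + codelen c2 + 2
  | TWhile _ c => codelen c + 2
  end.

Fixpoint code (c : tcmd) (o : nat) : seq instr :=
  match c with
  | TAct f mv => [:: IAct f mv]
  | TSeq c1 c2 => code c1 o ++ code c2 (o + codelen c1)
  | TIf P c1 c2 =>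
      IBr P (o + codelen c1 + 2) :: code c1 o.+1 ++
      IBr pred0 (o + codelen c1 + codelen c2 + 2) :: code c2 (o + codelen c1 + 2)
  | TWhile P c => IBr P (o + codelen c + 2) :: code c o.+1 ++ [:: IBr pred0 o]
  end.

Lemma size_code c o : size (code c o) = codelen c.
Proof.
elim: c o => [f mv|c1 IH1 c2 IH2|P c1 IH1 c2 IH2|P c IH] o //=.
- by rewrite size_cat IH1 IH2.
- by rewrite size_cat /= IH1 IH2; lia.
- by rewrite size_cat /= IH; lia.
Qed.

(** States are addresses. The extra state [size cd] has no transition, so running off the end of the
    code halts. [IBr pred0 j] is an unconditional jump. *)
Definition code_TM (cd : seq instr) : TM :=
  @mkTM (size cd) k ord0
    (fun q s => if (q < size cd)%N then
       match nth (IBr pred0 0) cd q with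
       | IAct f mv => Some (inord q.+1, f s, mv)
       | IBr P j => Some (inord (if P s then q.+1 else j), s, MoveS)
       end else None).

Lemma put_id tp h : put tp h (tp h) = tp.
Proof. by apply: functional_extensionality => i; rewrite /put; case: eqP => [->|]. Qed.

Lemma run_act cd pc f mv tp h t : (pc < size cd)%N ->
  nth (IBr pred0 0) cd pc = IAct f mv ->
  @tm_run (code_TM cd) t.+1 (inord pc, tp, h) =
  @tm_run (code_TM cd) t (inord pc.+1, put tp h (f (tp h)), shift mv h).
Proof. by move=> lt e /=; rewrite inordK ?ltnS ?(ltnW lt) // lt e. Qed.

Lemma run_br cd pc P j tp h t : (pc < size cd)%N ->
  nth (IBr pred0 0) cd pc = IBr P j ->
  @tm_run (code_TM cd) t.+1 (inord pc, tp, h) =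
  @tm_run (code_TM cd) t (inord (if P (tp h) then pc.+1 else j), tp, h).
Proof.
move=> lt e /=; rewrite inordK ?ltnS ?(ltnW lt) // lt e.
by rewrite -/(put tp h (tp h)) put_id.
Qed.

(** Jump targets are absolute, so the induction has to place the code of [c] at an arbitrary offset
    [o] of a larger program; the remaining time [t2] lets runs be chained. *)
Lemma texec_run c tp h tp' h' t : texec c tp h tp' h' t ->
  forall cd pre post o t2, cd = pre ++ code c o ++ post -> size pre = o ->
  @tm_run (code_TM cd) (t + t2) (inord o, tp, h) =
  @tm_run (code_TM cd) t2 (inord (o + codelen c), tp', h').
Proof.
elim=> {c tp h tp' h' t}.
- move=> f mv tp h cd pre post o t2 e so; rewrite add1n (@run_act _ _ f mv) ?addn1 //.
  + by rewrite e !size_cat /=; lia.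
  + by rewrite e nth_cat so ltnn subnn.
- move=> c1 c2 tp h tp1 h1 tp2 h2 t1 t2 _ IH1 _ IH2 cd pre post o t3 e so.
  rewrite -addnA (IH1 _ pre (code c2 (o + codelen c1) ++ post)) //; last first.
    by rewrite e /= -catA.
  rewrite (IH2 _ (pre ++ code c1 o) post) /= ?addnA //.
    by rewrite e /= -!catA.
  by rewrite size_cat size_code so.
- move=> P c1 c2 tp h tp1 h1 t Pt _ IH cd pre post o t3 e so.
  pose j2 := IBr pred0 (o + codelen c1 + codelen c2 + 2).
  pose j1 := IBr P (o + codelen c1 + 2).
  have e1 : cd = rcons pre j1 ++ code c1 o.+1 ++
     (j2 :: code c2 (o + codelen c1 + 2) ++ post).
    by rewrite e /= cat_rcons -!catA.
  have -> : t + 2 + t3 = (t + t3.+1).+1 by lia.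
  rewrite (@run_br _ _ P (o + codelen c1 + 2)); first last.
  + by rewrite e nth_cat so ltnn subnn.
  + by rewrite e !size_cat /= !size_cat /=; lia.
  rewrite Pt (IH _ _ _ _ _ e1); last by rewrite size_rcons so.
  rewrite (@run_br _ _ pred0 (o + codelen c1 + codelen c2 + 2)) /=.
  + by rewrite !addnA.
  + by rewrite e1 !size_cat size_rcons size_code /=; lia.
  + rewrite e1 nth_cat size_rcons so ifF; last by lia.
    by rewrite addKn nth_cat size_code ltnn subnn.
- move=> P c1 c2 tp h tp1 h1 t Pt _ IH cd pre post o t3 e so.
  pose j2 := IBr pred0 (o + codelen c1 + codelen c2 + 2).
  pose j1 := IBr P (o + codelen c1 + 2).
  pose pre2 := rcons (rcons pre j1 ++ code c1 o.+1) j2.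
  have s2 : size pre2 = o + codelen c1 + 2.
    by rewrite /pre2 size_rcons size_cat size_rcons size_code so; lia.
  have e1 : cd = pre2 ++ code c2 (o + codelen c1 + 2) ++ post.
    by rewrite e /pre2 /= -cats1 !cat_rcons -!catA.
  have -> : t + 1 + t3 = (t + t3).+1 by lia.
  rewrite (@run_br _ _ P (o + codelen c1 + 2)); first last.
  + by rewrite e nth_cat so ltnn subnn.
  + by rewrite e !size_cat /= !size_cat /=; lia.
  rewrite Pt (IH _ _ _ _ _ e1) //=.
  by congr (@tm_run _ _ (inord _, _, _)); lia.
- move=> P c tp h Pt cd pre post o t3 e so.
  rewrite add1n (@run_br _ _ P (o + codelen c + 2)) ?Pt /=; first last.
  + by rewrite e nth_cat so ltnn subnn.
  + by rewrite e !size_cat /= !size_cat /=; lia.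
  by rewrite addnA.
- move=> P c tp h tp1 h1 tp2 h2 t1 t2 Pt _ IH1 _ IH2 cd pre post o t3 e so.
  pose j1 := IBr P (o + codelen c + 2).
  have e1 : cd = rcons pre j1 ++ code c o.+1 ++ (IBr pred0 o :: post).
    by rewrite e /= cat_rcons -!catA.
  have -> : t1 + t2 + 2 + t3 = (t1 + (t2 + t3).+1).+1 by lia.
  rewrite (@run_br _ _ P (o + codelen c + 2)); first last.
  + by rewrite e nth_cat so ltnn subnn.
  + by rewrite e !size_cat /= !size_cat /=; lia.
  rewrite Pt (IH1 _ _ _ _ _ e1); last by rewrite size_rcons so.
  rewrite (@run_br _ _ pred0 o) /=; first exact: IH2 e so.
  + by rewrite e1 !size_cat size_rcons size_code /=; lia.
  + rewrite e1 nth_cat size_rcons so ifF; last by lia.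
    by rewrite addKn nth_cat size_code ltnn subnn.
Qed.

Lemma texec_halt c tp tp' h' t : texec c tp 0 tp' h' t ->
  let M := code_TM (code c 0) in
  @tm_run M t (@tm_start M, tp, 0) = (inord (codelen c), tp', h') /\
  @tm_halted M (inord (codelen c), tp', h').
Proof.
move=> ex M; split.
  have := @texec_run _ _ _ _ _ _ ex (code c 0) [::] [::] 0 0.
  rewrite /= cats0 addn0 => <- //.
  by congr (@tm_run _ _ (_, _, _)); apply: val_inj; rewrite /= inordK.
by rewrite /= inordK size_code ?ltnn // leqnn.
Qed.
End TapePrograms.

(** * Registers and bit arrays on the tape *)

Definition upd (T : Type) (env : nat -> T) (x : nat) (v : T) : nat -> T :=
  fun y => if y == x then v else env y.

Definition arith (op : bool) (a b : nat) : nat := if op then a - b else a + b.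

Inductive arr := AIn | APow | AHist | AFin.

(* Track 0 marks the left end; tracks 2 and 3 hold the emitted output; track
   [7 + r] holds register [r] in unary. *)
Definition atrk (a : arr) : nat :=
  match a with AIn => 1 | APow => 4 | AHist => 5 | AFin => 6 end.

Definition updA (A : arr -> nat -> bool) (a : arr) (i : nat) (b : bool) :=
  fun a' j => if (atrk a' == atrk a) && (j == i) then b else A a' j.

Record mstate := MState {
  regs : nat -> nat; arrs : arr -> nat -> bool; outp : seq bool }.

Definition setr (s : mstate) r v := MState (upd (regs s) r v) (arrs s) (outp s).

Section Tracks.
Variable R : nat.
Notation cell := {ffun 'I_(7 + R) -> bool}.
Definition nsym : nat := #|{: cell}|.
Notation sym := 'I_nsym.+3.

(* The raw symbols 0, 1, 2 (blank and input bits) are read as cells in which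
   only the input track may be set. *)
Definition dec (s : sym) : cell :=
  if s < 3 then [ffun i : 'I_(7 + R) => (i == 1 :> nat) && (s == 2 :> nat)]
  else nth [ffun=> false] (enum {: cell}) (s - 3).

Definition enc (g : cell) : sym := inord (3 + enum_rank g).

Lemma encK : cancel enc dec.
Proof.
move=> g; have lt : enum_rank g < nsym := ltn_ord _.
by rewrite /dec /enc inordK ?ltnS //=; rewrite ?subn0 !subSS ?subn0 nth_enum_rank.
Qed.

Definition trk (j : nat) (s : sym) : bool := dec s (inord j).
Definition stk (j : nat) (b : bool) (s : sym) : sym :=
  enc [ffun i : 'I_(7 + R) => if i == j :> nat then b else dec s i].

Lemma trk_stk j j' b s : j < 7 + R ->
  trk j (stk j' b s) = if j == j' then b else trk j s.
Proof. by move=> lt; rewrite /trk /stk encK ffunE inordK. Qed.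

(** An output bit is a mark on track 2 if false and on track 3 if true, so the first cell without
    either mark is the end of the output. *)
Record rep (s : mstate) (tp : nat -> sym) : Prop := Rep {
  rep_left : forall i, trk 0 (tp i) = (i == 0);
  rep_arr : forall a i, trk (atrk a) (tp i) = arrs s a i;
  rep_out0 : forall i, trk 2 (tp i) = (i < size (outp s)) && ~~ nth false (outp s) i;
  rep_out1 : forall i, trk 3 (tp i) = (i < size (outp s)) && nth false (outp s) i;
  rep_reg : forall r i, r < R -> trk (7 + r) (tp i) = (i < regs s r) }.

(** The head is on cell 0 before and after each command, so commands compose without any account of
    its position. *)
Definition run1 (c : tcmd nsym) (s : mstate) (T : nat) (s' : mstate) : Prop :=
  forall tp, rep s tp -> exists tp' t,
    [/\ t <= T, texec c tp 0 tp' 0 t & rep s' tp'].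

Lemma run1_seq c1 c2 s s1 s2 T1 T2 : run1 c1 s T1 s1 -> run1 c2 s1 T2 s2 ->
  run1 (TSeq c1 c2) s (T1 + T2) s2.
Proof.
move=> H1 H2 tp /H1 [tp1 [t1 [le1 e1 /H2 [tp2 [t2 [le2 e2 r2]]]]]].
by exists tp2, (t1 + t2); split=> //; [exact: leq_add | apply: XSeq e1 e2].
Qed.

Lemma run1_le c s s1 T T' : run1 c s T s1 -> T <= T' -> run1 c s T' s1.
Proof.
move=> H le tp /H [tp1 [t1 [le1 e1 r]]].
by exists tp1, t1; split=> //; apply: leq_trans le.
Qed.

Lemma texec_sweep (P : pred sym) f tp h h0 :
  (forall i, h0 <= i < h -> P (tp i)) -> P (tp h) = false -> h0 <= h ->
  texec (TWhile P (TAct f MoveR)) tp h0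
    (fun i => if h0 <= i < h then f (tp i) else tp i) h (3 * (h - h0) + 1).
Proof.
move E: (h - h0) => d; elim: d h0 tp E => [|d IH] h0 tp E HP Hh le.
  have -> : h0 = h by lia.
  have -> : (fun i => if h <= i < h then f (tp i) else tp i) = tp.
    by apply: functional_extensionality => i; rewrite ifF //; lia.
  exact: XWhF.
have -> : 3 * d.+1 + 1 = 1 + (3 * d + 1) + 2 by lia.
apply: XWhT; [by apply: HP; lia | exact: XAct |] => /=.
have -> : (fun i => if h0 <= i < h then f (tp i) else tp i) =
   (fun i => if h0 < i < h then f (put tp h0 (f (tp h0)) i)
             else put tp h0 (f (tp h0)) i).
  apply: functional_extensionality => i; rewrite /put.
  case: eqP => [->|ne]; first by rewrite ltnn leqnn /= ifT //; lia.
  by have -> : (h0 <= i < h) = (h0 < i < h) by lia.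
apply: IH; [lia | | | lia].
- by move=> i hi; rewrite /put ifF; [apply: HP; lia | lia].
- by rewrite /put ifF //; lia.
Qed.

Definition rewind : tcmd nsym := TWhile (fun s => ~~ trk 0 s) (TAct id MoveL).

Lemma texec_rewind tp h : (forall i, trk 0 (tp i) = (i == 0)) ->
  texec rewind tp h tp 0 (3 * h + 1).
Proof.
move=> H; elim: h => [|h IH]; first by apply: XWhF; rewrite H.
have -> : 3 * h.+1 + 1 = 1 + (3 * h + 1) + 2 by lia.
apply: XWhT; [by rewrite H | exact: XAct |].
by rewrite /= put_id.
Qed.

(** With unary registers most primitives are one sweep: apply [f] to the maximal prefix of cells
    satisfying [P], apply [g] to the next cell, and return to the left end. *)
Definition mac (P : pred sym) f g : tcmd nsym :=
  TSeq (TWhile P (TAct f MoveR)) (TSeq (TAct g MoveS) rewind).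

Definition swept (f g : sym -> sym) h (tp : nat -> sym) :=
  fun i => if i < h then f (tp i) else if i == h then g (tp i) else tp i.

Lemma run1_mac (P : pred sym) f g h s s' :
  (forall tp, rep s tp -> (forall i, i < h -> P (tp i)) /\ P (tp h) = false) ->
  (forall tp, rep s tp -> rep s' (swept f g h tp)) ->
  run1 (mac P f g) s (6 * h + 3) s'.
Proof.
move=> HP Hr tp r; exists (swept f g h tp), (6 * h + 3).
have [P1 P2] := HP _ r; have r' := Hr _ r; split=> //.
have -> : 6 * h + 3 = (3 * (h - 0) + 1) + (1 + (3 * h + 1)) by lia.
apply: XSeq; first by apply: texec_sweep.
apply: XSeq; first exact: XAct.
rewrite [shift _ _]/= [X in texec _ X](_ : _ = swept f g h tp).
  by apply: texec_rewind => i; rewrite (rep_left r').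
apply: functional_extensionality => i; rewrite /put /swept !leq0n /= ltnn.
by case: eqP => [->|]; rewrite ?ltnn.
Qed.

Definition okW W (s : mstate) :=
  [/\ 0 < W, forall r, regs s r <= W & size (outp s) <= W].
Definition cW W := 10 * W + 20.

Lemma okW_setr W s r v : okW W s -> v <= W -> okW W (setr s r v).
Proof.
by case=> W0 H1 H2 Hv; split=> // r'; rewrite /= /upd; case: eqP.
Qed.

Lemma atrk_lt a : atrk a < 7 + R. Proof. by case: a => /=; lia. Qed.
Lemma atrk_lt7 a : 1 <= atrk a < 7. Proof. by case: a. Qed.
Lemma atrk_out a : (atrk a == 2) = false /\ (atrk a == 3) = false.
Proof. by case: a. Qed.

Definition INC r : tcmd nsym := mac (trk (7 + r)) id (stk (7 + r) true).
Definition CLEAR r : tcmd nsym := mac (trk (7 + r)) (stk (7 + r) false) id.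
Definition COPY r d : tcmd nsym :=
  mac (fun s => trk (7 + r) s || trk (7 + d) s)
      (fun s => stk (7 + d) (trk (7 + r) s) s) id.

(** A register command touches a single track, so a cell-by-cell description of that track suffices
    to re-establish the whole representation. *)
Lemma rep_retrack s tp tp' r v : r < R -> rep s tp ->
  (forall i, exists2 b, tp' i = stk (7 + r) b (tp i) \/ tp' i = tp i /\ trk (7 + r) (tp i) = b
      & b = (i < v)) ->
  rep (setr s r v) tp'.
Proof.
move=> rR rp H.
have other j i : j < 7 + R -> j != 7 + r -> trk j (tp' i) = trk j (tp i).
  move=> jl /negPf jne; have [b [->|[-> _]] _] := H i => //.
  by rewrite trk_stk // jne.
have same i : trk (7 + r) (tp' i) = (i < v).
  have [b [->|[-> ->]] ->] := H i => //.
  by rewrite trk_stk ?ltn_add2l // eqxx.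
split.
- by move=> i; rewrite other ?(rep_left rp) //; lia.
- move=> a i; have al := atrk_lt7 a; rewrite other ?(rep_arr rp) //; lia.
- by move=> i; rewrite other ?(rep_out0 rp) //; lia.
- by move=> i; rewrite other ?(rep_out1 rp) //; lia.
- move=> r' i r'R; rewrite /= /upd; case: eqP => [->|ne]; first exact: same.
  by rewrite other ?(rep_reg rp) //; lia.
Qed.

Lemma run1_INC r s W : r < R -> okW W s ->
  run1 (INC r) s (cW W) (setr s r (regs s r).+1).
Proof.
move=> rR [W0 HW _]; apply: (@run1_le _ _ _ (6 * regs s r + 3)); last first.
  by rewrite /cW; have := HW r; lia.
apply: run1_mac => tp rp.
  by split=> [i lt|]; rewrite (rep_reg rp) // ltnn.
apply: (rep_retrack rR rp) => i; rewrite /swept; exists (i < (regs s r).+1) => //.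
case: (ltngtP i (regs s r)) => c.
- right; rewrite (rep_reg rp) //; split=> //; lia.
- right; rewrite (rep_reg rp) //; split=> //; lia.
- by left; congr stk; lia.
Qed.

Lemma run1_CLEAR r s W : r < R -> okW W s -> run1 (CLEAR r) s (cW W) (setr s r 0).
Proof.
move=> rR [W0 HW _]; apply: (@run1_le _ _ _ (6 * regs s r + 3)); last first.
  by rewrite /cW; have := HW r; lia.
apply: run1_mac => tp rp.
  by split=> [i lt|]; rewrite (rep_reg rp) // ltnn.
apply: (rep_retrack rR rp) => i; rewrite /swept; exists (i < 0) => //.
case: (ltngtP i (regs s r)) => c; first by left.
- right; rewrite (rep_reg rp) //; split=> //; lia.
- by right; rewrite (rep_reg rp) //; split=> //; lia.
Qed.

Lemma run1_COPY r d s W : r < R -> d < R -> okW W s ->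
  run1 (COPY r d) s (cW W) (setr s d (regs s r)).
Proof.
move=> rR dR [W0 HW _].
apply: (@run1_le _ _ _ (6 * (maxn (regs s r) (regs s d)) + 3)); last first.
  by rewrite /cW; have := HW r; have := HW d; lia.
apply: run1_mac => tp rp.
  by split=> [i lt|]; rewrite !(rep_reg rp) //; lia.
apply: (rep_retrack dR rp) => i; rewrite /swept; exists (i < regs s r) => //.
case: ltngtP => c.
- by left; rewrite (rep_reg rp).
- right; rewrite (rep_reg rp) //; split=> //; lia.
- by right; rewrite (rep_reg rp) //; split=> //; lia.
Qed.

(** On a zero register the head cannot move left of cell 0, and clearing the absent mark there is
    harmless, so the result is the truncated predecessor. *)
Definition DEC r : tcmd nsym :=
  TSeq (TWhile (trk (7 + r)) (TAct id MoveR))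
    (TSeq (TAct id MoveL) (TSeq (TAct (stk (7 + r) false) MoveS) rewind)).

Lemma sweep_id (tp : nat -> sym) h0 h :
  (fun i => if h0 <= i < h then id (tp i) else tp i) = tp.
Proof. by apply: functional_extensionality => i; case: ifP. Qed.

Lemma run1_DEC r s W : r < R -> okW W s ->
  run1 (DEC r) s (cW W) (setr s r (regs s r).-1).
Proof.
move=> rR [W0 HW _] tp rp; set h := regs s r.
pose tp' := put tp h.-1 (stk (7 + r) false (tp h.-1)).
have rp' : rep (setr s r h.-1) tp'.
  apply: (rep_retrack rR rp) => i; exists (i < h.-1) => //.
  rewrite /tp' /put; case: eqP => [->|ne]; first by left; rewrite ltnn.
  by right; rewrite (rep_reg rp) // -/h; split=> //; lia.
exists tp', ((3 * (h - 0) + 1) + (1 + (1 + (3 * h.-1 + 1)))); split=> //.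
  by have := HW r; rewrite -/h /cW; lia.
apply: XSeq.
  by apply: texec_sweep => // [i|]; rewrite (rep_reg rp) //; rewrite /h; lia.
rewrite sweep_id; apply: XSeq; first exact: XAct.
rewrite /= put_id; apply: XSeq; first exact: XAct.
by apply: texec_rewind => i; rewrite -/tp' (rep_left rp').
Qed.

(** The bit found at the cell addressed by [r] is carried back in the control state: both branches
    rewind, and only one then marks cell 0 of track [7 + d]. *)
Definition READ a r d : tcmd nsym :=
  TSeq (CLEAR d) (TSeq (TWhile (trk (7 + r)) (TAct id MoveR))
    (TIf (trk (atrk a)) (TSeq rewind (TAct (stk (7 + d) true) MoveS)) rewind)).

Lemma run1_READ a r d s W : r < R -> d < R -> r != d -> okW W s ->
  run1 (READ a r d) s (2 * cW W) (setr s d (arrs s a (regs s r))).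
Proof.
move=> rR dR ne ok; rewrite mul2n -addnn; apply: run1_seq (run1_CLEAR dR ok) _.
case: ok => W0 HW _ tp rp; set h := regs s r.
have hr : regs (setr s d 0) r = h by rewrite /= /upd (negPf ne).
have sw : texec (TWhile (trk (7 + r)) (TAct id MoveR)) tp 0 tp h (3 * (h - 0) + 1).
  rewrite -[X in texec _ _ _ X](sweep_id tp 0 h).
  by apply: texec_sweep => // [i|]; rewrite (rep_reg rp) // hr ?ltnn.
have rA := rep_arr rp a h; rewrite /= in rA.
have HWr := HW r; rewrite -/h in HWr.
case E: (arrs s a h) in rA *.
- pose tp' := put tp 0 (stk (7 + d) true (tp 0)).
  exists tp', ((3 * (h - 0) + 1) + (((3 * h + 1) + 1) + 2)); split=> //.
  + by rewrite /cW; lia.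
  + apply: XSeq sw _; apply: XIfT => //; apply: XSeq; last exact: XAct.
    by apply: texec_rewind => i; rewrite (rep_left rp).
  + have -> : setr s d true = setr (setr s d 0) d 1.
      rewrite /setr /=; congr MState; apply: functional_extensionality => x.
      by rewrite /upd; case: eqP.
    apply: (rep_retrack dR rp) => i; exists (i < 1) => //.
    rewrite /tp' /put; case: eqP => [->|ni]; first by left.
    right; rewrite (rep_reg rp) // /= /upd eqxx; split=> //; lia.
- exists tp, ((3 * (h - 0) + 1) + ((3 * h + 1) + 1)); split=> //.
  + by rewrite /cW; lia.
  + apply: XSeq sw _; apply: XIfF => //.
    by apply: texec_rewind => i; rewrite (rep_left rp).
Qed.

Definition WRITE a r d : tcmd nsym :=
  TIf (trk (7 + d)) (mac (trk (7 + r)) id (stk (atrk a) true))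
                    (mac (trk (7 + r)) id (stk (atrk a) false)).

Lemma atrk_inj a b : atrk a = atrk b -> a = b. Proof. by case: a; case: b. Qed.

Lemma run1_WRITE a r d s W : r < R -> d < R -> okW W s ->
  run1 (WRITE a r d) s (cW W)
    (MState (regs s) (updA (arrs s) a (regs s r) (regs s d != 0)) (outp s)).
Proof.
move=> rR dR [W0 HW _]; set h := regs s r.
have HWr : h <= W := HW r.
have main b : run1 (mac (trk (7 + r)) id (stk (atrk a) b)) s (6 * h + 3)
    (MState (regs s) (updA (arrs s) a h b) (outp s)).
  apply: run1_mac => tp rp.
    by split=> [i lt|]; rewrite (rep_reg rp) // -/h ltnn.
  have al := atrk_lt7 a.
  have other j i : j < 7 + R -> j != atrk a ->
      trk j (swept id (stk (atrk a) b) h tp i) = trk j (tp i).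
    move=> jl /negPf jn; rewrite /swept; case: ltngtP => // _.
    by rewrite trk_stk // jn.
  have [n2 n3] := atrk_out a.
  split=> /=.
  - by move=> i; rewrite other ?(rep_left rp) //; lia.
  - move=> a' i; rewrite /updA; case: eqP => [e|/eqP ne] /=; last first.
      by rewrite other ?(rep_arr rp) // atrk_lt.
    rewrite -(atrk_inj (esym e)) /swept; case: ltngtP => c; rewrite ?(rep_arr rp) //.
    by rewrite trk_stk ?eqxx // atrk_lt.
  - by move=> i; rewrite other ?(rep_out0 rp) //; lia.
  - by move=> i; rewrite other ?(rep_out1 rp) //; lia.
  - by move=> r' i r'R; rewrite other ?(rep_reg rp) //; lia.
move=> tp rp; have t0 := rep_reg rp 0 dR.
case E: (regs s d != 0).
- have [tp' [t [le ex r']]] := main true _ rp.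
  exists tp', (t + 2); split=> //; first by rewrite /cW; lia.
  by apply: XIfT ex; rewrite t0 lt0n E.
- have [tp' [t [le ex r']]] := main false _ rp.
  exists tp', (t + 1); split=> //; first by rewrite /cW; lia.
  by apply: XIfF ex; rewrite t0 lt0n E.
Qed.

Definition EMIT d : tcmd nsym :=
  let P s := trk 2 s || trk 3 s in
  TIf (trk (7 + d)) (mac P id (stk 3 true)) (mac P id (stk 2 true)).

Lemma run1_EMIT d s W : d < R -> okW W s ->
  run1 (EMIT d) s (cW W) (MState (regs s) (arrs s) (rcons (outp s) (regs s d != 0))).
Proof.
move=> dR [W0 HW HL]; set h := size (outp s).
have HWr : h <= W := HL.
have main (b : bool) : run1 (mac (fun s => trk 2 s || trk 3 s) id (stk (2 + b) true)) s
    (6 * h + 3) (MState (regs s) (arrs s) (rcons (outp s) b)).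
  apply: run1_mac => tp rp.
    split=> [i lt|]; rewrite (rep_out0 rp) (rep_out1 rp) -/h ?ltnn // lt.
    by case: (nth _ _ _).
  have other j i : j < 7 + R -> j != 2 + b ->
      trk j (swept id (stk (2 + b) true) h tp i) = trk j (tp i).
    move=> jl /negPf jn; rewrite /swept; case: ltngtP => // _.
    by rewrite trk_stk // jn.
  have same i : trk (2 + b) (swept id (stk (2 + b) true) h tp i) =
      (i == h) || trk (2 + b) (tp i).
    rewrite /swept; case: ltngtP => // _; rewrite trk_stk ?eqxx //.
    by case: (b); lia.
  split=> /=.
  - by move=> i; rewrite other ?(rep_left rp) //; lia.
  - move=> a' i; have [n2' n3'] := atrk_out a'.
    by rewrite other ?(rep_arr rp) ?atrk_lt //; case: (b); rewrite ?n2' ?n3'.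
  - move=> i; rewrite size_rcons nth_rcons -/h; case: b other same => other same.
    + rewrite other // (rep_out0 rp) -/h; case: ltngtP => //= c; lia.
    + rewrite same (rep_out0 rp) -/h; case: ltngtP => //= c; lia.
  - move=> i; rewrite size_rcons nth_rcons -/h; case: b other same => other same.
    + rewrite same (rep_out1 rp) -/h; case: ltngtP => //= c; lia.
    + rewrite other // (rep_out1 rp) -/h; case: ltngtP => //= c; lia.
  - by move=> r' i r'R; rewrite other ?(rep_reg rp) //; case: (b); lia.
move=> tp rp; have t0 := rep_reg rp 0 dR.
case E: (regs s d != 0).
- have [tp' [t [le ex r']]] := main true _ rp.
  exists tp', (t + 2); split=> //; first by rewrite /cW; lia.
  by apply: XIfT ex; rewrite t0 lt0n E.
- have [tp' [t [le ex r']]] := main false _ rp.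
  exists tp', (t + 1); split=> //; first by rewrite /cW; lia.
  by apply: XIfF ex; rewrite t0 lt0n E.
Qed.

Lemma run1_if_zero r c s : r < R -> regs s r = 0 ->
  run1 (TWhile (trk (7 + r)) c) s 1 s.
Proof.
move=> rR e tp rp; exists tp, 1; split=> //.
by apply: XWhF; rewrite (rep_reg rp) // e.
Qed.

Lemma run1_while_step r c s s1 s2 T1 T2 : r < R -> 0 < regs s r ->
  run1 c s T1 s1 -> run1 (TWhile (trk (7 + r)) c) s1 T2 s2 ->
  run1 (TWhile (trk (7 + r)) c) s (T1 + T2 + 2) s2.
Proof.
move=> rR p H1 H2 tp rp.
have [tp1 [t1 [le1 e1 /H2 [tp2 [t2 [le2 e2 r2]]]]]] := H1 _ rp.
exists tp2, (t1 + t2 + 2); split=> //; first by lia.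
by apply: XWhT e1 e2; rewrite (rep_reg rp).
Qed.

(** The counter register runs down while the index of the invariant runs up. The 2 in each summand
    pays for the test and the back jump, the final 1 for the failing test. *)
Lemma run1_drain r c (I : nat -> mstate -> Prop) (T : nat -> nat) m :
  r < R ->
  (forall v s, v < m -> I v s -> regs s r = m - v) ->
  (forall s, I m s -> regs s r = 0) ->
  (forall v s, v < m -> I v s -> exists2 s', run1 c s (T v) s' & I v.+1 s') ->
  forall s, I 0 s -> exists2 s', run1 (TWhile (trk (7 + r)) c) s
     (\sum_(i < m) (T i + 2) + 1) s' & I m s'.
Proof.
move=> rR Hr Hm Hstep s I0.
suff H : forall d v s, v + d = m -> I v s ->
   exists2 s', run1 (TWhile (trk (7 + r)) c) s
      (\sum_(v <= i < m) (T i + 2) + 1) s' & I m s'.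
  have [s' rs' Is'] := H m 0 s (erefl _) I0.
  by exists s' => //; move: rs'; rewrite big_mkord.
elim=> [|d IH] v s1 e I1.
  have {e} ev : v = m by lia.
  exists s1; last by rewrite -ev.
  rewrite ev big_geq // add0n; apply: run1_if_zero => //; apply: Hm; by rewrite -ev.
have lt : v < m by lia.
have [s2 r2 I2] := Hstep _ _ lt I1.
have [s3 r3 I3] := IH v.+1 s2 ltac:(lia) I2.
exists s3 => //; apply: (run1_le (run1_while_step rR _ r2 r3)).
  by rewrite (Hr _ _ lt I1); lia.
by rewrite [X in _ <= X + 1]big_ltn //; lia.
Qed.

Definition ACC op d e : tcmd nsym :=
  TWhile (trk (7 + e)) (TSeq (DEC e) (if op then DEC d else INC d)).

Lemma regs_setr s r v x : regs (setr s r v) x = if x == r then v else regs s x.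
Proof. by []. Qed.

Lemma setr_eq s t : regs s =1 regs t -> arrs s = arrs t -> outp s = outp t -> s = t.
Proof.
case: s => r1 a1 o1; case: t => r2 a2 o2 /= H -> ->; congr MState.
exact: functional_extensionality.
Qed.

Lemma drain_cost c v : \sum_(i < v) (2 * c + 2) + 1 <= (3 * v + 1) * (c + 2).
Proof. by rewrite sum_nat_const card_ord; nia. Qed.

Lemma run1_ACC op d e s W : d < R -> e < R -> d != e -> okW W s ->
  arith op (regs s d) (regs s e) <= W ->
  run1 (ACC op d e) s ((3 * regs s e + 1) * (cW W + 2))
    (setr (setr s e 0) d (arith op (regs s d) (regs s e))).
Proof.
move=> dR eR ne ok le; have [_ okr _] := ok.
pose I v t := t = setr (setr s e (regs s e - v)) d (arith op (regs s d) v) /\ v <= regs s e.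
have ne' : (e == d) = false by rewrite eq_sym (negPf ne).
have h1 v t : v < regs s e -> I v t -> regs t e = regs s e - v.
  by move=> lt [-> _]; rewrite !regs_setr ne' eqxx.
have h2 t : I (regs s e) t -> regs t e = 0.
  by move=> [-> _]; rewrite !regs_setr ne' eqxx subnn.
have h3 v t : v < regs s e -> I v t ->
    exists2 t', run1 (TSeq (DEC e) (if op then DEC d else INC d)) t (2 * cW W) t' & I v.+1 t'.
  move=> lt [-> _]; set t0 := setr _ d _; set t1 := setr t0 e (regs s e - v).-1.
  have ok0 : okW W t0.
    apply: okW_setr; first by apply: okW_setr => //; have := okr e; lia.
    by have := okr d; rewrite /arith; case: (op) le => /=; lia.
  have e0 : regs t0 e = regs s e - v by rewrite /t0 !regs_setr ne' eqxx.
  have d1 : regs t1 d = arith op (regs s d) v by rewrite /t1 /t0 !regs_setr (negPf ne) eqxx.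
  have ok1 : okW W t1 by apply: okW_setr => //; have := okr e; lia.
  exists (setr t1 d (arith op (regs s d) v.+1)).
    rewrite mul2n -addnn; apply: (@run1_seq _ _ _ t1); first by rewrite /t1 -e0; apply: run1_DEC.
    rewrite [arith _ _ _](_ : _ = if op then (regs t1 d).-1 else (regs t1 d).+1).
      by case: (op); [apply: run1_DEC | apply: run1_INC].
    by rewrite d1; case: (op); rewrite /= ?subnS ?addnS.
  split=> //; apply: setr_eq => // x; rewrite !regs_setr; case: (x =P d) => // _.
  by rewrite /t0 ?regs_setr; case: eqP => // _; lia.
have h0 : I 0 s.
  split=> //; apply: setr_eq => // x; rewrite !regs_setr.
  case: eqP => [->|_]; first by case: (op); rewrite /= ?subn0 ?addn0.
  by case: eqP => [->|] //; rewrite subn0.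
have [s' rs' [Is' _]] := run1_drain eR h1 h2 h3 h0.
rewrite subnn in Is'; rewrite -Is'.
exact: run1_le rs' (drain_cost _ _).
Qed.
End Tracks.

(** * A language of bounded loops *)

(** The bounded sum is the only iteration; products, quotients, quantifiers and comparisons are all
    derived from it together with addition and truncated subtraction. *)
Inductive expr :=
| EC (c : nat) | EV (x : nat) | EA (a : arr) (e : expr)
| EOp (op : bool) (e1 e2 : expr) | ESum (x : nat) (e1 e2 : expr).

Fixpoint eval (A : arr -> nat -> bool) (env : nat -> nat) (e : expr) : nat :=
  match e with
  | EC c => c
  | EV x => env x
  | EA a e => A a (eval A env e)
  | EOp op e1 e2 => arith op (eval A env e1) (eval A env e2)
  | ESum x e1 e2 => \sum_(i < eval A env e1) eval A (upd env x i) e2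
  end.

(** Time in units of [cW W + 2], which pays for one primitive; [3 v + 1] units pay for draining a
    register of value [v] into another. *)
Fixpoint stepsE (A : arr -> nat -> bool) (env : nat -> nat) (e : expr) : nat :=
  match e with
  | EC c => c.+1
  | EV x => 1
  | EA a e => stepsE A env e + 3
  | EOp _ e1 e2 =>
      stepsE A env e1 + stepsE A env e2 + (3 * eval A env e2 + 1)
  | ESum x e1 e2 => stepsE A env e1 + 5 +
      \sum_(i < eval A env e1)
        (stepsE A (upd env x i) e2 + 3 * eval A (upd env x i) e2 + 4)
  end.

Fixpoint okE (W : nat) (A : arr -> nat -> bool) (env : nat -> nat) (e : expr) : Prop :=
  match e with
  | EC c => c <= W
  | EV x => True
  | EA a e => okE W A env e
  | EOp op e1 e2 => [/\ okE W A env e1, okE W A env e2 &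
                        arith op (eval A env e1) (eval A env e2) <= W]
  | ESum x e1 e2 => [/\ okE W A env e1,
       forall i, i < eval A env e1 -> okE W A (upd env x i) e2 &
       \sum_(i < eval A env e1) eval A (upd env x i) e2 <= W]
  end.

Fixpoint wfE (v : nat) (e : expr) : bool :=
  match e with
  | EC _ => true
  | EV x => x < v
  | EA _ e => wfE v e
  | EOp _ e1 e2 => wfE v e1 && wfE v e2
  | ESum x e1 e2 => [&& x < v, wfE v e1 & wfE v e2]
  end.

Fixpoint depE (e : expr) : nat :=
  match e with
  | EC _ | EV _ => 1
  | EA _ e => maxn (depE e) 2
  | EOp _ e1 e2 => maxn (depE e1) (depE e2).+1
  | ESum _ e1 e2 => maxn (depE e1).+1 (depE e2).+3
  end.

Lemma depE_gt0 e : 0 < depE e.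
Proof. by elim: e => //= *; lia. Qed.

Inductive com :=
| CSeq (c1 c2 : com)
| CFor (x : nat) (e : expr) (c : com) | CLet (x : nat) (e : expr) (c : com)
| CSet (a : arr) (e1 e2 : expr) | CEmit (e : expr).

Definition store := ((arr -> nat -> bool) * seq bool)%type.

Definition iterC (f : nat -> store -> store) (m : nat) (s : store) : store :=
  foldl (fun s i => f i s) s (iota 0 m).

Lemma iterC_S f m s : iterC f m.+1 s = f m (iterC f m s).
Proof. by rewrite /iterC -addn1 iotaD foldl_cat. Qed.

Fixpoint evalC (env : nat -> nat) (c : com) (s : store) : store :=
  match c with
  | CSeq c1 c2 => evalC env c2 (evalC env c1 s)
  | CFor x e c => iterC (fun i => evalC (upd env x i) c) (eval s.1 env e) s
  | CLet x e c => evalC (upd env x (eval s.1 env e)) c s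
  | CSet a e1 e2 => (updA s.1 a (eval s.1 env e1) (eval s.1 env e2 != 0), s.2)
  | CEmit e => (s.1, rcons s.2 (eval s.1 env e != 0))
  end.

Fixpoint stepsC (env : nat -> nat) (c : com) (s : store) : nat :=
  match c with
  | CSeq c1 c2 => stepsC env c1 s + stepsC env c2 (evalC env c1 s)
  | CFor x e c => stepsE s.1 env e + 4 + \sum_(i < eval s.1 env e)
      (stepsC (upd env x i) c (iterC (fun i => evalC (upd env x i) c) i s) + 3)
  | CLet x e c => stepsE s.1 env e + 3 + stepsC (upd env x (eval s.1 env e)) c s
  | CSet a e1 e2 => stepsE s.1 env e1 + stepsE s.1 env e2 + 1
  | CEmit e => stepsE s.1 env e + 1
  end.

Fixpoint okC (W : nat) (env : nat -> nat) (c : com) (s : store) : Prop :=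
  match c with
  | CSeq c1 c2 => okC W env c1 s /\ okC W env c2 (evalC env c1 s)
  | CFor x e c => okE W s.1 env e /\ forall i, i < eval s.1 env e ->
      okC W (upd env x i) c (iterC (fun i => evalC (upd env x i) c) i s)
  | CLet x e c => okE W s.1 env e /\ okC W (upd env x (eval s.1 env e)) c s
  | CSet a e1 e2 => okE W s.1 env e1 /\ okE W s.1 env e2
  | CEmit e => okE W s.1 env e /\ size s.2 < W
  end.

Fixpoint wfC (v : nat) (c : com) : bool :=
  match c with
  | CSeq c1 c2 => wfC v c1 && wfC v c2
  | CFor x e c | CLet x e c => [&& x < v, wfE v e & wfC v c]
  | CSet _ e1 e2 => wfE v e1 && wfE v e2
  | CEmit e => wfE v e
  end.

Fixpoint depC (c : com) : nat :=
  match c with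
  | CSeq c1 c2 => maxn (depC c1) (depC c2)
  | CFor _ e c | CLet _ e c => maxn (maxn (depE e) 2) (depC c).+2
  | CSet _ e1 e2 => maxn (depE e1) (depE e2).+1
  | CEmit e => depE e
  end.

(** * Compiling bounded loops to tape programs *)

Section Compile.
Variable R : nat.

(** The result goes to register [d], and registers above are scratch. A sum keeps the accumulator in
    [d], the countdown in [d.+1], the shadowed value of [x] in [d.+2] and the current term in
    [d.+3]. *)
Fixpoint compE (e : expr) (d : nat) : tcmd (nsym R) :=
  match e with
  | EC c => iter c (fun p => TSeq p (INC R d)) (CLEAR R d)
  | EV x => COPY R x d
  | EA a e => TSeq (compE e d) (TSeq (READ R a d d.+1) (COPY R d.+1 d))
  | EOp op e1 e2 => TSeq (compE e1 d) (TSeq (compE e2 d.+1) (ACC R op d d.+1))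
  | ESum x e1 e2 => TSeq (compE e1 d.+1) (TSeq (COPY R x d.+2) (TSeq (CLEAR R x)
      (TSeq (CLEAR R d) (TSeq
      (TWhile (trk (7 + d.+1)) (TSeq (DEC R d.+1)
        (TSeq (compE e2 d.+3) (TSeq (ACC R false d d.+3) (INC R x)))))
      (COPY R d.+2 x)))))
  end.

Fixpoint compC (c : com) (d : nat) : tcmd (nsym R) :=
  match c with
  | CSeq c1 c2 => TSeq (compC c1 d) (compC c2 d)
  | CFor x e c => TSeq (compE e d) (TSeq (COPY R x d.+1) (TSeq (CLEAR R x) (TSeq
      (TWhile (trk (7 + d)) (TSeq (DEC R d) (TSeq (compC c d.+2) (INC R x))))
      (COPY R d.+1 x))))
  | CLet x e c => TSeq (compE e d) (TSeq (COPY R x d.+1) (TSeq (COPY R d x)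
      (TSeq (compC c d.+2) (COPY R d.+1 x))))
  | CSet a e1 e2 => TSeq (compE e1 d) (TSeq (compE e2 d.+1) (WRITE R a d d.+1))
  | CEmit e => TSeq (compE e d) (EMIT R d)
  end.

Definition keep d (s s' : mstate) :=
  [/\ arrs s' = arrs s, outp s' = outp s & forall r, r < d -> regs s' r = regs s r].

Variables (v0 W : nat).
Notation u := (cW W + 2).

Lemma run1_mul c s s' k T : run1 c s (k * T) s' -> run1 (R := R) c s (k * (T + 2)) s'.
Proof. by move=> H; apply: run1_le H _; nia. Qed.

Lemma run1_one c s s' : run1 c s (cW W) s' -> run1 (R := R) c s u s'.
Proof. by move=> H; apply: run1_le H _; lia. Qed.

Ltac tape_step := apply: run1_one;
  first [apply: run1_INC | apply: run1_DEC | apply: run1_CLEAR | apply: run1_COPY] => //; lia.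

Lemma compE_EC c d s : d < R -> okW W s -> c <= W ->
  run1 (compE (EC c) d) s (c.+1 * u) (setr s d c).
Proof.
move=> dR ok; elim: c => [|c IH] le.
  by rewrite mul1n; apply: run1_one; apply: run1_CLEAR.
rewrite mulSn addnC; apply: run1_seq (IH (ltnW le)) _; apply: run1_one.
have -> : setr s d c.+1 = setr (setr s d c) d (regs (setr s d c) d).+1.
  by apply: setr_eq => // x; rewrite !regs_setr eqxx; case: eqP.
by apply: run1_INC => //; apply: okW_setr => //; lia.
Qed.

Lemma compE_ok e : forall d env s,
  wfE v0 e -> v0 <= d -> d + depE e <= R -> okW W s -> okE W (arrs s) env e ->
  (forall r, r < v0 -> regs s r = env r) ->
  exists s', [/\ run1 (compE e d) s (stepsE (arrs s) env e * u) s', okW W s',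
                 keep d s s' & regs s' d = eval (arrs s) env e].
Proof.
elim: e => [c|x|a e IH|op e1 IH1 e2 IH2|x e1 IH1 e2 IH2]
  d env s; rewrite [wfE _ _]/= [depE _]/=.
- move=> _ v0d dR ok /= okc Henv; exists (setr s d c); split.
  + by apply: (compE_EC (d := d)) => //; lia.
  + exact: okW_setr.
  + by split=> // r lt; rewrite regs_setr; case: eqP => //; lia.
  + by rewrite regs_setr eqxx.
- move=> xv v0d dR ok _ Henv; exists (setr s d (regs s x)); split.
  + by rewrite [stepsE _ _ _]/= mul1n; apply: run1_one; apply: run1_COPY => //; lia.
  + by apply: okW_setr => //; case: ok => _ H _; apply: H.
  + by split=> // r lt; rewrite regs_setr; case: eqP => //; lia.
  + by rewrite regs_setr eqxx Henv.
- move=> wf v0d dR ok okE1 Henv.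
  have [s1 [r1 ok1 [k1 k2 k3] v1]] := IH d env s wf v0d ltac:(lia) ok okE1 Henv.
  pose b : nat := arrs s1 a (regs s1 d).
  have b1 : b <= W by rewrite /b; case: ok => + _ _; case: (arrs _ _ _); lia.
  have ok2 : okW W (setr s1 d.+1 b) by apply: okW_setr.
  exists (setr (setr s1 d.+1 b) d b); split.
  + rewrite /= mulnDl; apply: run1_seq r1 _.
    rewrite (_ : 3 * u = 2 * u + u); last by lia.
    apply: run1_seq; first by apply: run1_mul; apply: run1_READ ok1; lia.
    have -> : setr (setr s1 d.+1 b) d b =
      setr (setr s1 d.+1 b) d (regs (setr s1 d.+1 b) d.+1) by rewrite regs_setr eqxx.
    by tape_step.
  + exact: okW_setr.
  + split=> // r lt; rewrite !regs_setr k3 //.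
    by rewrite !ifF //; lia.
  + by rewrite !regs_setr eqxx /b k1 v1.
- case/andP=> wf1 wf2 v0d dR ok [okE1 okE2 le] Henv.
  have D1 := depE_gt0 e1; have D2 := depE_gt0 e2.
  have [s1 [r1 ok1 [k1 k2 k3] v1]] := IH1 d env s wf1 v0d ltac:(lia) ok okE1 Henv.
  have Henv1 r : r < v0 -> regs s1 r = env r by move=> lt; rewrite k3 ?Henv //; lia.
  rewrite -k1 in okE2.
  have [s2 [r2 ok2 [l1 l2 l3] v2]] :=
    IH2 d.+1 env s1 wf2 ltac:(lia) ltac:(lia) ok1 okE2 Henv1.
  have v1' : regs s2 d = eval (arrs s) env e1 by rewrite l3 // ltnSn.
  rewrite k1 in v2 r2.
  exists (setr (setr s2 d.+1 0) d (arith op (regs s2 d) (regs s2 d.+1))); split.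
  + apply: (@run1_le _ _ _ _ (stepsE (arrs s) env e1 * u +
      (stepsE (arrs s) env e2 * u + (3 * regs s2 d.+1 + 1) * u))).
      apply: run1_seq r1 _; apply: run1_seq r2 _; apply: run1_ACC => //; try lia.
      by rewrite v1' v2.
    by rewrite /= v2 !mulnDl; lia.
  + apply: okW_setr; first by apply: okW_setr.
    by rewrite v1' v2.
  + split=> [/=|/=|r lt]; rewrite ?l1 ?l2 //.
    by rewrite !regs_setr !ifF ?l3 ?k3 //; lia.
  + by rewrite regs_setr eqxx v1' v2.
- case/and3P=> xv wf1 wf2 v0d dR ok [okE1 okE2 le] Henv.
  have D1 := depE_gt0 e1; have D2 := depE_gt0 e2.
  have [s1 [r1 ok1 [k1 k2 k3] v1]] :=
    IH1 d.+1 env s wf1 ltac:(lia) ltac:(lia) ok okE1 Henv.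
  set m1 := eval _ _ e1 in v1 le okE2.
  pose F i := eval (arrs s) (upd env x i) e2.
  pose I v t := [/\ okW W t, [/\ arrs t = arrs s, outp t = outp s &
       forall r, r < d -> r != x -> regs t r = regs s r], regs t x = v /\ regs t d.+2 = regs s x,
      regs t d.+1 = m1 - v & regs t d = \sum_(i < v) F i].
  have h1 v t : v < m1 -> I v t -> regs t d.+1 = m1 - v by move=> _ [].
  have h2 t : I m1 t -> regs t d.+1 = 0 by case=> _ _ _ ->; rewrite subnn.
  pose T v := (stepsE (arrs s) (upd env x v) e2 + 3 * F v + 3) * u.
  have m1W : m1 <= W by rewrite -v1; case: ok1.
  have h3 v t : v < m1 -> I v t -> exists2 t', run1 (TSeq (DEC R d.+1)
        (TSeq (compE e2 d.+3) (TSeq (ACC R false d d.+3) (INC R x)))) t (T v) t' & I v.+1 t'.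
    move=> lt [okt [a1 a2 a3] [b1 b2] c1 c2].
    pose t1 := setr t d.+1 (regs t d.+1).-1.
    have okt1 : okW W t1 by apply: okW_setr => //; case: okt => _ /(_ d.+1); lia.
    have Ht1 r : r < v0 -> regs t1 r = upd env x v r.
      move=> ltr; rewrite /t1 regs_setr ifF /upd; last by lia.
      by case: eqP => [->|/eqP ne] //; rewrite a3 ?Henv //; lia.
    have okE2' : okE W (arrs t1) (upd env x v) e2 by rewrite /= a1; apply: okE2.
    have [t2 [rr2 okt2 [l1 l2 l3] vv2]] :=
      IH2 d.+3 (upd env x v) t1 wf2 ltac:(lia) ltac:(lia) okt1 okE2' Ht1.
    rewrite [arrs t1]/= a1 -/(F v) in vv2 rr2.
    have d2 : regs t2 d = \sum_(i < v) F i by rewrite l3 ?/t1 ?regs_setr ?ifF //; lia.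
    have d3 : regs t2 d.+1 = m1 - v.+1 by rewrite l3 ?/t1 ?regs_setr ?eqxx ?c1; lia.
    have lem : \sum_(i < v.+1) F i <= W.
      apply: leq_trans le; rewrite -/F -(big_mkord xpredT F) -(big_mkord xpredT F).
      by rewrite (big_cat_nat (leq0n _) lt) /= leq_addr.
    have S1 : \sum_(i < v.+1) F i = regs t2 d + regs t2 d.+3.
      by rewrite big_ord_recr /= d2 vv2.
    pose t3 := setr (setr t2 d.+3 0) d (regs t2 d + regs t2 d.+3).
    have okt3 : okW W t3 by do 2?[apply: okW_setr => //]; rewrite -S1.
    have x3 : regs t3 x = v by rewrite /t3 !regs_setr !ifF ?l3 /t1 ?regs_setr ?ifF //; lia.
    exists (setr t3 x (regs t3 x).+1).
      apply: (@run1_le _ _ _ _ (u + (stepsE (arrs s) (upd env x v) e2 * u +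
         ((3 * F v + 1) * u + u)))); last by rewrite /T; nia.
      apply: run1_seq; first by tape_step.
      apply: run1_seq rr2 _; apply: run1_seq.
        by rewrite -vv2; apply: (run1_ACC (op := false)) => //; try lia; rewrite /= -S1.
      by tape_step.
    split.
    - by apply: okW_setr => //; rewrite x3; lia.
    - split=> [/=|/=|r ltr ne]; rewrite ?l1 ?l2 //.
      by rewrite !regs_setr !ifF ?l3 /t1 ?regs_setr ?ifF ?a3 //; lia.
    - split; first by rewrite regs_setr eqxx x3.
      by rewrite !regs_setr !ifF ?l3 /t1 ?regs_setr ?ifF //; lia.
    - by rewrite !regs_setr !ifF ?d3 //; lia.
    - by rewrite regs_setr ifF ?regs_setr ?eqxx ?S1 //; lia.
  pose s2 := setr (setr (setr s1 d.+2 (regs s1 x)) x 0) d 0.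
  have s1x : regs s1 x = regs s x by rewrite k3 //; lia.
  have sxW : regs s1 x <= W by case: ok1.
  have oka : okW W (setr s1 d.+2 (regs s1 x)) by apply: okW_setr.
  have okb : okW W (setr (setr s1 d.+2 (regs s1 x)) x 0) by apply: okW_setr.
  have h0 : I 0 s2.
    split.
    - exact: okW_setr.
    - by split=> // r ltr ne; rewrite !regs_setr !ifF ?k3 //; lia.
    - by split; rewrite !regs_setr ifF ?eqxx ?ifF ?eqxx //; lia.
    - by rewrite !regs_setr !ifF ?v1 ?subn0 //; lia.
    - by rewrite regs_setr eqxx big_ord0.
  have [s3 r3 [ok3 [k31 k32 k33] [_ k34] _ e3]] := run1_drain (ltac:(lia) : d.+1 < R) h1 h2 h3 h0.
  exists (setr s3 x (regs s3 d.+2)); split.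
  + apply: (@run1_le _ _ _ _ (stepsE (arrs s) env e1 * u + (u + (u + (u +
       ((\sum_(i < m1) (T i + 2) + 1) + u)))))).
      apply: run1_seq r1 _; apply: run1_seq.
        by tape_step.
      apply: run1_seq; first by tape_step.
      apply: run1_seq; first by tape_step.
      apply: run1_seq r3 _.
      by tape_step.
    have : \sum_(i < m1) (T i + 2) <= (\sum_(i < m1) (stepsE (arrs s) (upd env x i) e2 +
       3 * F i + 4)) * u.
      rewrite big_distrl /=; apply: leq_sum => i _; rewrite /T.
      set q' := stepsE _ _ e2; set q := F i; nia.
    rewrite /= -/m1 mulnDl mulnDl.
    by set q := stepsE _ _ e1; set q1 := \sum_(i < m1) _; set q2 := \sum_(i < m1) _; lia.
  + by apply: okW_setr => //; case: ok3.
  + split=> // r ltr; rewrite regs_setr; case: eqP => [->|/eqP ne] //.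
    exact: k33.
  + by rewrite regs_setr ifF //; lia.
Qed.

Lemma compC_ok c : forall d env s,
  wfC v0 c -> v0 <= d -> d + depC c <= R -> okW W s ->
  okC W env c (arrs s, outp s) -> (forall r, r < v0 -> regs s r = env r) ->
  exists s', [/\ run1 (compC c d) s (stepsC env c (arrs s, outp s) * u) s',
     okW W s', forall r, r < d -> regs s' r = regs s r &
     (arrs s', outp s') = evalC env c (arrs s, outp s)].
Proof.
elim: c => [c1 IH1 c2 IH2|x e c IH|x e c IH|a e1 e2|e] d env s;
  rewrite [wfC _ _]/= [depC _]/=.
- case/andP=> wf1 wf2 v0d dR ok [okC1 okC2] Henv.
  have [s1 [r1 ok1 k1 v1]] := IH1 d env s wf1 v0d ltac:(lia) ok okC1 Henv.
  have Henv1 r : r < v0 -> regs s1 r = env r by move=> lt; rewrite k1 ?Henv //; lia.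
  rewrite -v1 in okC2.
  have [s2 [r2 ok2 k2 v2]] := IH2 d env s1 wf2 v0d ltac:(lia) ok1 okC2 Henv1.
  exists s2; split=> //.
  + by rewrite /= mulnDl -v1; apply: run1_seq r1 r2.
  + by move=> r lt; rewrite k2 ?k1.
  + by rewrite v2 v1.
- case/and3P=> xv wfe wfc v0d dR ok [oke okc] Henv.
  have [s1 [r1 ok1 [k1 k2 k3] v1]] := compE_ok wfe v0d ltac:(lia) ok oke Henv.
  set m := eval _ _ e in okc v1; rewrite [fst _]/= in m okc v1 *.
  pose F i := iterC (fun i => evalC (upd env x i) c) i (arrs s, outp s).
  pose I v t := [/\ okW W t, (arrs t, outp t) = F v,
     forall r, r < d -> r != x -> regs t r = regs s r,
     regs t x = v /\ regs t d.+1 = regs s x & regs t d = m - v].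
  have h1 v t : v < m -> I v t -> regs t d = m - v by move=> _ [].
  have h2 t : I m t -> regs t d = 0 by case=> _ _ _ _ ->; rewrite subnn.
  pose T v := (stepsC (upd env x v) c (F v) + 2) * u.
  have mW : m <= W by rewrite -v1; case: ok1.
  have h3 v t : v < m -> I v t -> exists2 t', run1 (TSeq (DEC R d)
        (TSeq (compC c d.+2) (INC R x))) t (T v) t' & I v.+1 t'.
    move=> lt [okt a1 a2 [b1 b2] c1].
    pose t1 := setr t d (regs t d).-1.
    have okt1 : okW W t1 by apply: okW_setr => //; case: okt => _ /(_ d); lia.
    have Ht1 r : r < v0 -> regs t1 r = upd env x v r.
      move=> ltr; rewrite /t1 regs_setr ifF /upd; last by lia.
      by case: eqP => [->|/eqP ne] //; rewrite a2 ?Henv //; lia.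
    have okC' : okC W (upd env x v) c (arrs t1, outp t1).
      by rewrite [arrs _]/= [outp _]/= a1; apply: okc.
    have [t2 [rr2 okt2 l3 vv2]] :=
      IH d.+2 (upd env x v) t1 wfc ltac:(lia) ltac:(lia) okt1 okC' Ht1.
    rewrite [arrs t1]/= [outp t1]/= a1 in vv2 rr2.
    have x2 : regs t2 x = v by rewrite l3 /t1 ?regs_setr ?ifF //; lia.
    exists (setr t2 x (regs t2 x).+1).
      apply: (@run1_le _ _ _ _ (u + (stepsC (upd env x v) c (F v) * u + u)));
        last by rewrite /T; nia.
      apply: run1_seq; first by tape_step.
      apply: run1_seq rr2 _.
      by tape_step.
    split.
    - by apply: okW_setr => //; rewrite x2; lia.
    - by rewrite /F iterC_S /= -/(F v) -vv2.
    - move=> r ltr ne.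
      by rewrite !regs_setr !ifF ?l3 /t1 ?regs_setr ?ifF ?a2 //; lia.
    - split; first by rewrite regs_setr eqxx x2.
      by rewrite !regs_setr !ifF ?l3 /t1 ?regs_setr ?ifF //; lia.
    - by rewrite !regs_setr !ifF ?l3 /t1 ?regs_setr ?eqxx ?c1; lia.
  pose s2 := setr (setr s1 d.+1 (regs s1 x)) x 0.
  have s1x : regs s1 x = regs s x by rewrite k3 //; lia.
  have sxW : regs s1 x <= W by case: ok1.
  have oka : okW W (setr s1 d.+1 (regs s1 x)) by apply: okW_setr.
  have h0 : I 0 s2.
    split.
    - exact: okW_setr.
    - by rewrite /= k1 k2.
    - by move=> r ltr ne; rewrite !regs_setr !ifF ?k3 //; lia.
    - by split; [rewrite regs_setr eqxx | rewrite !regs_setr ifF ?eqxx //; lia].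
    - by rewrite !regs_setr !ifF ?v1 ?subn0 //; lia.
  have [s3 r3 [ok3 e3 k31 [_ k34] _]] := run1_drain (ltac:(lia) : d < R) h1 h2 h3 h0.
  exists (setr s3 x (regs s3 d.+1)); split.
  + apply: (@run1_le _ _ _ _ (stepsE (arrs s) env e * u + (u + (u +
       ((\sum_(i < m) (T i + 2) + 1) + u))))).
      apply: run1_seq r1 _; apply: run1_seq.
        by tape_step.
      apply: run1_seq; first by tape_step.
      apply: run1_seq r3 _.
      by tape_step.
    have : \sum_(i < m) (T i + 2) <= (\sum_(i < m) (stepsC (upd env x i) c (F i) + 3)) * u.
      rewrite big_distrl /=; apply: leq_sum => i _; rewrite /T.
      set q' := stepsC _ _ _; nia.
    rewrite /= -/m mulnDl mulnDl.
    by set q := stepsE _ _ e; set q1 := \sum_(i < m) _; set q2 := \sum_(i < m) _; lia.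
  + by apply: okW_setr => //; case: ok3.
  + move=> r ltr; rewrite regs_setr; case: eqP => [->|/eqP ne] //.
    exact: k31.
  + by [].
- case/and3P=> xv wfe wfc v0d dR ok [oke okc] Henv.
  have [s1 [r1 ok1 [k1 k2 k3] v1]] := compE_ok wfe v0d ltac:(lia) ok oke Henv.
  set m := eval _ _ e in okc v1; rewrite [fst _]/= in m okc v1 *.
  have s1x : regs s1 x = regs s x by rewrite k3 //; lia.
  have sxW : regs s1 x <= W by case: ok1.
  have mW : m <= W by rewrite -v1; case: ok1.
  pose s2 := setr s1 d.+1 (regs s1 x); pose s3 := setr s2 x m.
  have ok2 : okW W s2 by apply: okW_setr.
  have ok3 : okW W s3 by apply: okW_setr.
  have Henv3 r : r < v0 -> regs s3 r = upd env x m r.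
    move=> lt; rewrite /s3 /s2 !regs_setr /upd; case: eqP => // _.
    by rewrite ifF ?k3 ?Henv //; lia.
  have okc3 : okC W (upd env x m) c (arrs s3, outp s3) by rewrite /= k1 k2.
  have [s4 [r4 ok4 k4 v4]] := IH d.+2 _ s3 wfc ltac:(lia) ltac:(lia) ok3 okc3 Henv3.
  rewrite [arrs s3]/= [outp s3]/= k1 k2 in r4 v4.
  exists (setr s4 x (regs s4 d.+1)); split.
  + apply: (@run1_le _ _ _ _ (stepsE (arrs s) env e * u + (u + (u +
       (stepsC (upd env x m) c (arrs s, outp s) * u + u))))).
      apply: run1_seq r1 _; apply: run1_seq.
        by tape_step.
      apply: (@run1_seq _ _ _ _ s3).
        have -> : s3 = setr s2 x (regs s2 d).
          by rewrite /s3 /s2 regs_setr ifF ?v1 //; lia.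
        by tape_step.
      apply: run1_seq r4 _; tape_step.
    by rewrite /= -/m !mulnDl; lia.
  + by apply: okW_setr => //; case: ok4.
  + have x4 : regs s4 d.+1 = regs s x.
      by rewrite k4 ?ltnSn // /s3 /s2 regs_setr ifF ?regs_setr ?eqxx //; lia.
    move=> r ltr; rewrite regs_setr x4; case: eqP => [->//|/eqP ne].
    rewrite k4; last by lia.
    by rewrite /s3 /s2 regs_setr ifF ?regs_setr ?ifF ?k3 //; lia.
  + by [].
- case/andP=> wf1 wf2 v0d dR ok [ok1 ok2] Henv.
  have D1 := depE_gt0 e1; have D2 := depE_gt0 e2.
  have [s1 [r1 okW1 [k1 k2 k3] v1]] := compE_ok wf1 v0d ltac:(lia) ok ok1 Henv.
  have Henv1 r : r < v0 -> regs s1 r = env r by move=> lt; rewrite k3 ?Henv //; lia.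
  rewrite [fst _]/= -k1 in ok2.
  have [s2 [r2 okW2 [l1 l2 l3] v2]] :=
    compE_ok wf2 (ltac:(lia) : v0 <= d.+1) ltac:(lia) okW1 ok2 Henv1.
  rewrite k1 in v2 r2.
  have v1' : regs s2 d = eval (arrs s) env e1 by rewrite l3 // ltnSn.
  exists (MState (regs s2) (updA (arrs s2) a (regs s2 d) (regs s2 d.+1 != 0)) (outp s2)); split.
  + rewrite /= !mulnDl -addnA; apply: run1_seq r1 _; apply: run1_seq r2 _.
    by rewrite mul1n; apply: run1_one; apply: run1_WRITE okW2; lia.
  + by case: okW2.
  + by move=> r lt; rewrite /= l3 ?k3 //; lia.
  + by rewrite /= l1 l2 k1 k2 v1' v2.
- move=> wf1 v0d dR ok [ok1 lt] Henv.
  have D1 := depE_gt0 e.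
  have [s1 [r1 okW1 [k1 k2 k3] v1]] := compE_ok wf1 v0d ltac:(lia) ok ok1 Henv.
  exists (MState (regs s1) (arrs s1) (rcons (outp s1) (regs s1 d != 0))); split.
  + rewrite /= !mulnDl; apply: run1_seq r1 _.
    by rewrite mul1n; apply: run1_one; apply: run1_EMIT okW1; lia.
  + by case: okW1 => ? ? _; split=> //=; rewrite size_rcons k2.
  + by move=> r ltr; rewrite /= k3.
  + by rewrite /= k1 k2 v1.
Qed.
End Compile.

Fixpoint maxvE (e : expr) : nat :=
  match e with
  | EC _ => 0
  | EV x => x.+1
  | EA _ e => maxvE e
  | EOp _ e1 e2 => maxn (maxvE e1) (maxvE e2)
  | ESum x e1 e2 => maxn x.+1 (maxn (maxvE e1) (maxvE e2))
  end.

Fixpoint maxvC (c : com) : nat :=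
  match c with
  | CSeq c1 c2 => maxn (maxvC c1) (maxvC c2)
  | CFor x e c | CLet x e c => maxn x.+1 (maxn (maxvE e) (maxvC c))
  | CSet _ e1 e2 => maxn (maxvE e1) (maxvE e2)
  | CEmit e => maxvE e
  end.

Lemma wfE_maxv v e : maxvE e <= v -> wfE v e.
Proof.
elim: e => //= [op e1 IH1 e2 IH2|x e1 IH1 e2 IH2] H;
  rewrite ?IH1 ?IH2 ?andbT //; lia.
Qed.

Lemma wfC_maxv v c : maxvC c <= v -> wfC v c.
Proof.
elim: c => //= [c1 IH1 c2 IH2|x e c IH|x e c IH|a e1 e2|e] H;
  rewrite ?IH1 ?IH2 ?IH ?wfE_maxv //; lia.
Qed.

(** * From a program to a Turing machine *)

Section Machine.
Variable c : com.

(* Register 0 receives the number of leading true bits of the input. *)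
Let v0 := maxn 1 (maxvC c).
Let R := v0 + depC c.

(** The left-end mark has to come first, since every rewind relies on it. The sweep then copies the
    leading true bits to the track of register 0. *)
Definition init_phase : tcmd (nsym R) :=
  TSeq (TAct (stk 0 true) MoveS) (mac (trk 1) (stk 7 true) id).

(** The required output consists of raw bit symbols followed by a blank, so the multi-track cells of
    the output are overwritten, and a blank is put behind them. *)
Definition final_phase : tcmd (nsym R) :=
  TSeq (TWhile (fun s => trk 2 s || trk 3 s)
    (TAct (fun s => sym_of_bool _ (trk 3 s)) MoveR))
  (TAct (fun=> blank_sym _) MoveS).

Definition machine : TM :=
  code_TM (code (TSeq init_phase (TSeq (compC R c v0) final_phase)) 0).

Definition init_store (inp : seq bool) : store :=
  (fun a i => if a is AIn then nth false inp i else false, [::]).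

Lemma trk_raw j (s : 'I_(nsym R).+3) : j < 7 + R -> s < 3 ->
  trk j s = (j == 1) && (s == 2 :> nat).
Proof. by move=> lj ls; rewrite /trk /dec ls ffunE inordK. Qed.

Lemma trk_tape j inp i : j < 7 + R ->
  trk j (nth (blank_sym (nsym R)) [seq sym_of_bool (nsym R) b | b <- inp] i) =
  (j == 1) && nth false inp i.
Proof.
move=> lj; have [lt|ge] := ltnP i (size inp); last first.
  by rewrite !nth_default ?size_map // trk_raw //= andbF.
rewrite (nth_map false) // trk_raw //; rewrite /sym_of_bool.
  by case: (nth _ _ _); rewrite inordK.
by case: (nth _ _ _); rewrite inordK.
Qed.

Theorem machine_ok inp n W : n < W -> (forall i, i < n -> nth false inp i) ->
  nth false inp n = false ->
  let env := upd (fun=> 0) 0 n in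
  okC W env c (init_store inp) ->
  tm_computes_within machine inp
    ((stepsC env c (init_store inp) + 4) * (cW W + 2))
    (evalC env c (init_store inp)).2.
Proof.
move=> nW Hin Hn env okc.
pose s0 := MState (fun=> 0) (init_store inp).1 [::].
pose tp0 i := nth (blank_sym (nsym R)) [seq sym_of_bool (nsym R) b | b <- inp] i.
have R0 : 0 < R by rewrite /R /v0; lia.
have rep0 : rep s0 (put tp0 0 (stk 0 true (tp0 0))).
  have T j i : j < 7 + R -> trk j (put tp0 0 (stk 0 true (tp0 0)) i) =
     if (j == 0) && (i == 0) then true else (j == 1) && nth false inp i.
    move=> lj; rewrite /put; case: (i =P 0) => [->|_]; rewrite ?andbT ?andbF.
      by rewrite trk_stk // trk_tape //; case: eqP.
    by rewrite trk_tape.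
  split.
  - by move=> i; rewrite T //=; case: (i == 0).
  - by move=> a i; rewrite T ?atrk_lt //; case: a.
  - by move=> i; rewrite T.
  - by move=> i; rewrite T.
  - by move=> r i rR; rewrite T ?ltn_add2l.
have W0 : 0 < W by lia.
have ok0 : okW W (setr s0 0 n) by split=> //= r; rewrite /upd; case: eqP => // _; lia.
have r1 : @run1 R (mac (trk 1) (stk 7 true) id) s0 (6 * n + 3) (setr s0 0 n).
  apply: run1_mac => tp rp.
    by split=> [i lt|]; rewrite (rep_arr rp AIn) //=; apply: Hin.
  apply: (rep_retrack R0 rp) => i; rewrite /swept; exists (i < n) => //.
  by case: ltngtP => cc; [left | right | right]; rewrite ?(rep_reg rp).
have wf : wfC v0 c by apply: wfC_maxv; rewrite /v0; lia.
have Henv r : r < v0 -> regs (setr s0 0 n) r = env r by [].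
have [s2 [r2 ok2 _ v2]] := compC_ok (R := R) wf (leqnn v0) (leqnn _) ok0 okc Henv.
have [tp1 [t1 [le1 e1 rp1]]] := r1 _ rep0.
have [tp2 [t2 [le2 e2 rp2]]] := r2 _ rp1.
set out := (evalC _ _ _).2.
have oE : outp s2 = out by rewrite /out -[init_store inp]/(arrs s0, outp s0) -v2.
have ex3 : texec (TWhile (fun s => trk 2 s || trk 3 s)
    (TAct (fun s => sym_of_bool _ (trk 3 s)) MoveR)) tp2 0
    (fun i => if 0 <= i < size out then sym_of_bool _ (trk 3 (tp2 i)) else tp2 i)
    (size out) (3 * (size out - 0) + 1).
  apply: texec_sweep => // [i|]; rewrite (rep_out0 rp2) (rep_out1 rp2) oE.
    by move=> /andP[_ ->]; case: nth.
  by rewrite ltnn.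
have szW : size out <= W by rewrite -oE; case: ok2.
have ex := XSeq (XSeq (XAct (stk 0 true) MoveS tp0 0) e1)
   (XSeq e2 (XSeq ex3 (XAct (fun=> blank_sym (nsym R)) MoveS _ _))).
have [Hrun Hhalt] := texec_halt ex.
exists (1 + t1 + (t2 + (3 * (size out - 0) + 1 + 1))); split.
  move: le2; rewrite mulnDl -[init_store inp]/(arrs s0, outp s0) -/env.
  by rewrite [arrs _]/= [outp _]/=; set q := _ * (cW W + 2); rewrite /cW; lia.
change (tm_init machine inp) with (@tm_start machine, tp0, 0).
rewrite Hrun; split; first exact: Hhalt.
split=> [i lt|].
  cbn [fst snd]; rewrite /put ifF ?lt /=; last by lia.
  by rewrite (rep_out1 rp2) oE lt.
by cbn [fst snd]; rewrite /put eqxx.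
Qed.
End Machine.

(** * Polynomial bounds on values and times *)

Fixpoint degE (e : expr) : nat :=
  match e with
  | EC _ | EV _ => 1
  | EA _ e => degE e + 2
  | EOp _ e1 e2 => degE e1 + degE e2 + 4
  | ESum _ e1 e2 => degE e1 + (degE e1).+1 * degE e2 + 4
  end.

Fixpoint constE (e : expr) : nat :=
  match e with
  | EC c => c
  | EV _ => 0
  | EA _ e => constE e
  | EOp _ e1 e2 | ESum _ e1 e2 => maxn (constE e1) (constE e2)
  end.

Fixpoint degC (c : com) : nat :=
  match c with
  | CSeq c1 c2 => degC c1 + degC c2 + 1
  | CFor _ e c | CLet _ e c => degE e + (degE e).+1 * degC c + 4
  | CSet _ e1 e2 => degE e1 + degE e2 + 2
  | CEmit e => degE e + 1
  end.

Fixpoint constC (c : com) : nat :=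
  match c with
  | CSeq c1 c2 => maxn (constC c1) (constC c2)
  | CFor _ e c | CLet _ e c => maxn (constE e) (constC c)
  | CSet _ e1 e2 => maxn (constE e1) (constE e2)
  | CEmit e => constE e
  end.

Lemma degE_gt0 e : 0 < degE e. Proof. by case: e => //= *; lia. Qed.

Lemma expn_ge X d d' : 1 < X -> d <= d' -> X ^ d <= X ^ d'.
Proof. by move=> X1 le; rewrite leq_exp2l. Qed.

Lemma expn_pos X d : 1 < X -> 0 < X ^ d.
Proof. by move=> X1; rewrite expn_gt0; lia. Qed.

Lemma expn_bound X d : 1 < X -> 0 < d -> X <= X ^ d.
Proof. by move=> X1 d0; rewrite -{1}(expn1 X) leq_exp2l. Qed.

(* Bounds for a body evaluated under a loop index below [X ^ d]. *)
Lemma expn_under X d : 1 < X -> 0 < d -> (X ^ d).+2 <= X ^ d.+1.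
Proof. by move=> X1 d0; have := expn_bound X1 d0; rewrite expnS; nia. Qed.

Lemma expn16 X d : 1 < X -> 16 * X ^ d <= X ^ (d + 4).
Proof.
move=> X1; rewrite expnD mulnC leq_mul2l; apply/orP; right.
by rewrite (_ : 16 = 2 ^ 4) // leq_exp2r.
Qed.

Lemma upd_le env x v B B' : (forall r, env r <= B) -> B <= B' -> v <= B' ->
  forall r, upd env x v r <= B'.
Proof. by move=> H le Hv r; rewrite /upd; case: eqP => // _; apply: leq_trans le. Qed.

(** Let [X = B + 2]. Below a sum the bound variable is less than [X ^ d1], so the body is estimated
    with [X ^ (d1 + 1)] in place of [X], which multiplies its degree. Constants enter only through
    [B]; the degree depends on the shape of the expression alone. *)
Lemma degE_ok A e : forall env B, (forall r, env r <= B) -> constE e <= B ->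
  [/\ eval A env e <= B.+2 ^ degE e, stepsE A env e <= B.+2 ^ degE e &
      forall W, B.+2 ^ degE e <= W -> okE W A env e].
Proof.
elim: e => [c|x|a e IH|op e1 IH1 e2 IH2|x e1 IH1 e2 IH2] env B Henv;
  rewrite [constE _]/= [degE _]/= => Hc; have X1 : 1 < B.+2 by [].
- by rewrite /= expn1; split; [lia | lia | move=> W; lia].
- by rewrite /= expn1; have := Henv x; split; [lia | lia | ].
- have [v1 s1 o1] := IH _ _ Henv Hc.
  have d0 := degE_gt0 e; have b := expn_bound X1 d0.
  have le : B.+2 ^ degE e * 4 <= B.+2 ^ (degE e + 2).
    by rewrite expnD leq_mul2l (_ : 4 = 2 ^ 2) // leq_exp2r //= orbT.
  split=> /=.
  + by case: (A _ _); lia.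
  + by lia.
  + by move=> W HW; apply: o1; lia.
- have [v1 s1 o1] := IH1 _ _ Henv (leq_trans (leq_maxl _ _) Hc).
  have [v2 s2 o2] := IH2 _ _ Henv (leq_trans (leq_maxr _ _) Hc).
  have le := expn16 (degE e1 + degE e2) X1.
  have g1 := expn_ge X1 (leq_addr (degE e2) (degE e1)).
  have g2 := expn_ge X1 (leq_addl (degE e1) (degE e2)).
  have p := expn_pos (degE e1) X1.
  have ar : arith op (eval A env e1) (eval A env e2) <= eval A env e1 + eval A env e2.
    by case: (op) => /=; lia.
  split=> /=; [lia | lia | move=> W HW; split; [apply: o1|apply: o2|]; lia].
- have [v1 s1 o1] := IH1 _ _ Henv (leq_trans (leq_maxl _ _) Hc).
  set d1 := degE e1 in v1 s1 o1 *; set d2 := degE e2 in IH2 *.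
  have d10 : 0 < d1 := degE_gt0 e1.
  have b1 := expn_bound X1 d10; have b2 := expn_under X1 d10.
  have H2 i : i < eval A env e1 ->
    [/\ eval A (upd env x i) e2 <= B.+2 ^ (d1.+1 * d2),
        stepsE A (upd env x i) e2 <= B.+2 ^ (d1.+1 * d2) &
        forall W, B.+2 ^ (d1.+1 * d2) <= W -> okE W A (upd env x i) e2].
    move=> lt.
    have le : (B.+2 ^ d1).+2 ^ d2 <= B.+2 ^ (d1.+1 * d2).
      by rewrite expnM; case: (d2) => // k; rewrite leq_exp2r.
    have [||v2 s2 o2] := IH2 (upd env x i) (B.+2 ^ d1).
    + by apply: upd_le Henv _ _; lia.
    + by apply: leq_trans (leq_maxr _ _) _; apply: leq_trans Hc _; lia.
    split; [exact: leq_trans le | exact: leq_trans le |].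
    by move=> W HW; apply: o2; apply: leq_trans HW.
  set d' := d1.+1 * d2 in H2 *.
  have p' := expn_pos d' X1; have p1 := expn_pos d1 X1.
  have le := expn16 (d1 + d') X1; rewrite expnD in le.
  have m1 := leq_mul v1 (leqnn (B.+2 ^ d')).
  have S1 : \sum_(i < eval A env e1) eval A (upd env x i) e2 <=
      B.+2 ^ d1 * B.+2 ^ d'.
    apply: leq_trans m1.
    rewrite -[X in _ <= X * _]card_ord -sum_nat_const; apply: leq_sum => i _.
    by have [] := H2 i (ltn_ord i).
  have S2 : \sum_(i < eval A env e1) (stepsE A (upd env x i) e2 +
       3 * eval A (upd env x i) e2 + 4) <= B.+2 ^ d1 * (8 * B.+2 ^ d').
    apply: (@leq_trans (eval A env e1 * (8 * B.+2 ^ d'))); last by rewrite leq_mul2r v1 orbT.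
    rewrite -[X in _ <= X * _]card_ord -sum_nat_const; apply: leq_sum => i _.
    by have [h1 h2 _] := H2 i (ltn_ord i); lia.
  rewrite mulnCA in S2.
  have g1 : B.+2 ^ d1 <= B.+2 ^ d1 * B.+2 ^ d' by rewrite leq_pmulr.
  have g2 : B.+2 ^ d' <= B.+2 ^ d1 * B.+2 ^ d' by rewrite leq_pmull.
  split=> [||W HW] /=.
  + by apply: leq_trans S1 _; lia.
  + by apply: (leq_trans (leq_add (leq_add s1 (leqnn 5)) S2)); lia.
  + split; first by apply: o1; lia.
      by move=> i /H2[_ _ o2]; apply: o2; lia.
    by apply: leq_trans S1 _; lia.
Qed.

Lemma degC_ok c : forall env B s, (forall r, env r <= B) -> constC c <= B ->
  [/\ size (evalC env c s).2 <= size s.2 + B.+2 ^ degC c,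
      stepsC env c s <= B.+2 ^ degC c &
      forall W, B.+2 ^ degC c + size s.2 <= W -> okC W env c s].
Proof.
elim: c => [c1 IH1 c2 IH2|x e c IH|x e c IH|a e1 e2|e] env B s Henv;
  rewrite [constC _]/= [degC _]/= => Hc; have X1 : 1 < B.+2 by [].
- have [v1 s1 o1] := IH1 _ _ s Henv (leq_trans (leq_maxl _ _) Hc).
  have [v2 s2 o2] := IH2 _ _ (evalC env c1 s) Henv (leq_trans (leq_maxr _ _) Hc).
  have le : 2 * B.+2 ^ (degC c1 + degC c2) <= B.+2 ^ (degC c1 + degC c2 + 1).
    by rewrite [X in _ <= X]expnD expn1 mulnC leq_mul2l orbT.
  have g1 := expn_ge X1 (leq_addr (degC c2) (degC c1)).
  have g2 := expn_ge X1 (leq_addl (degC c1) (degC c2)).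
  split=> /=; [lia | lia | move=> W HW; split; [apply: o1|apply: o2]; lia].
- have [v1 s1 o1] := degE_ok s.1 Henv (leq_trans (leq_maxl _ _) Hc).
  set d1 := degE e in v1 s1 o1 *; set d2 := degC c in IH *.
  have d10 : 0 < d1 := degE_gt0 e.
  have b1 := expn_bound X1 d10; have b2 := expn_under X1 d10.
  have H2 i s' : i < eval s.1 env e ->
    [/\ size (evalC (upd env x i) c s').2 <= size s'.2 + B.+2 ^ (d1.+1 * d2),
        stepsC (upd env x i) c s' <= B.+2 ^ (d1.+1 * d2) &
        forall W, B.+2 ^ (d1.+1 * d2) + size s'.2 <= W -> okC W (upd env x i) c s'].
    move=> lt.
    have le : (B.+2 ^ d1).+2 ^ d2 <= B.+2 ^ (d1.+1 * d2).
      by rewrite expnM; case: (d2) => // k; rewrite leq_exp2r.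
    have [||v2 s2 o2] := IH (upd env x i) (B.+2 ^ d1) s'.
    + by apply: upd_le Henv _ _; lia.
    + by apply: leq_trans (leq_maxr _ _) _; apply: leq_trans Hc _; lia.
    split; [by apply: leq_trans v2 _; rewrite leq_add2l | exact: leq_trans le |].
    by move=> W HW; apply: o2; lia.
  set d' := d1.+1 * d2 in H2 *.
  have p' := expn_pos d' X1; have p1 := expn_pos d1 X1.
  have le := expn16 (d1 + d') X1; rewrite expnD in le.
  have m1 := leq_mul v1 (leqnn (B.+2 ^ d')).
  set F := fun i => iterC (fun i => evalC (upd env x i) c) i s.
  have SF i : i <= eval s.1 env e -> size (F i).2 <= size s.2 + i * B.+2 ^ d'.
    elim: i => [|i IHi] lti; first by rewrite addn0.
    rewrite /F iterC_S -/(F i); have [h _ _] := H2 i (F i) lti.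
    by have := IHi (ltnW lti); rewrite mulSn; lia.
  have S2 : \sum_(i < eval s.1 env e) (stepsC (upd env x i) c (F i) + 3) <=
       B.+2 ^ d1 * (4 * B.+2 ^ d').
    apply: (@leq_trans (eval s.1 env e * (4 * B.+2 ^ d'))); last by rewrite leq_mul2r v1 orbT.
    rewrite -[X in _ <= X * _]card_ord -sum_nat_const; apply: leq_sum => i _.
    by have [_ h2 _] := H2 i (F i) (ltn_ord i); lia.
  rewrite mulnCA in S2.
  have g1 : B.+2 ^ d1 <= B.+2 ^ d1 * B.+2 ^ d' by rewrite leq_pmulr.
  have g2 : B.+2 ^ d' <= B.+2 ^ d1 * B.+2 ^ d' by rewrite leq_pmull.
  split=> /=.
  + by have := SF _ (leqnn _); rewrite -/(F _); lia.
  + apply: (leq_trans (leq_add (leq_add s1 (leqnn 4)) S2)); lia.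
  + move=> W HW; split; first by apply: o1; lia.
    move=> i lti; have [_ _ o2] := H2 i (F i) lti; apply: o2.
    have := SF i (ltnW lti).
    have : i.+1 * B.+2 ^ d' <= B.+2 ^ d1 * B.+2 ^ d'.
      by rewrite leq_mul2r; apply/orP; right; lia.
    by rewrite mulSn; lia.
- have [v1 s1 o1] := degE_ok s.1 Henv (leq_trans (leq_maxl _ _) Hc).
  set d1 := degE e in v1 s1 o1 *; set d2 := degC c in IH *.
  have d10 : 0 < d1 := degE_gt0 e.
  have b1 := expn_bound X1 d10; have b2 := expn_under X1 d10.
  have le2 : (B.+2 ^ d1).+2 ^ d2 <= B.+2 ^ (d1.+1 * d2).
    by rewrite expnM; case: (d2) => // k; rewrite leq_exp2r.
  have [||v2 s2 o2] := IH (upd env x (eval s.1 env e)) (B.+2 ^ d1) s.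
  + by apply: upd_le Henv _ _; lia.
  + by apply: leq_trans (leq_maxr _ _) _; apply: leq_trans Hc _; lia.
  set d' := d1.+1 * d2 in le2 *.
  have p' := expn_pos d' X1; have p1 := expn_pos d1 X1.
  have le := expn16 (d1 + d') X1; rewrite expnD in le.
  have g1 : B.+2 ^ d1 <= B.+2 ^ d1 * B.+2 ^ d' by rewrite leq_pmulr.
  have g2 : B.+2 ^ d' <= B.+2 ^ d1 * B.+2 ^ d' by rewrite leq_pmull.
  split=> /=; [lia | lia | move=> W HW; split; [apply: o1|apply: o2]; lia].
- have [v1 s1 o1] := degE_ok s.1 Henv (leq_trans (leq_maxl _ _) Hc).
  have [v2 s2 o2] := degE_ok s.1 Henv (leq_trans (leq_maxr _ _) Hc).
  have le : 4 * B.+2 ^ (degE e1 + degE e2) <= B.+2 ^ (degE e1 + degE e2 + 2).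
    by rewrite [X in _ <= X]expnD mulnC leq_mul2l (_ : 4 = 2 ^ 2) // leq_exp2r //= orbT.
  have g1 := expn_ge X1 (leq_addr (degE e2) (degE e1)).
  have g2 := expn_ge X1 (leq_addl (degE e1) (degE e2)).
  have p1 := expn_pos (degE e1) X1.
  split=> /=; [lia | lia | move=> W HW; split; [apply: o1|apply: o2]; lia].
- have [v1 s1 o1] := degE_ok s.1 Henv Hc.
  have le : 2 * B.+2 ^ degE e <= B.+2 ^ (degE e + 1).
    by rewrite [X in _ <= X]expnD expn1 mulnC leq_mul2l orbT.
  have p1 := expn_pos (degE e) X1.
  split=> /=; [rewrite size_rcons; lia | lia | move=> W HW; split; [apply: o1|]; lia].
Qed.

(** * Sampled gradients *)

Section Sampling.
Local Open Scope ring_scope.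
Variable n : nat.

Lemma sum_avg (X : nat -> bool) (F : nat -> rat) (c : rat) :
  (0 < \sum_(w < n) X w)%N ->
  \sum_(w < n) (X w)%:R * F w <= (\sum_(w < n) X w)%:R * c ->
  exists2 w, (w < n)%N && X w & F w <= c.
Proof.
move=> X0 H.
case: (boolP [exists w : 'I_n, X w && (F w <= c)]).
  by case/existsP=> w /andP[Xw Fw]; exists (val w) => //; rewrite ltn_ord.
move=> /existsPn H'; exfalso; move: H; rewrite leNgt => /negP; apply.
rewrite natr_sum mulr_suml.
have [w0 Xw0] : exists w : 'I_n, X w.
  apply/existsP; apply: contraLR X0 => /existsPn HX.
  by rewrite big1 // => i _; rewrite (negbTE (HX i)).
have le (w : 'I_n) : (X w)%:R * c <= (X w)%:R * F w.
  have := H' w; case: (X w); rewrite ?mul0r ?mul1r //= -ltNge; exact: ltW.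
rewrite (bigD1 w0) // [X in _ < X](bigD1 w0) //=; apply: ltr_leD.
  by rewrite Xw0 !mul1r; have := H' w0; rewrite Xw0 /= -ltNge.
exact: ler_sum.
Qed.

(* Greedy derandomisation of sampling: averaging over the next sample bounds
   the growth of the total squared deviation. *)
Lemma sample_exists (B X : nat -> bool) (phi : nat -> nat -> rat) (k : nat) :
  (forall u v, phi u v ^+ 2 <= 1) -> (0 < \sum_(w < n) X w)%N ->
  exists2 A : seq nat, size A = k /\ (forall w, w \in A -> (w < n)%N && X w) &
   \sum_(u < n) (B u)%:R * (\sum_(w <- A) phi u w - k%:R *
      ((\sum_(v < n) (X v)%:R * phi u v) / (\sum_(v < n) X v)%:R)) ^+ 2
    <= k%:R * (\sum_(u < n) B u)%:R.
Proof.
move=> phi1 X0; set x := (\sum_(v < n) X v)%N in X0 *.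
have x0 : 0 < x%:R :> rat by rewrite ltr0n.
pose mean u := (\sum_(v < n) (X v)%:R * phi u v) / x%:R.
elim: k => [|k [A [sA HA] IH]].
  exists [::] => //; rewrite mul0r big1 // => u _.
  by rewrite big_nil mul0r subr0 expr0n mulr0.
pose s u := \sum_(w <- A) phi u w - k%:R * mean u.
pose F w := \sum_(u < n) (B u)%:R * (s u + (phi u w - mean u)) ^+ 2.
have [|w wX Fw] := @sum_avg X F (\sum_(u < n) (B u)%:R * (s u) ^+ 2 + (\sum_(u < n) B u)%:R) X0.
  rewrite -/x /F; under eq_bigr do rewrite big_distrr /=.
  rewrite exchange_big /= mulrDr mulr_sumr natr_sum mulr_sumr -big_split /=.
  apply: ler_sum => u _.
  have -> : \sum_(w < n) (X w)%:R * ((B u)%:R * (s u + (phi u w - mean u)) ^+ 2) =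
     (B u)%:R * \sum_(w < n) (X w)%:R * (s u + (phi u w - mean u)) ^+ 2.
    by rewrite mulr_sumr; apply: eq_bigr => w _; rewrite mulrCA.
  case: (B u); rewrite ?mul0r ?mulr0 ?addr0 // !mul1r mulr1.
  have e1 : \sum_(w < n) (X w)%:R * phi u w = x%:R * mean u.
    by rewrite /mean mulrC divfK // gt_eqF.
  have e2 : \sum_(w < n) (X w)%:R = x%:R :> rat by rewrite /x natr_sum.
  (* The first two terms on the right equal [x (s u) ^ 2 - x (mean u) ^ 2]: deviations from the mean
     have no cross term. The last sum is at most [x], so one more sample adds at most 1 per vertex
     on average. *)
  have -> : \sum_(w < n) (X w)%:R * (s u + (phi u w - mean u)) ^+ 2 =
     x%:R * (s u - mean u) ^+ 2 + 2 * (s u - mean u) * (x%:R * mean u) +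
     \sum_(w < n) (X w)%:R * phi u w ^+ 2.
    rewrite -e2 mulr_suml e2 -e1 mulr_sumr -!big_split /=.
    by apply: eq_bigr => w _; ring.
  have le : \sum_(w < n) (X w)%:R * phi u w ^+ 2 <= x%:R.
    rewrite -e2; apply: ler_sum => w _; rewrite -[X in _ <= X]mulr1.
    by apply: ler_wpM2l.
  have m2 : 0 <= x%:R * mean u ^+ 2 by rewrite mulr_ge0 ?sqr_ge0 // ltW.
  nra.
exists (rcons A w).
  split; first by rewrite size_rcons sA.
  by move=> v; rewrite mem_rcons inE => /orP[/eqP->|/HA].
apply: le_trans (le_trans Fw _).
  rewrite /F le_eqVlt; apply/orP; left; apply/eqP; apply: eq_bigr => u _.
  congr (_ * _ ^+ 2); rewrite /s -cats1 big_cat big_seq1 /= -/x -/(mean u).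
  by rewrite -natr1; ring.
by rewrite -natr1 mulrDl mul1r lerD2r.
Qed.

(** Squared deviations become absolute ones by [2 |z| <= z ^ 2 / kappa + kappa]; taking [kappa ^ 2]
    samples balances the two terms. *)
Lemma sample_error (B X : nat -> bool) (phi : nat -> nat -> rat) (kappa : nat) :
  (0 < kappa)%N -> (forall u v, phi u v ^+ 2 <= 1) -> (0 < \sum_(w < n) X w)%N ->
  let x : rat := (\sum_(w < n) X w)%:R in
  let k := (kappa ^ 2)%N in
  exists2 A : seq nat, size A = k /\ (forall w, w \in A -> (w < n)%N && X w) &
   \sum_(u < n) (B u)%:R * `|\sum_(v < n) (X v)%:R * phi u v -
       x / k%:R * \sum_(w <- A) phi u w| <= x * (\sum_(u < n) B u)%:R / kappa%:R.
Proof.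
move=> k0 phi1 X0 x k.
have [A HA le] := sample_exists B k phi1 X0; exists A => //.
have x0 : 0 < x by rewrite ltr0n.
have K0 : 0 < kappa%:R :> rat by rewrite ltr0n.
have kE : k%:R = kappa%:R ^+ 2 :> rat by rewrite /k natrX.
pose s u := \sum_(w <- A) phi u w - k%:R * ((\sum_(v < n) (X v)%:R * phi u v) / x).
have step (u : 'I_n) : (B u)%:R * `|\sum_(v < n) (X v)%:R * phi u v -
       x / k%:R * \sum_(w <- A) phi u w| <=
   x / k%:R * (((B u)%:R * (s u) ^+ 2 / kappa%:R + kappa%:R * (B u)%:R) / 2).
  have -> : \sum_(v < n) (X v)%:R * phi u v - x / k%:R * \sum_(w <- A) phi u w =
     - (x / k%:R * s u).
    by rewrite /s kE; field; rewrite !gt_eqF.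
  rewrite normrN normrM (ger0_norm (_ : 0 <= x / k%:R)); last first.
    by rewrite divr_ge0 ?ler0n // ltW.
  rewrite mulrCA ler_wpM2l //; first by rewrite divr_ge0 ?ler0n // ltW.
  case: (B u); rewrite ?mul0r ?mulr0 ?addr0 ?mul0r // !mul1r mulr1.
  rewrite -(real_normK (num_real (s u))); set z := `|s u|.
  have h : 0 <= (z - kappa%:R) ^+ 2 / kappa%:R by rewrite divr_ge0 ?sqr_ge0 // ltW.
  have e : (z - kappa%:R) ^+ 2 / kappa%:R = z ^+ 2 / kappa%:R + kappa%:R - 2 * z.
    by field; rewrite gt_eqF.
  by rewrite e in h; lra.
apply: le_trans (ler_sum _ (fun u _ => step u)) _.
rewrite -mulr_sumr -mulr_suml big_split /= -mulr_suml -mulr_sumr -natr_sum.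
set b := (\sum_(u < n) B u)%:R in le *.
rewrite -/x in le; rewrite -/(s _) in le.
have -> : x * b / kappa%:R = x / k%:R * ((k%:R * b / kappa%:R + kappa%:R * b) / 2).
  by rewrite kE; field; rewrite gt_eqF.
rewrite ler_wpM2l ?divr_ge0 ?ler0n // ?(ltW x0) // ler_wpM2r // lerD2r.
by rewrite ler_wpM2r // invr_ge0 ltW.
Qed.
End Sampling.

(** * Rounding undecided vertices by estimated gradients *)

Section Oracle.
Variables (n : nat) (a : nat -> nat -> bool).
Hypothesis asym : forall u v, u < n -> v < n -> a u v = a v u.
Hypothesis arefl : forall u, u < n -> a u u.

Definition vcard (x : nat -> bool) := \sum_(v < n) x v.
Definition vinter (x y : nat -> bool) := \sum_(v < n) (x v && y v).
Definition vdist (x y : nat -> bool) := \sum_(v < n) (x v != y v).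

(* The cost of [x] as a cluster, counted twice: [a u] is the closed
   neighbourhood of [u]. *)
Definition vcost (x : nat -> bool) := \sum_(u < n) x u * vdist (a u) x.

Local Open Scope ring_scope.

Definition vpcost (p : nat -> rat) (x : nat -> bool) : rat :=
  (vcost x)%:R - \sum_(u < n) (x u)%:R * p u.

Definition sgn_adj (u v : nat) : rat := if a u v then -1 else 1.

Lemma dist_sgn u x :
  (vdist (a u) x)%:R = (vcard (a u))%:R + \sum_(v < n) (x v)%:R * sgn_adj u v.
Proof.
rewrite /vdist /vcard !natr_sum -big_split /=; apply: eq_bigr => v _.
by rewrite /sgn_adj; case: (a u v); case: (x v) => /=; ring.
Qed.

Lemma vpcost_quad p x : vpcost p x =
  \sum_(u < n) (x u)%:R * ((vcard (a u))%:R - p u) +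
  \sum_(u < n) \sum_(v < n) (x u)%:R * (x v)%:R * sgn_adj u v.
Proof.
rewrite /vpcost /vcost natr_sum -sumrB -big_split /=; apply: eq_bigr => u _.
under [X in _ = _ + X]eq_bigr do rewrite -mulrA.
by rewrite natrM dist_sgn -mulr_sumr; ring.
Qed.

(** The partial derivative at [x] of the quadratic form in [vpcost_quad]; the factor 2 comes from
    the symmetry of [sgn_adj]. *)
Definition grad p (x : nat -> bool) u : rat :=
  (vcard (a u))%:R - p u + 2 * \sum_(v < n) (x v)%:R * sgn_adj u v.

Lemma sgn_sym (u v : 'I_n) : sgn_adj u v = sgn_adj v u.
Proof. by rewrite /sgn_adj asym. Qed.

Lemma sgn_diag (u : 'I_n) : sgn_adj u u = -1.
Proof. by rewrite /sgn_adj arefl. Qed.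

Lemma sgn_sqr u v : sgn_adj u v ^+ 2 <= 1.
Proof. by rewrite /sgn_adj; case: (a u v); rewrite ?sqrrN expr1n. Qed.

Definition pairs (B : nat -> nat -> bool) : nat :=
  \sum_(u < n) \sum_(v < n) ((u != v :> nat) && B u v).

(* A block of simultaneous moves changes the cost by the sum of the gradients
   up to one unit per pair of distinct moved vertices; the diagonal of the
   quadratic form is negative and can be dropped. *)
Lemma vpcost_move p x y (B : nat -> bool) (gh : nat -> rat) :
  (forall u, (u < n)%N -> ~~ B u -> y u = x u) ->
  (forall u, (u < n)%N -> B u -> y u = (gh u < 0)) ->
  vpcost p y <= vpcost p x + \sum_(u < n) (B u)%:R * `|grad p x u - gh u| +
     (pairs (fun u v => B u && B v))%:R.
Proof.
move=> HnB HB; pose d (u : 'I_n) : rat := (y u)%:R - (x u)%:R.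
have dB (u : 'I_n) : ~~ B u -> d u = 0 by move=> nb; rewrite /d HnB // subrr.
have E : vpcost p y = vpcost p x + \sum_(u < n) d u * grad p x u +
    \sum_(u < n) \sum_(v < n) d u * d v * sgn_adj u v.
  rewrite !vpcost_quad.
  have -> : \sum_(u < n) d u * grad p x u = \sum_(u < n) d u * ((vcard (a u))%:R - p u) +
     (\sum_(u < n) \sum_(v < n) d u * (x v)%:R * sgn_adj u v +
      \sum_(u < n) \sum_(v < n) (x u)%:R * d v * sgn_adj u v).
    rewrite [X in _ = _ + (_ + X)]exchange_big /= -!big_split /=; apply: eq_bigr => u _.
    rewrite /grad mulrDr; congr (_ + _); rewrite mulrA mulr_sumr -big_split /=.
    by apply: eq_bigr => v _; rewrite (sgn_sym v u); ring.
  have e1 : \sum_(u < n) (y u)%:R * ((vcard (a u))%:R - p u) =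
      \sum_(u < n) (x u)%:R * ((vcard (a u))%:R - p u) +
      \sum_(u < n) d u * ((vcard (a u))%:R - p u).
    by rewrite -big_split /=; apply: eq_bigr => u _; rewrite /d; ring.
  have e2 : \sum_(u < n) \sum_(v < n) (y u)%:R * (y v)%:R * sgn_adj u v =
    \sum_(u < n) \sum_(v < n) (x u)%:R * (x v)%:R * sgn_adj u v +
    \sum_(u < n) \sum_(v < n) d u * (x v)%:R * sgn_adj u v +
    \sum_(u < n) \sum_(v < n) (x u)%:R * d v * sgn_adj u v +
    \sum_(u < n) \sum_(v < n) d u * d v * sgn_adj u v.
    rewrite -!big_split /=; apply: eq_bigr => u _; rewrite -!big_split /=.
    by apply: eq_bigr => v _; rewrite /d; ring.
  by rewrite e1 e2; ring.
suff [h1 h2] : \sum_(u < n) d u * grad p x u <= \sum_(u < n) (B u)%:R * `|grad p x u - gh u| /\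
   \sum_(u < n) \sum_(v < n) d u * d v * sgn_adj u v <= (pairs (fun u v => B u && B v))%:R.
  by rewrite E; apply: lerD => //; rewrite lerD2l.
split.
  apply: ler_sum => u _; case Bu: (B u); last by rewrite dB ?Bu // !mul0r.
  rewrite mul1r; have yE := HB u (ltn_ord u) Bu.
  (* A vertex is put in exactly when its estimate is negative, so no move increases the estimated
     first-order change; only the error of the estimate is paid. *)
  have dg : d u * gh u <= 0.
    rewrite /d yE; case: ltP => h; case: (x u); rewrite ?subrr ?mul0r //.
      by rewrite subr0 mul1r ltW.
    by rewrite sub0r mulN1r oppr_le0.
  have -> : d u * grad p x u = d u * gh u + d u * (grad p x u - gh u) by ring.
  rewrite -[X in _ <= X]add0r; apply: lerD => //.
  apply: le_trans (ler_norm _) _; rewrite normrM -[X in _ <= X]mul1r ler_wpM2r //.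
  by rewrite /d; case: (y u); case: (x u); rewrite ?subrr ?subr0 ?sub0r ?normrN ?normr0 ?normr1.
rewrite /pairs natr_sum; apply: ler_sum => u _.
rewrite natr_sum; apply: ler_sum => v _.
case: (u =P v :> nat) => [/val_inj ->|_] /=.
  by rewrite sgn_diag mulrN1 oppr_le0 -expr2 sqr_ge0.
case Bu: (B u); last by rewrite dB ?Bu // !mul0r.
case Bv: (B v); last by rewrite (dB v) ?Bv // mulr0 mul0r.
rewrite /= -[true%:R]/(1 : rat) -[X in _ <= X](mulr1 1).
apply: le_trans (ler_norm _) _; rewrite normrM; apply: ler_pM => //.
  rewrite normrM -[X in _ <= X](mulr1 1); apply: ler_pM => //; rewrite /d.
    by case: (y u); case: (x u); rewrite ?subrr ?subr0 ?sub0r ?normrN ?normr0 ?normr1.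
  by case: (y v); case: (x v); rewrite ?subrr ?subr0 ?sub0r ?normrN ?normr0 ?normr1.
by rewrite /sgn_adj; case: (a u v); rewrite ?normrN normr1.
Qed.

Variables (kappa : nat) (p : nat -> rat).
Hypothesis kappa0 : (0 < kappa)%N.
Notation k := (kappa ^ 2)%N.

Definition hits (u : nat) (A : seq nat) : nat := (\sum_(w <- A) a u w)%N.

(* Gradient at a cluster containing [K] whose remaining part has size [t] and
   is sampled by [A]. *)
Definition est (K : nat -> bool) (t : nat) (A : seq nat) (u : nat) : rat :=
  (vcard (a u))%:R - p u + 2 * ((vcard K)%:R - 2 * (vinter (a u) K)%:R) +
  2 * (t%:R / k%:R * (k%:R - 2 * (hits u A)%:R)).

Lemma sum_sgn u (x : nat -> bool) :
  \sum_(v < n) (x v)%:R * sgn_adj u v = (vcard x)%:R - 2 * (vinter (a u) x)%:R.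
Proof.
rewrite /vcard /vinter !natr_sum mulr_sumr -sumrB; apply: eq_bigr => v _.
by rewrite /sgn_adj; case: (a u v); case: (x v) => /=; ring.
Qed.

Lemma seq_sgn u A : \sum_(w <- A) sgn_adj u w = (size A)%:R - 2 * (hits u A)%:R.
Proof.
elim: A => [|w A IH]; first by rewrite /hits !big_nil mulr0 subr0.
rewrite big_cons IH /hits big_cons natrD /= -[(size A).+1%:R]natr1 /sgn_adj.
by case: (a u w) => /=; ring.
Qed.

Definition rounded (K D : nat -> bool) (ch : nat -> nat) (ts : nat -> nat)
    (As : nat -> seq nat) (u : nat) : bool :=
  K u || (D u && (est K (ts (ch u)) (As (ch u)) u < 0)).

(** A hybrid argument: [T i] is rounded on the chunks below [i] and follows [C] on the others, so it
    passes from [C] to the rounded cluster. Rounding one chunk [B] costs [2 |D| |B| / kappa] for the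
    sampling error, which sums to the second term, and one unit for each ordered pair inside the
    chunk. *)
Lemma oracle (K D C : nat -> bool) (ch : nat -> nat) (m : nat) :
  (forall u, (u < n)%N -> K u -> C u) ->
  (forall u, (u < n)%N -> K u -> ~~ D u) ->
  (forall u, (u < n)%N -> C u -> K u || D u) ->
  (forall u, (u < n)%N -> (ch u < m)%N) ->
  exists (ts : nat -> nat) (As : nat -> seq nat), [/\ forall i, (ts i <= n)%N,
    forall i, size (As i) = k, forall i w, w \in As i -> (w < n.+1)%N &
    vpcost p (rounded K D ch ts As) <= vpcost p C +
      2 * (vcard D)%:R ^+ 2 / kappa%:R +
      (pairs (fun u v => [&& D u, D v & ch u == ch v]))%:R].
Proof.
move=> KC KD CKD chm.
have K0 : 0 < kappa%:R :> rat by rewrite ltr0n.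
have kn0 : k%:R != 0 :> rat by rewrite natrX expf_neq0 // gt_eqF.
pose T i ts As u := K u || (D u && (if (ch u < i)%N
   then est K (ts (ch u)) (As (ch u)) u < 0 else C u)).
pose errb i : rat := \sum_(u < n) (D u && (ch u < i)%N)%:R * (2 * (vcard D)%:R / kappa%:R).
pose errp i := pairs (fun u v => [&& D u, D v & (ch u == ch v) && (ch u < i)%N]).
suff H i : exists (ts : nat -> nat) (As : nat -> seq nat), [/\ forall i, (ts i <= n)%N,
    forall i, size (As i) = k, forall i w, w \in As i -> (w < n.+1)%N &
    vpcost p (T i ts As) <= vpcost p C + errb i + (errp i)%:R].
  have [ts [As [H1 H2 H3 H4]]] := H m; exists ts, As; split=> //.
  have ext (x y : nat -> bool) : (forall u : 'I_n, x u = y u) -> vpcost p x = vpcost p y.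
    move=> xy; rewrite !vpcost_quad; congr (_ + _); apply: eq_bigr => u _.
      by rewrite xy.
    by apply: eq_bigr => v _; rewrite !xy.
  rewrite (ext _ (T m ts As)); last by move=> u; rewrite /T /rounded chm.
  apply: le_trans H4 _; apply: lerD; first rewrite lerD2l.
    rewrite /errb -mulr_suml mulrA [X in _ <= X * _]mulrC expr2 -!mulrA.
    rewrite (_ : \sum_(i < n) _ = (vcard D)%:R); last first.
      by rewrite /vcard natr_sum; apply: eq_bigr => u _; rewrite chm // andbT.
    by rewrite le_eqVlt; apply/orP; left; apply/eqP; ring.
  rewrite ler_nat /errp /pairs; apply: leq_sum => u _; apply: leq_sum => v _.
  by case: (u != v :> nat); case: (D u); case: (D v); case: (ch u == ch v); case: (_ < m)%N.
elim: i => [|i [ts [As [H1 H2 H3 H4]]]].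
  exists (fun=> 0%N), (fun=> nseq k 0%N); split=> //.
  - by move=> i; rewrite size_nseq.
  - by move=> i w; rewrite mem_nseq => /andP[_ /eqP->].
  rewrite /errb /errp /pairs big1 ?addr0; last first.
    by move=> u _; rewrite ltn0 andbF mul0r.
  rewrite big1 ?addr0; last first.
    by move=> u _; rewrite big1 // => v _; rewrite ltn0 !andbF.
  rewrite le_eqVlt; apply/orP; left; apply/eqP; rewrite !vpcost_quad.
  have TE (u : 'I_n) : T 0%N (fun=> 0%N) (fun=> nseq k 0%N) u = C u.
    rewrite /T ltn0; have := KC u (ltn_ord u); have := CKD u (ltn_ord u).
    by case: (K u); case: (D u); case: (C u) => //= h1 h2; rewrite ?h1 ?h2 // h1.
  congr (_ + _); apply: eq_bigr => u _; rewrite ?TE //.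
  by apply: eq_bigr => v _; rewrite !TE.
pose x := T i ts As.
pose B u := D u && (ch u == i).
(* The part of the hybrid outside the core. Its size and its sample are what the guess for this
   chunk must supply; the contribution of [K] to the gradient is computed exactly. *)
pose X u := D u && x u.
have XD : (vcard X <= vcard D)%N by apply: leq_sum => u _; rewrite /X; case: (D u); case: (x u).
have cn y : (vcard y <= n)%N.
  rewrite -[X in (_ <= X)%N]card_ord -sum1_card; apply: leq_sum => u _.
  by case: (y u).
have [A [sA HA] leA] : exists2 A : seq nat, size A = k /\ (forall w, w \in A -> (w < n.+1)%N) &
   \sum_(u < n) (B u)%:R * `|\sum_(v < n) (X v)%:R * sgn_adj u v -
       (vcard X)%:R / k%:R * \sum_(w <- A) sgn_adj u w| <= (vcard D)%:R * (vcard B)%:R / kappa%:R.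
  (* If that part is empty there is nothing to sample; zeros fill the list and are multiplied by the
     size 0. *)
  case: (posnP (vcard X)) => [X0|Xpos].
    exists (nseq k 0%N).
      by rewrite size_nseq; split=> // w; rewrite mem_nseq => /andP[_ /eqP->].
    rewrite big1; first by rewrite !mulr_ge0 ?ler0n // invr_ge0 ltW.
    move=> u _; rewrite X0 !mul0r subr0 big1 ?normr0 ?mulr0 // => v _.
    move/eqP: X0; rewrite /vcard sum_nat_eq0 => /forallP /(_ v) /=.
    by case: (X v); rewrite ?mul0r.
  have [A [sA HA] le] := sample_error B kappa0 sgn_sqr Xpos.
  exists A; first by split=> // w /HA /andP[/ltnW].
  apply: le_trans le _; rewrite ler_wpM2r ?invr_ge0 ?(ltW K0) //.
  by rewrite ler_wpM2r // ler_nat.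
pose ts' j := if j == i then vcard X else ts j.
pose As' j := if j == i then A else As j.
exists ts', As'; split.
- by move=> j; rewrite /ts'; case: eqP.
- by move=> j; rewrite /As'; case: eqP.
- by move=> j w; rewrite /As'; case: eqP => _; [apply: HA | apply: H3].
have gE (u : nat) : grad p x u - est K (vcard X) A u =
   2 * (\sum_(v < n) (X v)%:R * sgn_adj u v -
        (vcard X)%:R / k%:R * \sum_(w <- A) sgn_adj u w).
  rewrite seq_sgn sA /grad /est -sum_sgn.
  have -> : \sum_(v < n) (x v)%:R * sgn_adj u v =
     \sum_(v < n) (K v)%:R * sgn_adj u v + \sum_(v < n) (X v)%:R * sgn_adj u v.
    rewrite -big_split /=; apply: eq_bigr => v _; rewrite -mulrDl; congr (_ * _).
    rewrite /X /x /T; have := KD v (ltn_ord v).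
    by case: (K v); case: (D v) => //= h; rewrite ?addr0 ?add0r //; have := h isT.
  ring.
have mv := @vpcost_move p x (T i.+1 ts' As') B (est K (vcard X) A).
apply: le_trans (mv _ _) _ => {mv}.
- move=> u un; rewrite /B /x /T /ts' /As'.
  case: (D u) => //= ne; rewrite (negPf ne) ltnS leq_eqVlt (negPf ne) /=.
  by case: (K u).
- move=> u un; rewrite /B /x /T /ts' /As' => /andP[Du /eqP ->]; rewrite eqxx ltnSn Du /=.
  by case Ku: (K u) => //=; have := KD u un Ku; rewrite Du.
have -> : \sum_(u < n) (B u)%:R * `|grad p x u - est K (vcard X) A u| =
   2 * \sum_(u < n) (B u)%:R * `|\sum_(v < n) (X v)%:R * sgn_adj u v -
       (vcard X)%:R / k%:R * \sum_(w <- A) sgn_adj u w|.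
  rewrite mulr_sumr; apply: eq_bigr => u _.
  by rewrite gE normrM (ger0_norm (_ : 0 <= 2)) // mulrCA.
have eb : errb i.+1 = errb i + 2 * ((vcard D)%:R * (vcard B)%:R / kappa%:R).
  have cB : (vcard B)%:R = \sum_(u < n) (B u)%:R :> rat by rewrite /vcard natr_sum.
  rewrite /errb cB mulr_sumr mulr_suml mulr_sumr -big_split /=.
  apply: eq_bigr => u _; rewrite /B ltnS leq_eqVlt.
  case: (D u); rewrite /= ?mul0r ?mulr0 ?mul0r ?mulr0 ?addr0 //.
  by case: ltngtP => //= _; ring.
have ep : errp i.+1 = (errp i + pairs (fun u v => B u && B v))%N.
  rewrite /errp /pairs -big_split /=; apply: eq_bigr => u _.
  rewrite -big_split /=; apply: eq_bigr => v _; rewrite /B.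
  case: (u != v :> nat) => //=; case: (D u) => //=; case: (D v) => //=; rewrite ?andbF //.
  case: (ch u =P ch v) => [<-|ne] /=; first by rewrite ltnS leq_eqVlt; case: ltngtP.
  by case: (ch u =P i) => // e; case: (ch v =P i) => // e'; case: ne; rewrite e e'.
rewrite eb ep natrD; rewrite -/x in H4; lra.
Qed.
End Oracle.

(** * Candidate clusters *)

Section Counting.
Variable n : nat.
Notation card := (vcard n).
Notation dist := (vdist n).
Notation inter := (vinter n).

Lemma dist_tri x y z : dist x z <= dist x y + dist y z.
Proof.
rewrite /vdist -big_split; apply: leq_sum => v _ /=.
by case: (x v); case: (y v); case: (z v).
Qed.

Lemma dist_sym x y : dist x y = dist y x.
Proof. by apply: eq_bigr => v _; rewrite eq_sym. Qed.

Lemma inter_dist x y z : inter x y <= inter x z + dist z y.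
Proof.
rewrite /vinter /vdist -big_split; apply: leq_sum => v _ /=.
by case: (x v); case: (y v); case: (z v).
Qed.

Lemma vcard_dist x y : card x <= card y + dist x y.
Proof.
rewrite /vcard /vdist -big_split; apply: leq_sum => v _ /=.
by case: (x v); case: (y v).
Qed.

Lemma vcard_le x : card x <= n.
Proof.
rewrite -[X in _ <= X]card_ord -sum1_card; apply: leq_sum => u _.
by case: (x u).
Qed.

Lemma vcard0P x : reflect (forall u, u < n -> ~~ x u) (card x == 0).
Proof.
rewrite /vcard sum_nat_eq0; apply: (iffP forallP) => H.
  by move=> u un; have := H (Ordinal un); case: (x u).
by move=> u; rewrite (negbTE (H _ (ltn_ord u))).
Qed.

Lemma vcard_gt0 x : 0 < card x -> exists2 u, u < n & x u.
Proof.
move=> H; case: (boolP [exists u : 'I_n, x u]) => [/existsP[u xu]|/existsPn h].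
  by exists u.
move: H; rewrite lt0n => /negP[]; apply/vcard0P => u un.
exact: (h (Ordinal un)).
Qed.

Definition rank (D : nat -> bool) (v : nat) := \sum_(w < n) ((w < v) && D w).
Definition chunk (m : nat) (D : nat -> bool) (v : nat) := rank D v %% m.

Lemma rank_lt (D : nat -> bool) v : v < n -> D v -> rank D v < card D.
Proof.
move=> vn Dv; rewrite /rank /vcard (bigD1 (Ordinal vn)) //=.
rewrite [X in _ < X](bigD1 (Ordinal vn)) //= ltnn Dv add0n add1n ltnS.
by apply: leq_sum => w _; case: (w < v); case: (D w).
Qed.

Lemma rank_mono (D : nat -> bool) u v : u < n -> D u -> u < v -> rank D u < rank D v.
Proof.
move=> un Du uv; rewrite /rank (bigD1 (Ordinal un)) //=.
rewrite [X in _ < X](bigD1 (Ordinal un)) //= ltnn uv Du add0n add1n ltnS.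
apply: leq_sum => w _; case: (ltnP w u) => //= wu; by rewrite (ltn_trans wu uv).
Qed.

Lemma rank_inj (D : nat -> bool) u v : u < n -> v < n -> D u -> D v ->
  rank D u = rank D v -> u = v.
Proof.
move=> un vn Du Dv e; case: (ltngtP u v) => // lt.
  by have := rank_mono un Du lt; rewrite e ltnn.
by have := rank_mono vn Dv lt; rewrite e ltnn.
Qed.

(** Members of [D] are dealt out in rotation by rank, so each shares its chunk with at most
    [(L - 1) / m] others, where [L = |D|]. Leaving out the diagonal is what avoids a rounding
    term. *)
Lemma pairs_chunk (m : nat) (D : nat -> bool) : 0 < m ->
  pairs n (fun u v => [&& D u, D v & chunk m D u == chunk m D v]) * m <= card D ^ 2.
Proof.
move=> m0; rewrite /pairs big_distrl /= expnS expn1 {1}/vcard big_distrl /=.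
apply: leq_sum => u _; case Du: (D u) => /=; last first.
  by rewrite big1 ?mul0n // => v _; rewrite andbF.
rewrite mul1n; set L := card D.
have rL (v : 'I_n) : D v -> rank D v < L := rank_lt (ltn_ord v).
pose S := [set v : 'I_n | D v && (chunk m D v == chunk m D u)].
have cS : #|S| <= ((L.-1) %/ m).+1.
  rewrite -[X in _ <= X]card_ord.
  pose f (v : 'I_n) : 'I_((L.-1) %/ m).+1 := inord (rank D v %/ m).
  have fE (v : 'I_n) : D v -> f v = rank D v %/ m :> nat.
    move=> Dv; rewrite inordK // ltnS leq_div2r //.
    by have := rL v Dv; case: (L).
  rewrite -(card_in_imset (f := f)); first exact: max_card.
  move=> v w; rewrite !inE => /andP[Dv /eqP ev] /andP[Dw /eqP ew] /(congr1 val) /=.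
  rewrite -!/(f _) !fE // => e; apply: val_inj; apply: rank_inj Dv Dw _ => //=.
  by rewrite (divn_eq (rank D v) m) (divn_eq (rank D w) m) e; move: ev ew; rewrite /chunk => -> ->.
have SE : #|S| = (\sum_(v < n) ((u != v :> nat) && (D v && (chunk m D u == chunk m D v)))).+1.
  rewrite (cardsD1 u) inE Du eqxx /= add1n; congr _.+1.
  rewrite -sum1_card big_mkcond /=; apply: eq_bigr => v _.
  rewrite !inE -val_eqE /= eq_sym [chunk m D v == _]eq_sym.
  by case: (_ && _).
have le : \sum_(v < n) ((u != v :> nat) && (D v && (chunk m D u == chunk m D v))) <= L.-1 %/ m.
  by rewrite -ltnS -SE.
apply: leq_trans (leq_mul le (leqnn m)) _.
by apply: leq_trans (leq_trunc_div _ _) _; apply: leq_pred.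
Qed.
End Counting.

Section Candidates.
Variables (n : nat) (a : nat -> nat -> bool).
Hypothesis asym : forall u v, u < n -> v < n -> a u v = a v u.
Hypothesis arefl : forall u, u < n -> a u u.
Notation card := (vcard n).
Notation dist := (vdist n).
Notation inter := (vinter n).
Notation cost2 := (vcost n a).
Variable Q : nat.
Hypothesis Q0 : 0 < Q.
Variable p : nat -> rat.
Notation pcost := (vpcost n a p).

(** Both constants come from [class_mid], where [c = cost2 C] is at least [s ^ 2 / 100] and each of
    two errors may cost [c / (2 Q)]. At most [3 s / nroots] vertices are missed, at a cost of
    [6 s ^ 2 / nroots]. With [|D| <= nroots (9 Q) s], the rounding error is [3 |D| ^ 2 / kap]. *)
Definition nroots := 1200 * Q.
Definition kap := 600 * Q * (nroots * (9 * Q)) ^ 2.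

Lemma nroots_gt0 : 0 < nroots. Proof. by rewrite muln_gt0 Q0. Qed.
Lemma kap_gt0 : 0 < kap. Proof. by rewrite !muln_gt0 Q0. Qed.

(* Candidate clusters contain a core [Kset] and a part of the undecided
   vertices [Dset].  Kind 0 serves expensive clusters (no core), kind 1
   near-cliques, and kind 2 singletons and the empty cluster. *)
Definition Tset (roots : seq nat) (v : nat) : bool := 0 < \sum_(w <- roots) a v w.

Definition Kset (kd s0 : nat) (roots : seq nat) (v : nat) : bool :=
  if kd == 0 then false else
  if kd == 1 then 4 * dist (a v) (Tset roots) <= card (Tset roots) else v == s0.

Definition Dset (kd s0 : nat) (roots : seq nat) (v : nat) : bool :=
  if kd == 0 then Tset roots v else
  if kd == 1 then ~~ Kset kd s0 roots v && (card (Tset roots) <= 3 * inter (a v) (Tset roots))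
  else false.

Definition candS kd s0 roots ts As :=
  let D := Dset kd s0 roots in
  rounded n a kap p (Kset kd s0 roots) D (chunk n kap D) ts As.

(** The digits are: the kind, the vertex of kind 2, the roots, and then for each chunk the guessed
    size followed by [kap ^ 2] samples. *)
Definition digit_base (i : nat) := 2 + nroots + i * (kap ^ 2).+1.
Definition ndigits := digit_base kap.

Definition cand (dg : nat -> nat) : nat -> bool :=
  candS (dg 0) (dg 1) [seq dg j.+2 | j <- iota 0 nroots]
    (fun i => dg (digit_base i))
    (fun i => [seq dg (digit_base i + j.+1) | j <- iota 0 (kap ^ 2)]).

Lemma pcost_ext x y : (forall u, u < n -> x u = y u) -> pcost x = pcost y.
Proof.
move=> xy; rewrite !vpcost_quad; congr (_ + _)%R; apply: eq_bigr => u _.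
  by rewrite xy.
by apply: eq_bigr => v _; rewrite !xy.
Qed.

Lemma pcost_sum x : (pcost x = \sum_(u < n) (x u)%:R * ((dist (a u) x)%:R - p u))%R.
Proof.
rewrite /vpcost /vcost natr_sum -sumrB; apply: eq_bigr => u _.
by rewrite natrM -mulrBr.
Qed.

Lemma chunk_lt D v : chunk n kap D v < kap.
Proof. by rewrite ltn_mod kap_gt0. Qed.

Definition digits_of kd s0 (roots : seq nat) (ts : nat -> nat) (As : nat -> seq nat) x :=
  if x == 0 then kd else if x == 1 then s0
  else if x < 2 + nroots then nth 0 roots (x - 2)
  else let y := x - (2 + nroots) in
       if y %% (kap ^ 2).+1 == 0 then ts (y %/ (kap ^ 2).+1)
       else nth 0 (As (y %/ (kap ^ 2).+1)) (y %% (kap ^ 2).+1).-1.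

Lemma cand_digits kd s0 roots ts As :
  size roots = nroots -> (forall i, size (As i) = kap ^ 2) ->
  cand (digits_of kd s0 roots ts As) = candS kd s0 roots ts As.
Proof.
move=> sr sA; rewrite /cand; set dg := digits_of _ _ _ _ _; congr candS.
- apply: (@eq_from_nth _ 0); rewrite size_map size_iota // => j lt.
  by rewrite (nth_map 0) ?size_iota // nth_iota // /dg /digits_of add0n /= !ltnS
     subSS subSS subn0 lt.
- apply: functional_extensionality => i; rewrite /dg /digits_of /digit_base.
  by rewrite /= ltnNge leq_addr /= addKn modnMl eqxx mulnK.
- apply: functional_extensionality => i.
  apply: (@eq_from_nth _ 0); rewrite size_map size_iota // => j lt.
  rewrite (nth_map 0) ?size_iota // nth_iota // /dg /digits_of add0n /digit_base.
  rewrite /= ifF; last by lia.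
  rewrite -addnA addKn divnMDl // divn_small // modnMDl modn_small //=.
  by rewrite addn0.
Qed.

Lemma digits_lt kd s0 roots ts As B :
  kd < B -> s0 < B -> (forall w, w \in roots -> w < B) ->
  (forall i, ts i < B) -> (forall i w, w \in As i -> w < B) ->
  forall x, digits_of kd s0 roots ts As x < B.
Proof.
move=> h1 h2 h3 h4 h5 x; rewrite /digits_of.
have B0 : 0 < B by lia.
do 2?[case: ifP => // _].
case: ifP => _.
  by case: (ltnP (x - 2) (size roots)) => h; [apply/h3/mem_nth | rewrite nth_default].
case: ifP => // _; set A := As _; set i := _.-1.
by case: (ltnP i (size A)) => h; [apply/(h5 (_ %/ _))/mem_nth | rewrite nth_default].
Qed.

Local Open Scope ring_scope.

Variable minf : rat.
Hypothesis minfP : forall dg : nat -> nat,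
  (forall j, (dg j < n + 4)%N) -> minf <= pcost (cand dg).

(** The factor 3 is made of [2 |D| ^ 2 / kap] for sampling and at most [|D| ^ 2 / kap] for the pairs
    inside chunks. *)
Lemma minf_oracle kd s0 (roots : seq nat) (C : nat -> bool) : (kd < 2)%N -> (s0 < n + 4)%N -> size roots = nroots ->
  (forall w, w \in roots -> (w < n + 4)%N) ->
  let K := Kset kd s0 roots in let D := Dset kd s0 roots in
  (forall u, (u < n)%N -> K u -> C u) ->
  (forall u, (u < n)%N -> C u -> K u || D u) ->
  minf <= pcost C + 3 * (card D)%:R ^+ 2 / kap%:R.
Proof.
move=> hk hs sr hr K D KC CKD.
have KD u : (u < n)%N -> K u -> ~~ D u.
  move=> _; rewrite /K /D /Dset /Kset; case: kd hk {K D KC CKD} => [|[|]] //= _ ->.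
  by [].
have [ts [As [t1 t2 t3 t4]]] := oracle asym arefl p kap_gt0 KC KD CKD (fun u _ => chunk_lt D u).
apply: le_trans (minfP (dg := digits_of kd s0 roots ts As) _) _.
  apply: digits_lt => //; first by lia.
    by move=> i; have := t1 i; lia.
  by move=> i w /t3; lia.
rewrite cand_digits //; apply: le_trans t4 _.
have := @pairs_chunk n kap D kap_gt0.
rewrite -(ler_nat rat) natrM natrX => pc.
have K0 : 0 < kap%:R :> rat by rewrite ltr0n kap_gt0.
have pc' : (pairs n (fun u v => [&& D u, D v & chunk n kap D u == chunk n kap D v]))%:R <=
   (card D)%:R ^+ 2 / kap%:R :> rat by rewrite ler_pdivlMr.
rewrite -addrA lerD2l.
have -> : 3 * (card D)%:R ^+ 2 / kap%:R = 2 * (card D)%:R ^+ 2 / kap%:R +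
    (card D)%:R ^+ 2 / kap%:R :> rat by ring.
by rewrite lerD2l.
Qed.

Lemma cand_kind2 s0 ts As u :
  candS 2 s0 (nseq nroots 0%N) ts As u = (u == s0).
Proof. by rewrite /candS /rounded /Kset /Dset /= orbF. Qed.

Lemma minf_kind2 s0 : (s0 < n + 4)%N -> minf <= pcost (fun u => u == s0).
Proof.
move=> hs; pose As := fun i : nat => nseq (kap ^ 2) 0%N.
apply: le_trans (minfP (dg := digits_of 2 s0 (nseq nroots 0%N) (fun=> 0%N) As) _) _.
  apply: digits_lt => //; try lia.
  - by move=> w; rewrite mem_nseq => /andP[_ /eqP->]; lia.
  - by move=> i w; rewrite mem_nseq => /andP[_ /eqP->]; lia.
rewrite cand_digits ?size_nseq //; last by move=> i; rewrite size_nseq.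
rewrite le_eqVlt; apply/orP; left; apply/eqP; apply: pcost_ext => u _.
exact: cand_kind2.
Qed.

Lemma pcost0 (x : nat -> bool) : (forall u, (u < n)%N -> ~~ x u) -> pcost x = 0.
Proof.
move=> H; rewrite /vpcost /vcost !big1 ?subr0 // => u _; by rewrite (negbTE (H _ _)) ?mul0r.
Qed.

(** Kind 2 with the non-vertex [n] gives the empty cluster, of value 0. *)
Lemma minf_le0 : minf <= 0.
Proof.
rewrite -(@pcost0 (fun u => u == n)); first by apply: minf_kind2; lia.
by move=> u un; rewrite (ltn_eqF un).
Qed.

Lemma pcost1 v : (v < n)%N -> pcost (fun u => u == v) = (dist (a v) (fun u => u == v))%:R - p v.
Proof.
move=> vn; rewrite /vpcost /vcost.
have e (F : nat -> rat) : \sum_(u < n) ((u : nat) == v)%:R * F u = F v.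
  rewrite (bigD1 (Ordinal vn)) //= eqxx mul1r big1 ?addr0 // => u.
  by rewrite -val_eqE /= => /negPf ->; rewrite mul0r.
rewrite e natr_sum; under eq_bigr do rewrite natrM.
by rewrite (e (fun u => (dist (a u) (fun u => u == v))%:R)).
Qed.

(** [C] is replaced by [C] minus [M] and the singletons of [M]. A vertex of the main part gains at
    most [|M|] in distance and a singleton at most [|C|], which is [2 |C| |M|] in total. The main
    part has weight at least 1 unless empty, and a larger weight only helps since [minf] is not
    positive. *)
Lemma split_bound (C M : nat -> bool) (dl : rat) : 0 <= dl ->
  (forall u, (u < n)%N -> M u -> C u) ->
  minf <= pcost (fun u => C u && ~~ M u) + dl ->
  (card C)%:R * minf <= pcost C + 2 * (card C)%:R * (card M)%:R + dl.
Proof.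
move=> dl0 MC le; set C' := fun u => _ in le.
have cC : card C = (card C' + card M)%N.
  rewrite /vcard -big_split; apply: eq_bigr => u _ /=; rewrite /C'.
  by have := MC u (ltn_ord u); case: (M u); case: (C u) => // /(_ isT).
have hM : (card M)%:R * minf <= \sum_(v < n) (M v)%:R * ((dist (a v) C)%:R + (card C)%:R - p v).
  rewrite /vcard natr_sum mulr_suml -/(card C); apply: ler_sum => v _.
  case Mv: (M v); rewrite ?mul0r // !mul1r.
  apply: le_trans (minf_kind2 (_ : (v < n + 4)%N)) _; first by have := ltn_ord v; lia.
  rewrite pcost1 // lerD2r -natrD ler_nat.
  apply: leq_trans (dist_tri n _ C _) _; rewrite leq_add2l.
  apply: leq_sum => u _; case: (u =P v :> nat) => [->|_]; last by case: (C u).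
  by rewrite MC.
have hC : (card C')%:R * minf <= pcost C' + dl.
  case: (posnP (card C')) => [/eqP e|c0].
    rewrite (eqP e) mul0r pcost0 ?add0r //; exact/vcard0P.
  apply: le_trans le; rewrite -[X in _ <= X]mul1r ler_wnM2r ?minf_le0 //.
  by rewrite ler1n.
have pC : pcost C' <= \sum_(u < n) (C' u)%:R * ((dist (a u) C)%:R + (card M)%:R - p u).
  rewrite pcost_sum; apply: ler_sum => u _.
  rewrite ler_wpM2l // lerD2r -natrD ler_nat.
  apply: leq_trans (dist_tri n _ C _) _; rewrite leq_add2l.
  by apply: leq_sum => w _; rewrite /C'; case: (C w); case: (M w).
have tot : \sum_(u < n) (C' u)%:R * ((dist (a u) C)%:R + (card M)%:R - p u) +
   \sum_(v < n) (M v)%:R * ((dist (a v) C)%:R + (card C)%:R - p v) =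
   pcost C + (card C')%:R * (card M)%:R + (card M)%:R * (card C)%:R.
  have -> : (card C')%:R * (card M)%:R = \sum_(u < n) (C' u)%:R * (card M)%:R :> rat.
    by rewrite -mulr_suml /vcard natr_sum.
  have -> : (card M)%:R * (card C)%:R = \sum_(u < n) (M u)%:R * (card C)%:R :> rat.
    by rewrite -mulr_suml {1}/vcard natr_sum.
  rewrite pcost_sum -!big_split /=; apply: eq_bigr => u _.
  rewrite /C'; have := MC u (ltn_ord u).
  by case: (M u); case: (C u) => h; rewrite ?(h isT) /=; try ring; have := h isT.
have cle : (card C')%:R <= (card C)%:R :> rat by rewrite ler_nat cC leq_addr.
have M0 : 0 <= (card M)%:R :> rat by [].
rewrite cC natrD mulrDl -natrD -cC; nra.
Qed.
End Candidates.

(** * Candidates against one class of an optimal clustering *)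

Section Classes.
Variables (n : nat) (a : nat -> nat -> bool).
Hypothesis asym : forall u v, u < n -> v < n -> a u v = a v u.
Hypothesis arefl : forall u, u < n -> a u u.
Notation card := (vcard n).
Notation dist := (vdist n).
Notation inter := (vinter n).
Notation cost2 := (vcost n a).

Lemma inter_swap (x y : nat -> bool) :
  \sum_(u < n) x u * inter (a u) y = \sum_(u < n) y u * inter (a u) x.
Proof.
rewrite /vinter; under eq_bigr do rewrite big_distrr /=.
under [RHS]eq_bigr do rewrite big_distrr /=.
rewrite exchange_big /=; apply: eq_bigr => v _; apply: eq_bigr => u _.
by rewrite asym //; case: (x u); case: (y v); case: (a v u).
Qed.

(** That is, [(3/4) ^ k <= 3 / (k + 3)]: the geometric decay is weakened to a harmonic one, for
    which linearly many roots in [Q] suffice. *)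
Lemma pow_ratio k : 3 ^ k * (k + 3) <= 3 * 4 ^ k.
Proof.
elim: k => // k IH; have h : 3 ^ k <= 4 ^ k by case: k {IH} => // k; rewrite leq_exp2r.
by rewrite !expnS; nia.
Qed.

(** Greedy cover. Every uncovered vertex has at least [|C| / 4 >= |G| / 4] neighbours in [G], so by
    double counting some vertex of [G] is adjacent to a quarter of the uncovered ones. *)
Lemma cover_exists (C G : nat -> bool) k :
  (forall u, u < n -> G u -> C u) -> 0 < card C ->
  (forall v, v < n -> C v -> card C <= 4 * inter (a v) G) ->
  exists A : seq nat, [/\ size A = k, forall w, w \in A -> (w < n) && G w &
    4 ^ k * card (fun v => C v && ~~ Tset a A v) <= 3 ^ k * card C].
Proof.
move=> GC C0 HG.
have G0 : 0 < card G.
  have [v vn Cv] := vcard_gt0 C0; have := HG v vn Cv.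
  have : inter (a v) G <= card G by apply: leq_sum => w _; case: (a v w); case: (G w).
  by lia.
elim: k => [|k [A [sA HA IH]]].
  exists [::]; split=> //; rewrite !mul1n; apply: leq_sum => v _.
  by case: (C v); case: (Tset _ _ _).
set U := fun v => _ in IH.
have [||r /andP[rn Gr] Hr] := @sum_avg n G (fun r => - (4 * inter (a r) U)%:R)%R (- (card U)%:R)%R.
- exact: G0.
- under eq_bigr do rewrite mulrN -natrM.
  rewrite sumrN mulrN lerN2 -natr_sum -natrM ler_nat.
  under eq_bigr do rewrite mulnCA.
  rewrite -big_distrr /= inter_swap.
  have CG : card G <= card C by apply: leq_sum => u _; have := GC u (ltn_ord u); case: (G u) => // ->.
  apply: (leq_trans (leq_mul CG (leqnn (card U)))).
  rewrite [X in _ * X]/vcard big_distrr [X in _ <= X]big_distrr /=; apply: leq_sum => v _.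
  case Uv: (U v); rewrite ?muln0 // muln1 mul1n.
  by apply: HG => //; move: Uv; rewrite /U; case: (C v).
rewrite lerN2 ler_nat in Hr.
exists (rcons A r); split; first by rewrite size_rcons sA.
  by move=> w; rewrite mem_rcons inE => /orP[/eqP->|/HA //]; rewrite rn.
set U' := fun v => _.
have UU : card U' + inter (a r) U <= card U.
  rewrite /vcard /vinter -big_split /=; apply: leq_sum => v _.
  rewrite /U' /U /Tset -cats1 big_cat big_seq1 /= (asym (ltn_ord v) rn) addn_gt0.
  by case: (C v); case: (0 < _); case: (a r v).
by rewrite !expnS; nia.
Qed.

Variable Q : nat.
Hypothesis Q0 : 0 < Q.
Variable p : nat -> rat.
Notation pcost := (vpcost n a p).
Variable minf : rat.
Hypothesis minfP : forall dg : nat -> nat,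
  (forall j, dg j < n + 4) -> (minf <= pcost (cand n a Q p dg))%R.

Variable C : nat -> bool.
(** The only two consequences of optimality in use: a vertex of [C] does not gain by becoming a
    singleton, and a vertex outside does not gain by moving from its class [C'] to [C]. *)
Hypothesis inner : forall v, v < n -> C v -> card C < 2 * inter (a v) C.
Hypothesis outer : forall v, v < n -> ~~ C v -> exists C' : nat -> bool,
  [/\ forall u, u < n -> ~~ (C u && C' u), C' v & dist (a v) C' <= dist (a v) C].
Notation s := (card C).

(* Splitting [C] into singletons raises the cost by at most [2 s ^ 2]. *)
Lemma class_huge : 2 * Q * s ^ 2 <= cost2 C ->
  (s%:R * minf <= pcost C + (cost2 C)%:R / Q%:R)%R.
Proof.
move=> le; have := @split_bound n a Q Q0 p minf minfP C C 0%R (lexx _).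
rewrite !addr0 => /(_ (fun _ _ H => H)) H.
apply: le_trans (H _) _.
  by rewrite pcost0 ?(minf_le0 Q0 minfP) // => u _; case: (C u).
rewrite lerD2l ler_pdivlMr ?ltr0n // -!natrM ler_nat.
by apply: leq_trans le; nia.
Qed.

(* All but [s / 4] vertices of [C] have at most [9 Q s] neighbours.  The
   neighbourhoods of greedily chosen roots miss few vertices of [C] and have a
   union of size O(s), so that everything can be left undecided. *)
Lemma class_mid : 0 < s -> cost2 C <= 2 * Q * s ^ 2 -> s ^ 2 <= 100 * cost2 C ->
  (s%:R * minf <= pcost C + (cost2 C)%:R / Q%:R)%R.
Proof.
move=> s0 le1 le2; set c := cost2 C in le1 le2 *.
pose H v := C v && (9 * Q * s < card (a v)).
(* Each vertex of [H] adds at least [(9 Q - 1) s] to a cost of at most [2 Q s ^ 2], and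
   [8 Q <= 9 Q - 1]. *)
have H4 : 4 * card H <= s.
  have h : card H * ((9 * Q - 1) * s) <= c.
    rewrite /vcard big_distrl /= /c /vcost; apply: leq_sum => v _.
    rewrite -/(card C) /H; case: (C v); rewrite ?mul0n //= mul1n.
    case: ltnP => // lt; rewrite mul1n.
    by have := vcard_dist n (a v) C; rewrite mulnBl mul1n; lia.
  have : card H * (9 * Q - 1) <= 2 * Q * s.
    have : card H * (9 * Q - 1) * s <= 2 * Q * s * s by rewrite -mulnA; lia.
    by rewrite leq_pmul2r.
  by nia.
pose G v := C v && ~~ H v.
(* By [inner] more than half of [C] is adjacent to [v], and at most a quarter of [C] is lost to
   [H]. *)
have CG v : v < n -> C v -> card C <= 4 * inter (a v) G.
  move=> vn Cv; have := inner vn Cv.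
  have : inter (a v) C <= inter (a v) G + card H.
    rewrite /vinter /vcard -big_split /=; apply: leq_sum => u _; rewrite /G.
    by case: (a v u); case: (C u); case: (H u).
  by lia.
have [A [sA HA HM]] := @cover_exists C G (nroots Q) (fun u _ => fun h => proj1 (andP h)) s0 CG.
pose M v := C v && ~~ Tset a A v.
have M3 : card M * nroots Q <= 3 * s.
  rewrite -/M in HM; have := pow_ratio (nroots Q).
  have e0 : 0 < 3 ^ nroots Q by rewrite expn_gt0.
  move: HM; set e := 3 ^ _ in e0 *; set f := 4 ^ _; move: (card M) (nroots Q) => mu k h1 h2.
  have : mu * (e * (k + 3)) <= mu * (3 * f) by rewrite leq_mul2l h2 orbT.
  have -> : mu * (3 * f) = 3 * (f * mu) by lia.
  move=> h3; have : e * (mu * k) <= e * (3 * s) by nia.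
  by rewrite leq_pmul2l.
have TC : card (Tset a A) <= nroots Q * (9 * Q * s).
  rewrite -sA; elim: (A) HA => [|r A' IH] HA'.
    by rewrite /vcard big1 // => v _; rewrite /Tset big_nil.
  have /andP[rn /andP[Cr Hr]] := HA' r (mem_head _ _).
  have cr : card (a r) <= 9 * Q * s by move: Hr; rewrite /H Cr /= -leqNgt.
  have IH' : card (Tset a A') <= size A' * (9 * Q * s).
    by apply: IH => w wA; apply: HA'; rewrite inE wA orbT.
  rewrite /= mulSn; apply: leq_trans (leq_add cr IH').
  rewrite /vcard -big_split /=; apply: leq_sum => v _.
  rewrite /Tset big_cons (asym (ltn_ord v) rn) addn_gt0.
  by case: (a r v); case: (0 < \sum_(w <- A') a v w).
have K0 := kap_gt0 Q0.
have rA w : w \in A -> w < n + 4 by move=> /HA /andP[]; lia.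
have h1 u : u < n -> Kset n a 0 0 A u -> C u && ~~ M u by [].
have h2 u : u < n -> C u && ~~ M u -> Kset n a 0 0 A u || Dset n a 0 0 A u.
  by move=> un; rewrite /M /Dset /=; case: (C u); case: (Tset a A u).
have or := minf_oracle asym arefl Q0 minfP (isT : 0 < 2) (ltn_addl n (isT : 0 < 4)) sA rA h1 h2.
rewrite /Dset /= in or.
have dl0 : (0 <= 3 * (card (Tset a A))%:R ^+ 2 / (kap Q)%:R :> rat)%R.
  by rewrite divr_ge0 ?mulr_ge0 ?exprn_ge0.
apply: le_trans (split_bound Q0 minfP dl0 _ or) _.
  by move=> u _; rewrite /M; case: (C u).
rewrite -addrA lerD2l.
(* The allowance [c / Q] is shared equally: [e1] pays for the missed vertices [M], and [e2] for the
   rounding error. *)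
have e1 : 2 * s * card M * (2 * Q) <= c.
  have h : nroots Q * (s * card M) <= 3 * s ^ 2 by nia.
  rewrite /nroots in h; have : 1200 * (Q * (s * card M)) <= 300 * c by lia.
  by nia.
have e2 : 3 * card (Tset a A) ^ 2 * (2 * Q) <= c * kap Q.
  have h : card (Tset a A) ^ 2 <= (nroots Q * (9 * Q)) ^ 2 * s ^ 2.
    by rewrite -expnMn -mulnA leq_exp2r.
  rewrite /kap; move: h; set y := _ ^ 2; set z := (_ * (9 * Q)) ^ 2 => h.
  have h3 : y <= z * (100 * c) := leq_trans h (leq_mul (leqnn z) le2).
  have : Q * y <= Q * (z * (100 * c)) by rewrite leq_mul2l h3 orbT.
  by move: z {h h3} => z; nia.
have Q0' : (0 < Q%:R :> rat)%R by rewrite ltr0n.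
have K0' : (0 < (kap Q)%:R :> rat)%R by rewrite ltr0n.
have f1 : (2 * s%:R * (card M)%:R <= c%:R / Q%:R / 2 :> rat)%R.
  move: e1; rewrite -(ler_nat rat) !natrM => e1.
  rewrite ler_pdivlMr // ler_pdivlMr //; lra.
have f2 : (3 * (card (Tset a A))%:R ^+ 2 / (kap Q)%:R <= c%:R / Q%:R / 2 :> rat)%R.
  move: e2 K0'; move: (kap Q) (card (Tset a A)) => kp t e2 K0'.
  have -> : (c%:R / Q%:R / 2 = c%:R / (2 * Q%:R) :> rat)%R by field; rewrite gt_eqF.
  rewrite ler_pdivrMr // [X in (_ <= X)%R]mulrAC ler_pdivlMr ?mulr_gt0 //.
  move: e2; rewrite -(ler_nat rat) natrM natrM natrM natrX natrM => e2.
  lra.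
move: f1 f2; set x1 := (2 * _ * _)%R; set x2 := (3 * _ / _)%R; set y := (_ / Q%:R)%R.
lra.
Qed.

(* The neighbourhood [T] of an average vertex of [C] differs from [C] in at most
   [cost2 C / s] vertices.  By optimality of the clustering, the vertices whose
   neighbourhood is close to [T] are in [C]; few others are undecided. *)
Lemma class_cheap : 0 < s -> 100 * cost2 C <= s ^ 2 ->
  (s%:R * minf <= pcost C + (cost2 C)%:R / Q%:R)%R.
Proof.
move=> s0 le; set c := cost2 C in le *.
have [||r /andP[rn Cr] Hr] := @sum_avg n C (fun r => (s * dist (a r) C)%:R)%R c%:R.
- exact: s0.
- under eq_bigr do rewrite -natrM mulnCA.
  by rewrite -natr_sum -big_distrr /= natrM.
rewrite ler_nat in Hr.
(* The code of a candidate has a fixed number of root digits; repeating [r] makes their union the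
   single neighbourhood of [r]. *)
pose roots := nseq (nroots Q) r.
pose T := Tset a roots.
have TE v : v < n -> T v = a r v.
  move=> vn; rewrite /T /Tset /roots big_nseq (asym rn vn).
  have : 0 < nroots Q by apply: nroots_gt0.
  case: (a v r) => /=.
    by case: (nroots Q) => // k _; rewrite iterS.
  by move=> _; elim: (nroots Q).
have Td x : dist T x = dist (a r) x by apply: eq_bigr => v _; rewrite TE.
set d0 := dist (a r) C in Hr.
have d0s : 100 * d0 <= s.
  have : s * (100 * d0) <= s * s by nia.
  by rewrite leq_pmul2l.
have t1 : card T <= s + d0 by rewrite -[d0]Td; apply: vcard_dist.
have t2 : s <= card T + d0 by rewrite -[d0]Td dist_sym; apply: vcard_dist.
pose K := Kset n a 1 0 roots; pose D := Dset n a 1 0 roots.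
have dT v : dist (a v) C <= dist (a v) T + d0 by rewrite -[d0]Td; apply: dist_tri.
have dT' v : dist (a v) T <= dist (a v) C + d0.
  by rewrite -[d0]Td [X in _ + X]dist_sym; apply: dist_tri.
have iT v : inter (a v) C <= inter (a v) T + d0 by rewrite -[d0]Td; apply: inter_dist.
have iT' v : inter (a v) T <= inter (a v) C + d0.
  by rewrite -[d0]Td [X in _ + X]dist_sym; apply: inter_dist.
(* If such a [v] were outside [C], then [C] and the class [C'] of [v] would both be within
   [|T| / 4 + d0] of its neighbourhood. But they are disjoint, so at distance at least [s + 1],
   while [|T| <= s + d0] and [100 d0 <= s]. *)
have KC v : v < n -> K v -> C v.
  move=> vn; rewrite /K /Kset /= -/T => Kv; apply/negPn/negP => nC.
  have [C' [dis C'v le']] := outer vn nC.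
  have : s + card C' <= dist C C'.
    rewrite /vcard /vdist -big_split /=; apply: leq_sum => u _.
    by have := dis u (ltn_ord u); case: (C u); case: (C' u).
  have : 0 < card C'.
    rewrite lt0n; apply/negP => /vcard0P /(_ v vn); by rewrite C'v.
  have := dist_tri n C (a v) C'; rewrite [dist C (a v)]dist_sym.
  by have := dT v; lia.
have CKD v : v < n -> C v -> K v || D v.
  move=> vn Cv; rewrite /D /Dset /= -/K -/T; case: (K v) => //=.
  by have := inner vn Cv; have := iT v; lia.
have outC : \sum_(v < n) (~~ C v) * inter (a v) C <= c.
  rewrite (inter_swap (fun v => ~~ C v) C) /c /vcost; apply: leq_sum => u _.
  rewrite leq_mul2l; apply/orP; right; apply: leq_sum => w _.
  by case: (a u w); case: (C w).
(* An undecided vertex of [C] is not in the core, so its neighbourhood is at distance at least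
   [s / 5] from [C]; one outside has at least [s / 4] neighbours in [C]. The former distances sum to
   at most [c], and so do the edges leaving [C], by [outC]. *)
have Ds : card D * s <= 9 * c.
  apply: (@leq_trans (\sum_(v < n) (5 * (C v * dist (a v) C) + 4 * ((~~ C v) * inter (a v) C)))).
    rewrite /vcard big_distrl /=; apply: leq_sum => v _; rewrite -/(card C).
    rewrite /D /Dset /= -/T; case Dv: (_ && _); rewrite ?mul0n // mul1n.
    move/andP: Dv => [nK iv]; rewrite /Kset /= -/T -ltnNge in nK.
    have := dT' v; have := iT' v.
    by case: (C v); rewrite /= ?mul0n ?muln0 ?mul1n ?addn0 ?add0n; lia.
  rewrite big_split /= -!big_distrr /=; apply: (@leq_trans (5 * c + 4 * c)); last by lia.
  by rewrite leq_add // leq_mul2l outC.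
(* Squaring [Ds] gives [81 c ^ 2 / s ^ 2], and [100 c <= s ^ 2]. *)
have D2 : card D ^ 2 <= c.
  have h1 : (card D * s) ^ 2 <= 81 * c ^ 2.
    by rewrite (_ : 81 = 9 ^ 2) // -expnMn leq_exp2r.
  have h2 : s ^ 2 * (card D ^ 2) <= s ^ 2 * c.
    by rewrite mulnC -expnMn; apply: leq_trans h1 _; nia.
  by move: h2; rewrite leq_pmul2l // expn_gt0 s0.
have rA w : w \in roots -> w < n + 4 by rewrite mem_nseq => /andP[_ /eqP->]; lia.
have or := minf_oracle asym arefl Q0 minfP (isT : 1 < 2) (ltn_addl n (isT : 0 < 4)) (size_nseq _ _) rA KC CKD.
have m0 := minf_le0 Q0 minfP.
(* One candidate is enough here; the weight [s >= 1] is dropped because [minf <= 0]. *)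
apply: (@le_trans _ _ minf).
  rewrite -[X in (_ <= X)%R]mul1r ler_wnM2r // ler1n; exact: s0.
apply: le_trans or _; rewrite lerD2l.
have Q0' : (0 < Q%:R :> rat)%R by rewrite ltr0n.
have K0' : (0 < (kap Q)%:R :> rat)%R by rewrite ltr0n kap_gt0.
have kQ : 3 * Q <= kap Q.
  rewrite /kap; set y := _ ^ 2.
  have : 0 < y by rewrite expn_gt0 !muln_gt0 Q0.
  by nia.
rewrite -/D; move: K0' kQ D2; move: (kap Q) (card D) => kp t K0' kQ D2.
rewrite ler_pdivrMr // [X in (_ <= X)%R]mulrAC ler_pdivlMr // -natrX -!natrM ler_nat.
have : t ^ 2 * (3 * Q) <= c * kp by apply: leq_mul.
by lia.
Qed.

Lemma class_bound : (s%:R * minf <= pcost C + (cost2 C)%:R / Q%:R)%R.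
Proof.
case: (posnP s) => [/eqP s0|s0].
  rewrite (eqP s0) mul0r pcost0; last exact/vcard0P.
  by rewrite add0r divr_ge0.
case: (leqP (2 * Q * s ^ 2) (cost2 C)) => [|/ltnW le1]; first exact: class_huge.
case: (leqP (s ^ 2) (100 * cost2 C)) => [|/ltnW]; first exact: class_mid.
exact: class_cheap.
Qed.
End Classes.

(** * Optimal colourings and regret *)

Section Colouring.
Variables (n : nat) (a : nat -> nat -> bool).
Hypothesis asym : forall u v, u < n -> v < n -> a u v = a v u.
Hypothesis arefl : forall u, u < n -> a u u.
Notation card := (vcard n).
Notation dist := (vdist n).
Notation inter := (vinter n).
Notation cost2 := (vcost n a).
Notation colour := {set 'I_n}.
Notation colouring := {ffun 'I_n -> colour}.

(** Colours are vertex sets, so that [pblock P] is itself a colouring and spare colours exist.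
    Ordered pairs are summed, which gives twice the cost of the clustering. *)
Definition colcost (c : colouring) := \sum_(u < n) \sum_(v < n) (a u v != (c u == c v)).
Definition class (c : colouring) (k : colour) (v : nat) : bool :=
  if insub v is Some v' then c v' == k else false.

Lemma classE c k (v : 'I_n) : class c k v = (c v == k).
Proof. by rewrite /class valK. Qed.

Lemma sum_classes (R : nmodType) (c : colouring) (F : 'I_n -> colour -> R) :
  (\sum_(k : colour) \sum_(u < n) (if c u == k then F u k else 0) = \sum_(u < n) F u (c u))%R.
Proof.
rewrite exchange_big /=; apply: eq_bigr => u _.
by rewrite -big_mkcond /= (bigD1 (c u)) //= big1 ?addr0 // => k /andP[/eqP->]; rewrite eqxx.
Qed.

Lemma sum_class_cost c : \sum_(k : colour) cost2 (class c k) = colcost c.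
Proof.
transitivity (\sum_(k : colour) \sum_(u < n) (if c u == k then dist (a u) (class c k) else 0)).
  apply: eq_bigr => k _; apply: eq_bigr => u _.
  by rewrite classE; case: eqP; rewrite ?mul1n ?mul0n.
rewrite (sum_classes c (fun u k => dist (a u) (class c k)) : _ = _).
by apply: eq_bigr => u _; apply: eq_bigr => v _; rewrite classE eq_sym [c v == _]eq_sym eq_sym.
Qed.

(** The row and the column of [v] are set apart from the rest, which recolouring [v] does not
    change. *)
Lemma colcost_row c (v : 'I_n) : colcost c =
  2 * dist (a v) (class c (c v)) +
  \sum_(u < n | u != v) \sum_(w < n | w != v) (a u w != (c u == c w)).
Proof.
rewrite /colcost (bigD1 v) //=.
have -> : \sum_(w < n) (a v w != (c v == c w)) = dist (a v) (class c (c v)).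
  by apply: eq_bigr => w _; rewrite classE [c w == _]eq_sym.
rewrite mul2n -addnn -addnA; congr (_ + _).
under eq_bigr => u _ do rewrite (bigD1 v) //=.
rewrite big_split /=; congr (_ + _).
rewrite /vdist [RHS](bigD1 v) //= classE eqxx arefl // add0n.
by apply: eq_bigr => u _; rewrite classE asym.
Qed.

Definition recolour (c : colouring) (v : 'I_n) (k : colour) : colouring :=
  [ffun u => if u == v then k else c u].

Lemma recolour_le c (v : 'I_n) k : (forall c', colcost c <= colcost c') ->
  dist (a v) (class c (c v)) <= dist (a v) (class (recolour c v k) k).
Proof.
move=> /(_ (recolour c v k)); rewrite (colcost_row c v) (colcost_row (recolour c v k) v).
rewrite {2}/recolour ffunE eqxx.
have -> : \sum_(u < n | u != v) \sum_(w < n | w != v)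
    (a u w != (recolour c v k u == recolour c v k w)) =
   \sum_(u < n | u != v) \sum_(w < n | w != v) (a u w != (c u == c w)).
  apply: eq_bigr => u /negPf uv; apply: eq_bigr => w /negPf wv.
  by rewrite !ffunE uv wv.
by rewrite leq_add2r leq_mul2l.
Qed.

(** At most [n] of the [2 ^ n] colours are in use. *)
Lemma fresh_colour (c : colouring) : exists k : colour, forall u, c u != k.
Proof.
case: (boolP [forall k, k \in codom c]) => [/forallP H|/forallPn[k kc]]; last first.
  exists k => u; apply: contraNneq kc => <-; exact: codom_f.
have : #|{: colour}| <= size (codom c).
  have -> : #|{: colour}| = #|codom c| by apply: eq_card => k; rewrite H.
  exact: card_size.
rewrite size_codom card_ord -cardsT -powersetT card_powerset cardsT card_ord.
by rewrite leqNgt ltn_expl.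
Qed.

Lemma dist_card x y : dist x y + 2 * inter x y = card x + card y.
Proof.
rewrite /vdist /vinter /vcard big_distrr -!big_split /=; apply: eq_bigr => v _.
by case: (x v); case: (y v).
Qed.

(** Recolouring [v] with a fresh colour puts its row at [|N[v]| - 1], whereas in its class [C] it is
    [|N[v]| + |C| - 2 |N[v] ∩ C|]. *)
Lemma opt_inner c (k : colour) : (forall c', colcost c <= colcost c') ->
  forall v, v < n -> class c k v -> card (class c k) < 2 * inter (a v) (class c k).
Proof.
move=> opt v vn; have [w <-] : exists w : 'I_n, w = v :> nat by exists (Ordinal vn).
rewrite classE => /eqP cw; have [k' fr] := fresh_colour c.
have := recolour_le w k' opt; rewrite cw.
have -> : dist (a w) (class (recolour c w k') k') = (card (a w)).-1.
  rewrite /vcard (bigD1 w) //= arefl // add1n /= /vdist (bigD1 w) //=.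
  rewrite classE ffunE eqxx eqxx arefl //= add0n; apply: eq_bigr => u /negPf uw.
  by rewrite classE ffunE uw (negPf (fr u)); case: (a _ _).
have : 0 < card (a w) by rewrite /vcard (bigD1 w) //= arefl.
by have := dist_card (a w) (class c k); lia.
Qed.

(** [C'] is the present class of [v]. Moving [v] would put it in [C] with [v] added, which is no
    farther from [N[v]] than [C], since [v] lies in [N[v]]. *)
Lemma opt_outer c (k : colour) : (forall c', colcost c <= colcost c') ->
  forall v, v < n -> ~~ class c k v -> exists C' : nat -> bool,
  [/\ forall u, u < n -> ~~ (class c k u && C' u), C' v
    & dist (a v) C' <= dist (a v) (class c k)].
Proof.
move=> opt v vn; have [w <-] : exists w : 'I_n, w = v :> nat by exists (Ordinal vn).
rewrite classE => cw; exists (class c (c w)); split.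
- move=> u un; have [x <-] : exists x : 'I_n, x = u :> nat by exists (Ordinal un).
  rewrite !classE; apply/andP => -[/eqP-> /eqP e].
  by rewrite e eqxx in cw.
- by rewrite classE.
- apply: leq_trans (recolour_le w k opt) _; apply: leq_sum => u _.
  rewrite !classE ffunE; case: (u =P w) => [->|//].
  by rewrite eqxx arefl.
Qed.

Lemma best_colouring : exists c : colouring, forall c', colcost c <= colcost c'.
Proof.
have [c _ H] := arg_minnP colcost (isT : xpredT ([ffun=> set0] : colouring)).
by exists c => c'; apply: H.
Qed.

Lemma round_bound (c : colouring) (Q : nat) p minf : (forall c', colcost c <= colcost c') ->
  0 < Q ->
  (forall dg : nat -> nat, (forall j, dg j < n + 4) ->
     (minf <= vpcost n a p (cand n a Q p dg))%R) ->
  (n%:R * minf <= (colcost c)%:R * (1 + Q%:R^-1) - \sum_(u < n) p u)%R.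
Proof.
move=> opt Q0 H.
have B k := class_bound asym arefl Q0 H (opt_inner (k := k) opt) (opt_outer (k := k) opt).
have : (\sum_(k : colour) (card (class c k))%:R * minf <=
   \sum_(k : colour) (vpcost n a p (class c k) + (cost2 (class c k))%:R / Q%:R))%R.
  by apply: ler_sum => k _; apply: B.
rewrite -mulr_suml -natr_sum.
have -> : \sum_(k : colour) card (class c k) = n.
  transitivity (\sum_(k : colour) \sum_(u < n) (if c u == k then 1 else 0)).
    apply: eq_bigr => k _; apply: eq_bigr => u _.
    by rewrite classE; case: eqP.
  by rewrite (sum_classes c (fun _ _ => 1)) sum1_card card_ord.
rewrite big_split /= -mulr_suml -natr_sum sum_class_cost.
rewrite /vpcost sumrB -natr_sum sum_class_cost.
have -> : (\sum_(k : colour) \sum_(u < n) (class c k u)%:R * p u = \sum_(u < n) p u)%R.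
  rewrite -(sum_classes c (fun u _ => p u)); apply: eq_bigr => k _.
  by apply: eq_bigr => u _; rewrite classE; case: eqP; rewrite ?mul1r ?mul0r.
by move=> h; apply: le_trans h _; rewrite mulrDr mulr1; lra.
Qed.
End Colouring.

(** * Regret of the price updates and repair of the cover *)

Section Regret.
Local Open Scope ring_scope.
Variables (n : nat) (a : nat -> nat -> bool) (S : nat -> nat -> bool).
Notation dist := (vdist n).
Notation cost2 := (vcost n a).

Definition cnt (t u : nat) : nat := (\sum_(t' < t) S t' u)%N.
(** Gradient ascent with step [1 / E]: each round raises every price by one step and lowers those of
    the covered vertices by [n] steps. Being covered once in [n] rounds keeps a price in balance. *)
Definition price (E t u : nat) : rat := (t%:R - n%:R * (cnt t u)%:R) / E%:R.
Definition trunc (N t u : nat) : bool := S t u && (cnt t u < N)%N.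

Lemma cntS t u : cnt t.+1 u = (cnt t u + S t u)%N.
Proof. by rewrite /cnt big_ord_recr. Qed.

Lemma cost2_sub (x y : nat -> bool) : (forall u, (u < n)%N -> y u -> x u) ->
  (cost2 y <= cost2 x + n * \sum_(u < n) (x u && ~~ y u))%N.
Proof.
move=> yx; set d := (\sum_(u < n) (x u && ~~ y u))%N.
have dE : vdist n x y = d.
  apply: eq_bigr => u _; have := yx u (ltn_ord u).
  by case: (x u); case: (y u) => // /(_ isT).
have -> : (n * d = \sum_(u < n) d)%N by rewrite sum_nat_const card_ord.
rewrite /vcost -big_split /=; apply: leq_sum => u _.
case yu: (y u) => //; rewrite (yx u) // !mul1n.
by rewrite -dE; apply: dist_tri.
Qed.

Lemma trunc_count N T u : (\sum_(t < T) trunc N t u = minn N (cnt T u))%N.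
Proof.
elim: T => [|T IH]; first by rewrite /cnt !big_ord0 minn0.
rewrite big_ord_recr /= IH cntS /trunc.
by case: (S T u) => /=; case: ltnP; lia.
Qed.

(* Online gradient ascent on the prices telescopes to the squared imbalance
   of the cover, which by AM-GM pays for repairing it. *)
Lemma regret (Q : nat) (opt : rat) : (0 < n)%N -> (0 < Q)%N ->
  let N := (n ^ 5 * Q ^ 2)%N in let E := (n ^ 3 * Q)%N in let T := (n * N)%N in
  (forall t, (t < T)%N -> n%:R * vpcost n a (price E t) (S t) <=
      opt - \sum_(u < n) price E t u) ->
  (\sum_(t < T) cost2 (trunc N t) + n * \sum_(u < n) (N - cnt T u))%:R <=
  N%:R * (opt + Q%:R^-1).
Proof.
move=> n0 Q0 N E T H.
have n0' : 0 < n%:R :> rat by rewrite ltr0n.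
have Q0' : 0 < Q%:R :> rat by rewrite ltr0n.
have E0 : (0 < E)%N by rewrite /E muln_gt0 expn_gt0 n0.
have E0' : 0 < E%:R :> rat by rewrite ltr0n.
have TE : T%:R = n%:R * N%:R :> rat by rewrite /T natrM.
have NE : N%:R = n%:R ^+ 5 * Q%:R ^+ 2 :> rat by rewrite /N natrM !natrX.
have EE : E%:R = n%:R ^+ 3 * Q%:R :> rat by rewrite /E natrM natrX.
clearbody T; clearbody E; clearbody N.
pose G t u : rat := t%:R - n%:R * (cnt t u)%:R.
pose g t u : rat := 1 - n%:R * (S t u)%:R.
have GS t u : G t.+1 u = G t u + g t u.
  by rewrite /G /g cntS natrD -natr1; ring.
have tele u m : 2 * \sum_(t < m) G t u * g t u = G m u ^+ 2 - \sum_(t < m) g t u ^+ 2.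
  elim: m => [|m IH].
    by rewrite !big_ord0 /G /cnt big_ord0 !mulr0 !subr0 expr0n.
  by rewrite !big_ord_recr /= mulrDr IH GS; ring.
have gn t u : g t u ^+ 2 <= n%:R ^+ 2.
  have n1 : 1 <= n%:R :> rat by rewrite ler1n.
  by rewrite /g; case: (S t u); rewrite ?mulr1 ?mulr0; nra.
have rounds : n%:R * \sum_(t < T) (cost2 (S t))%:R +
    (\sum_(u < n) G T u ^+ 2) / (2 * E%:R) <= T%:R * opt + T%:R * n%:R ^+ 3 / (2 * E%:R).
  have h1 : \sum_(t < T) n%:R * vpcost n a (price E t) (S t) <=
      \sum_(t < T) (opt - \sum_(u < n) price E t u).
    by apply: ler_sum => t _; apply: H.
  have e1 : \sum_(t < T) n%:R * vpcost n a (price E t) (S t) +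
      \sum_(t < T) \sum_(u < n) price E t u =
     n%:R * \sum_(t < T) (cost2 (S t))%:R + (\sum_(u < n) \sum_(t < T) G t u * g t u) / E%:R.
    rewrite [\sum_(u < n) _]exchange_big /= mulr_suml mulr_sumr -!big_split /=.
    apply: eq_bigr => t _; rewrite /vpcost.
    have -> : (\sum_(u < n) G t u * g t u) / E%:R =
       \sum_(u < n) price E t u - n%:R * \sum_(u < n) (S t u)%:R * price E t u.
      rewrite mulr_sumr mulr_suml -sumrB; apply: eq_bigr => u _.
      by rewrite /price -/(G t u) /g; ring.
    by ring.
  have e2 : \sum_(u < n) \sum_(t < T) G t u * g t u =
     (\sum_(u < n) G T u ^+ 2 - \sum_(u < n) \sum_(t < T) g t u ^+ 2) / 2.
    rewrite -sumrB mulr_suml; apply: eq_bigr => u _; rewrite -tele.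
    by field.
  have h2 : \sum_(u < n) \sum_(t < T) g t u ^+ 2 <= T%:R * n%:R ^+ 3.
    have -> : T%:R * n%:R ^+ 3 = \sum_(u < n) \sum_(t < T) n%:R ^+ 2 :> rat.
      by rewrite !sumr_const !card_ord -mulrnA -[RHS]mulr_natr natrM; ring.
    by apply: ler_sum => u _; apply: ler_sum.
  rewrite sumrB sumr_const card_ord -[opt *+ T]mulr_natl in h1.
  have h3 : (\sum_(u < n) \sum_(t < T) g t u ^+ 2) / (2 * E%:R) <= T%:R * n%:R ^+ 3 / (2 * E%:R).
    by rewrite ler_wpM2r // invr_ge0 mulr_ge0 // ltW.
  have e3 : (\sum_(u < n) \sum_(t < T) G t u * g t u) / E%:R =
     (\sum_(u < n) G T u ^+ 2) / (2 * E%:R) -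
     (\sum_(u < n) \sum_(t < T) g t u ^+ 2) / (2 * E%:R).
    by rewrite e2; field; rewrite gt_eqF.
  lra.
(* Each unit of surplus removes a vertex from a set, and each unit of deficit adds a singleton; both
   are charged [n]. Because [T = n N], the imbalance of [u] times [n] is [|G T u|]. *)
have repair : n%:R * (\sum_(t < T) cost2 (trunc N t) + n * \sum_(u < n) (N - cnt T u))%:R <=
   n%:R * \sum_(t < T) (cost2 (S t))%:R + \sum_(u < n) n%:R * `|G T u|.
  have h : (\sum_(t < T) cost2 (trunc N t) <= \sum_(t < T) cost2 (S t) +
      n * \sum_(u < n) (cnt T u - N))%N.
    have -> : (\sum_(u < n) (cnt T u - N) = \sum_(t < T) \sum_(u < n) (S t u && ~~ trunc N t u))%N.
      rewrite exchange_big /=; apply: eq_bigr => u _.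
      have : (\sum_(t < T) (S t u && ~~ trunc N t u) + \sum_(t < T) trunc N t u = cnt T u)%N.
        rewrite -big_split /=; apply: eq_bigr => t _.
        by rewrite /trunc; case: (S t u); case: (_ < _)%N.
      by rewrite trunc_count; move: (\sum_(t < T) (S t u && ~~ trunc N t u))%N => z; lia.
    rewrite big_distrr /= -big_split /=; apply: leq_sum => t _.
    by apply: cost2_sub => u _ /andP[].
  have h' : (\sum_(t < T) cost2 (trunc N t) + n * \sum_(u < n) (N - cnt T u) <=
     \sum_(t < T) cost2 (S t) + n * \sum_(u < n) (cnt T u - N + (N - cnt T u)))%N.
    by rewrite big_split /= mulnDr addnA leq_add2r.
  have e : \sum_(u < n) n%:R * `|G T u| =
      n%:R * (n * \sum_(u < n) (cnt T u - N + (N - cnt T u)))%:R.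
    rewrite natrM natr_sum !mulr_sumr; apply: eq_bigr => u _.
    have -> : G T u = n%:R * (N%:R - (cnt T u)%:R) by rewrite /G TE; ring.
    rewrite normrM (ger0_norm (ltW n0')); congr (_ * (_ * _)).
    case: (leqP N (cnt T u)) => c.
      have -> : (N - cnt T u = 0)%N by lia.
      by rewrite addn0 distrC ger0_norm ?natrB // subr_ge0 ler_nat.
    have -> : (cnt T u - N = 0)%N by lia.
    by rewrite add0n ger0_norm ?natrB ?(ltnW c) // subr_ge0 ler_nat ltnW.
  rewrite e -mulrDr ler_wpM2l ?(ltW n0') // -natr_sum -natrD ler_nat //.
have amgm : \sum_(u < n) n%:R * `|G T u| <=
    (\sum_(u < n) G T u ^+ 2) / (2 * E%:R) + E%:R * n%:R ^+ 3 / 2.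
  have -> : E%:R * n%:R ^+ 3 / 2 = \sum_(u < n) E%:R * n%:R ^+ 2 / 2 :> rat.
    by rewrite sumr_const card_ord -[RHS]mulr_natr; ring.
  rewrite mulr_suml -big_split /=; apply: ler_sum => u _.
  rewrite -(real_normK (num_real (G T u))); set z := `|G T u|.
  have h : 0 <= (z - E%:R * n%:R) ^+ 2 / (2 * E%:R).
    by rewrite divr_ge0 ?sqr_ge0 // mulr_ge0 // ltW.
  have e : (z - E%:R * n%:R) ^+ 2 / (2 * E%:R) =
     z ^+ 2 / (2 * E%:R) + E%:R * n%:R ^+ 2 / 2 - n%:R * z.
    by field; rewrite gt_eqF.
  by rewrite e in h; lra.
(* The origin of [N] and [E]: with [E = n ^ 3 Q] the two error terms are equal, and
   [N = n ^ 5 Q ^ 2] makes their sum [n N / Q]. *)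
have fin : T%:R * n%:R ^+ 3 / (2 * E%:R) + E%:R * n%:R ^+ 3 / 2 = n%:R * (N%:R / Q%:R) :> rat.
  rewrite TE NE EE; field.
  by rewrite !gt_eqF.
rewrite -(ler_pM2l n0').
have -> : n%:R * (N%:R * (opt + Q%:R^-1)) = T%:R * opt + n%:R * (N%:R / Q%:R).
  by rewrite TE; ring.
lra.
Qed.
End Regret.

(** * Programs with bound variables *)

(* Expressions with fresh bound names: a [bexpr] is given the least register
   index not in use.  A world is such an index with a register valuation. *)
Definition bexpr := nat -> expr.
Definition bcom := nat -> com.
Definition world := (nat * (nat -> nat))%type.
Definition ext (w w' : world) := w.1 <= w'.1 /\ forall x, x < w.1 -> w'.2 x = w.2 x.

Lemma ext_refl w : ext w w. Proof. by []. Qed.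
Lemma ext_trans w1 w2 w3 : ext w1 w2 -> ext w2 w3 -> ext w1 w3.
Proof.
move=> [l1 h1] [l2 h2]; split; first exact: leq_trans l2.
by move=> x lt; rewrite h2 ?h1 //; apply: leq_trans lt l1.
Qed.

(** The value must persist in all extensions of the world, as in a Kripke model; this is what
    permits the use of [b] below further binders. *)
Definition den (A : arr -> nat -> bool) (w : world) (b : bexpr) (v : nat) : Prop :=
  forall w', ext w w' -> eval A w'.2 (b w'.1) = v.

Definition denF A w m (f : bexpr -> bexpr) (F : nat -> nat) : Prop :=
  forall w' y i, ext w w' -> i < m -> den A w' y i -> den A w' (f y) (F i).
Definition denP A w m (f : bexpr -> bexpr) (F : nat -> bool) : Prop :=
  forall w' y i, ext w w' -> i < m -> den A w' y i -> den A w' (f y) (F i).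

Lemma den_mono A w w' b v : ext w w' -> den A w b v -> den A w' b v.
Proof. by move=> X H w2 X2; apply/H/(ext_trans X X2). Qed.
Lemma denF_mono A w w' m f F : ext w w' -> denF A w m f F -> denF A w' m f F.
Proof. by move=> X H w2 y i X2; apply: H; apply: ext_trans X2. Qed.
Lemma denP_mono A w w' m f F : ext w w' -> denP A w m f F -> denP A w' m f F.
Proof. by move=> X H w2 y i X2; apply: H; apply: ext_trans X2. Qed.

Definition BC c : bexpr := fun _ => EC c.
Definition BV x : bexpr := fun _ => EV x.
Definition BA a (e : bexpr) : bexpr := fun L => EA a (e L).
Definition BAdd (x y : bexpr) : bexpr := fun L => EOp false (x L) (y L).
Definition BSub (x y : bexpr) : bexpr := fun L => EOp true (x L) (y L).
Definition BSum (e : bexpr) (f : bexpr -> bexpr) : bexpr :=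
  fun L => ESum L (e L) (f (BV L) L.+1).
Definition BMul (x y : bexpr) : bexpr := BSum x (fun _ => y).
Definition BNot x := BSub (BC 1) x.
Definition BLe x y := BNot (BSub x y).
Definition BLt x y := BLe (BAdd x (BC 1)) y.
Definition BAnd x y := BMul x y.
Definition BOr x y := BNot (BAnd (BNot x) (BNot y)).
Definition BEq x y := BAnd (BLe x y) (BLe y x).
Definition BNe x y := BNot (BEq x y).
Definition BPos x := BLt (BC 0) x.
Definition BEx e f := BPos (BSum e f).
Definition BAll e f := BNot (BEx e (fun y => BNot (f y))).

Definition sumf (m : nat) (F : nat -> nat) := \sum_(i < m) F i.

Section Rules.
Variables (A : arr -> nat -> bool) (w : world).
Notation den := (den A w).

Lemma den_c c : den (BC c) c. Proof. by []. Qed.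
Lemma den_v x : x < w.1 -> den (BV x) (w.2 x).
Proof. by move=> lt w' [_ h]; rewrite /= h. Qed.
Lemma den_a a x u : den x u -> den (BA a x) (A a u).
Proof. by move=> H w' X; rewrite /= H. Qed.
Lemma den_add x y u v : den x u -> den y v -> den (BAdd x y) (u + v).
Proof. by move=> H K w' X; rewrite /= H ?K. Qed.
Lemma den_sub x y u v : den x u -> den y v -> den (BSub x y) (u - v).
Proof. by move=> H K w' X; rewrite /= H ?K. Qed.
Lemma den_sum e f m F : den e m -> denF A w m f F ->
  den (BSum e f) (sumf m F).
Proof.
move=> H K w' X; rewrite /sumf /= H //; apply: eq_bigr => i _.
pose w2 : world := (w'.1.+1, upd w'.2 w'.1 (i : nat)).
have X1 : ext w' w2.
  by split=> //= x lt; rewrite /upd ltn_eqF.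
have X2 : ext w w2 by apply: ext_trans X1.
apply: (K w2 (BV w'.1) i X2 (ltn_ord i) _ w2 (ext_refl _)).
by move=> w3 [l3 h3]; rewrite /= h3 /= /upd ?eqxx.
Qed.
Lemma den_mul x y u v : den x u -> den y v -> den (BMul x y) (u * v).
Proof.
move=> H K; have K' : denF A w u (fun _ => y) (fun=> v).
  by move=> w' z i X _ _; apply: den_mono K.
by move=> w' X; rewrite (den_sum H K' X) /sumf sum_nat_const card_ord.
Qed.
Lemma den_eq x u v : den x u -> u = v -> den x v. Proof. by move=> H <-. Qed.
Lemma den_not x (p : bool) : den x p -> den (BNot x) (~~ p).
Proof. by move=> H; apply: den_eq (den_sub (den_c 1) H) _; case: p {H}. Qed.
Lemma den_le x y u v : den x u -> den y v -> den (BLe x y) (u <= v).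
Proof.
move=> H K; apply: den_eq (den_sub (den_c 1) (den_sub H K)) _.
by rewrite -subn_eq0; case: (u - v).
Qed.
Lemma den_lt x y u v : den x u -> den y v -> den (BLt x y) (u < v).
Proof. by move=> H K; have := den_le (den_add H (den_c 1)) K; rewrite addn1. Qed.
Lemma den_and x y (p q : bool) : den x p -> den y q -> den (BAnd x y) (p && q).
Proof. by move=> H K; apply: den_eq (den_mul H K) _; case: p {H}; case: q {K}. Qed.
Lemma den_or x y (p q : bool) : den x p -> den y q -> den (BOr x y) (p || q).
Proof.
move=> H K; apply: den_eq (den_not (den_and (den_not H) (den_not K))) _.
by rewrite negb_and !negbK.
Qed.
Lemma den_eqn x y u v : den x u -> den y v -> den (BEq x y) (u == v).
Proof. by move=> H K; rewrite eqn_leq; apply: den_and; apply: den_le. Qed.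
Lemma den_eqb x y (u v : bool) : den x u -> den y v -> den (BEq x y) (u == v).
Proof. by move=> H K; apply: den_eq (den_eqn H K) _; case: u {H}; case: v {K}. Qed.
Lemma den_neb x y (u v : bool) : den x u -> den y v -> den (BNe x y) (u != v).
Proof. by move=> H K; apply: den_not; apply: den_eqb. Qed.
Lemma den_pos x u : den x u -> den (BPos x) (0 < u).
Proof. exact: den_lt (den_c 0). Qed.

Lemma den_ex e f m F : den e m -> denP A w m f F -> den (BEx e f) (has F (iota 0 m)).
Proof.
move=> H K; apply: den_eq (den_pos (den_sum H (K : denF A w m f F))) _; congr nat_of_bool.
rewrite lt0n /sumf sum_nat_eq0; apply/idP/idP.
  move/forallPn=> [i]; rewrite eqb0 negbK => Fi; apply/hasP; exists (i : nat) => //.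
  by rewrite mem_iota /=.
case/hasP=> i; rewrite mem_iota /= => lt Fi; apply/forallPn; exists (Ordinal lt).
by rewrite eqb0 negbK.
Qed.
End Rules.

Lemma den_all A w e f m F : den A w e m -> denP A w m f F ->
  den A w (BAll e f) (all F (iota 0 m)).
Proof.
move=> H K; have K' : denP A w m (fun y => BNot (f y)) (fun i => ~~ F i).
  by move=> w' y i X lt Hy; apply: den_not; apply: K Hy.
by apply: den_eq (den_not (den_ex H K')) _; rewrite has_predC negbK.
Qed.

Ltac weaken_base X := idtac.
Ltac weaken X :=
  weaken_base X;
  match type of X with ext ?w ?w' =>
    repeat match goal with
    | H : den _ w _ _ |- _ => apply (den_mono X) in H
    | H : denF _ w _ _ _ |- _ => apply (denF_mono X) in H
    | H : denP _ w _ _ _ |- _ => apply (denP_mono X) in H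
    end
  end.

Ltac dn_ext := fail.
Ltac dn_base := fail.
Ltac dn1 :=
  first
  [ eassumption
  | dn_base
  | match goal with
    | H : denP _ ?w _ ?f _ |- den _ ?w (?f _) _ => eapply H; [exact: ext_refl | eassumption | ]
    | H : denF _ ?w _ ?f _ |- den _ ?w (?f _) _ => eapply H; [exact: ext_refl | eassumption | ]
    end
  | dn_ext
  | lazymatch goal with
    | |- den _ _ (BC _) _ => apply: den_c
    | |- den _ _ (BA _ _) _ => apply: den_a
    | |- den _ _ (BAdd _ _) _ => apply: den_add
    | |- den _ _ (BSub _ _) _ => apply: den_sub
    | |- den _ _ (BMul _ _) _ => apply: den_mul
    | |- den _ _ (BSum _ _) _ => apply: den_sum
    | |- den _ _ (BNot _) _ => apply: den_not
    | |- den _ _ (BLe _ _) _ => apply: den_le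
    | |- den _ _ (BLt _ _) _ => apply: den_lt
    | |- den _ _ (BAnd _ _) _ => apply: den_and
    | |- den _ _ (BOr _ _) _ => apply: den_or
    | |- den _ _ (BEq _ _) (nat_of_bool (@eq_op bool _ _)) => apply: den_eqb
    | |- den _ _ (BEq _ _) _ => apply: den_eqn
    | |- den _ _ (BNe _ _) _ => apply: den_neb
    | |- den _ _ (BPos _) _ => apply: den_pos
    | |- den _ _ (BEx _ _) _ => apply: den_ex
    | |- den _ _ (BAll _ _) _ => apply: den_all
    | |- denP _ _ _ _ _ =>
        let w' := fresh "w" in let y := fresh "y" in let i := fresh "i" in
        let X := fresh "X" in let lt := fresh "lt" in let Hy := fresh "Hy" in
        intros w' y i X lt Hy; weaken X
    | |- denF _ _ _ _ _ =>
        let w' := fresh "w" in let y := fresh "y" in let i := fresh "i" in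
        let X := fresh "X" in let lt := fresh "lt" in let Hy := fresh "Hy" in
        intros w' y i X lt Hy; weaken X
    end ].
Ltac dn := repeat dn1.

(** Division as a count of multiples, since the language has no division. For [m = 0] the value is
    [x]. *)
Definition bdiv (x m : nat) := sumf x (fun i => (i + 1) * m <= x).
Definition bmod (x m : nat) := x - m * bdiv x m.

Lemma bdivE x m : 0 < m -> bdiv x m = x %/ m.
Proof.
move=> m0; rewrite /bdiv /sumf; under eq_bigr => i _ do rewrite addn1 -leq_divRL //.
have le : x %/ m <= x by apply: leq_div.
rewrite -(big_mkord xpredT (fun i => (i < x %/ m) : nat)) (big_cat_nat (leq0n _) le) /=.
rewrite (eq_big_nat _ _ (F2 := fun=> 1)); last by move=> i /andP[_ ->].
rewrite sum_nat_const_nat subn0 muln1 big_nat big1 ?addn0 // => i /andP[h _].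
by rewrite ltnNge h.
Qed.

Lemma bmodE x m : 0 < m -> bmod x m = x %% m.
Proof. by move=> m0; rewrite /bmod bdivE // {1}(divn_eq x m) mulnC addKn. Qed.

Definition BDiv x m := BSum x (fun i => BLe (BMul (BAdd i (BC 1)) m) x).
Definition BMod x m := BSub x (BMul m (BDiv x m)).

Lemma den_div A w x m u v : den A w x u -> den A w m v -> den A w (BDiv x m) (bdiv u v).
Proof.
by move=> Hx Hm; rewrite /BDiv /bdiv; dn.
Qed.

Lemma den_mod A w x m u v : den A w x u -> den A w m v -> den A w (BMod x m) (bmod u v).
Proof. by move=> Hx Hm; apply: den_sub => //; apply: den_mul => //; apply: den_div. Qed.

(* [n] vertices, digit base [b], [G] candidate codes, [K] chunks, [R] roots,
   prices in multiples of [1 / E], [N] copies of each vertex, [k] samples. *)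
Record params := Params {
  gn : nat; gb : nat; gG : nat; gK : nat; gR : nat; gE : nat; gN : nat; gk : nat }.

(** * The algorithm in natural-number arithmetic *)

Section Formulas.
Variables (inp pw : nat -> bool) (g : params).
Notation n := (gn g).
Notation b := (gb g).
Notation G := (gG g).
Notation K := (gK g).
Notation R := (gR g).
Notation E := (gE g).
Notation N := (gN g).
Notation k := (gk g).

(* The matrix follows the unary [n] and its terminator in [inp]. *)
Definition adjacent (u v : nat) : bool := (u == v) || inp (n + 1 + u * n + v).

(* [pw] marks the powers of [b]; this is the [j]-th base-[b] digit of [c]. *)
Definition dig (c j : nat) : nat := sumf (G + 1) (fun x =>
  (pw x && (sumf x (fun y => pw y) == j)) * bmod (bdiv c x) b).

Definition fT c v : bool := 0 < sumf R (fun j => adjacent v (dig c (j + 2))).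
Definition fK c v : bool :=
  (dig c 0 == 1) && (4 * vdist n (adjacent v) (fT c) <= vcard n (fT c)) ||
  (1 < dig c 0) && (v == dig c 1).
Definition fD c v : bool :=
  (dig c 0 == 0) && fT c v ||
  (dig c 0 == 1) && (~~ fK c v && (vcard n (fT c) <= 3 * vinter n (adjacent v) (fT c))).
Definition frank c v := sumf n (fun w => (w < v) && fD c w).
Definition fbase c v := 2 + R + bmod (frank c v) K * (k + 1).
Definition fhits c v := sumf k (fun j => adjacent v (dig c (fbase c v + (j + 1)))).
(** The condition [est < 0] multiplied by [E k], with the negative terms moved to the right so that
    no truncated subtraction occurs. Here [m v] counts how often [v] has been covered. *)
Definition fdec t (m : nat -> nat) c v : bool :=
  E * k * vcard n (adjacent v) + 2 * k * E * vcard n (fK c) +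
  2 * dig c (fbase c v) * k * E + k * n * m v <
  k * t + 4 * k * E * vinter n (adjacent v) (fK c) + 4 * E * fhits c v * dig c (fbase c v).
Definition fS t m c v : bool := fK c v || fD c v && fdec t m c v.
(** [E] times the price-adjusted cost of the candidate, shifted by [n t] to be a natural number; the
    shift does not affect the minimiser. *)
Definition fval t m c := sumf n (fun u => fS t m c u *
   (E * vdist n (adjacent u) (fS t m c) + n * m u)) + (n * t - vcard n (fS t m c) * t).
Definition fmin t m c : bool := all (fun c' => fval t m c <= fval t m c') (iota 0 G).
(** Ties are broken by the least index, so that the separate answers for all [u] describe one and
    the same cluster. *)
Definition fsel t m u : bool := has (fun c =>
  fmin t m c && (~~ has (fmin t m) (iota 0 c) && fS t m c u)) (iota 0 G).
(* A transitive instance has optimum 0, which a multiplicative guarantee requires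
   to be found exactly; [frow] lists its classes. *)
Definition ftransb : bool := all (fun u => all (fun v => all (fun w =>
  ~~ (adjacent u v && (adjacent v w && ~~ adjacent u w))) (iota 0 n)) (iota 0 n)) (iota 0 n).
Definition frow r u : bool := adjacent r u && all (fun r' => ~~ adjacent r r') (iota 0 r).
Definition fH r t m u : bool := ftransb && frow r u || ~~ ftransb && fsel t m u.

Definition pn := BV 0.
Definition pb := BV 1.
Definition pG := BV 2.
Definition pK := BV 3.
Definition pR := BV 4.
Definition pE := BV 5.
Definition pN := BV 6.
Definition pk := BV 7.

Definition base (A : arr -> nat -> bool) (w : world) : Prop :=
  [/\ 8 <= w.1, A AIn = inp, A APow = pw &
      [seq w.2 i | i <- iota 0 8] = [:: n; b; G; K; R; E; N; k]].

Lemma base_mono A w w' : ext w w' -> base A w -> base A w'.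
Proof.
move=> [l h] [l8 h1 h2 h3]; split=> //; first exact: leq_trans l.
rewrite -h3; apply/eq_in_map => i; rewrite mem_iota => /andP[_ lt].
by rewrite h //; apply: leq_trans l8.
Qed.

Lemma den_par A w x : base A w -> x < 8 ->
  den A w (BV x) (nth 0 [:: n; b; G; K; R; E; N; k] x).
Proof.
move=> [l8 _ _ h3] lt; rewrite -h3 (nth_map 0) ?size_iota // nth_iota //.
by apply: den_v; apply: leq_trans l8.
Qed.

Lemma den_pn A w : base A w -> den A w pn n. Proof. by move=> /den_par/(_ (isT : 0 < 8)). Qed.
Lemma den_pb A w : base A w -> den A w pb b. Proof. by move=> /den_par/(_ (isT : 1 < 8)). Qed.
Lemma den_pG A w : base A w -> den A w pG G. Proof. by move=> /den_par/(_ (isT : 2 < 8)). Qed.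
Lemma den_pK A w : base A w -> den A w pK K. Proof. by move=> /den_par/(_ (isT : 3 < 8)). Qed.
Lemma den_pR A w : base A w -> den A w pR R. Proof. by move=> /den_par/(_ (isT : 4 < 8)). Qed.
Lemma den_pE A w : base A w -> den A w pE E. Proof. by move=> /den_par/(_ (isT : 5 < 8)). Qed.
Lemma den_pN A w : base A w -> den A w pN N. Proof. by move=> /den_par/(_ (isT : 6 < 8)). Qed.
Lemma den_pk A w : base A w -> den A w pk k. Proof. by move=> /den_par/(_ (isT : 7 < 8)). Qed.

Lemma den_in A w x u : base A w -> den A w x u -> den A w (BA AIn x) (inp u).
Proof. by move=> [_ <- _ _]; apply: den_a. Qed.
Lemma den_pw A w x u : base A w -> den A w x u -> den A w (BA APow x) (pw u).
Proof. by move=> [_ _ <- _]; apply: den_a. Qed.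
End Formulas.

Ltac weaken_base X ::=
  repeat match goal with
  | H : base _ _ _ _ _ |- _ => apply (base_mono X) in H
  end.
Ltac dn_base ::=
  lazymatch goal with
  | |- den _ _ pn _ => eapply den_pn; eassumption
  | |- den _ _ pb _ => eapply den_pb; eassumption
  | |- den _ _ pG _ => eapply den_pG; eassumption
  | |- den _ _ pK _ => eapply den_pK; eassumption
  | |- den _ _ pR _ => eapply den_pR; eassumption
  | |- den _ _ pE _ => eapply den_pE; eassumption
  | |- den _ _ pN _ => eapply den_pN; eassumption
  | |- den _ _ pk _ => eapply den_pk; eassumption
  | |- den _ _ (BA AIn _) _ => eapply den_in; [eassumption | ]
  | |- den _ _ (BA APow _) _ => eapply den_pw; [eassumption | ]
  | |- den _ _ (BDiv _ _) _ => apply: den_div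
  | |- den _ _ (BMod _ _) _ => apply: den_mod
  end.

Definition mAdj u v :=
  BOr (BEq u v) (BA AIn (BAdd (BAdd (BAdd pn (BC 1)) (BMul u pn)) v)).
Definition mDig c j := BSum (BAdd pG (BC 1)) (fun x =>
  BMul (BAnd (BA APow x) (BEq (BSum x (fun y => BA APow y)) j)) (BMod (BDiv c x) pb)).
Definition mCard f := BSum pn f.
Definition mInter f h := BSum pn (fun v => BAnd (f v) (h v)).
Definition mDist f h := BSum pn (fun v => BNe (f v) (h v)).
Definition mT c v := BPos (BSum pR (fun j => mAdj v (mDig c (BAdd j (BC 2))))).
Definition mK c v :=
  BOr (BAnd (BEq (mDig c (BC 0)) (BC 1))
            (BLe (BMul (BC 4) (mDist (mAdj v) (mT c))) (mCard (mT c))))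
      (BAnd (BLt (BC 1) (mDig c (BC 0))) (BEq v (mDig c (BC 1)))).
Definition mD c v :=
  BOr (BAnd (BEq (mDig c (BC 0)) (BC 0)) (mT c v))
      (BAnd (BEq (mDig c (BC 0)) (BC 1)) (BAnd (BNot (mK c v))
         (BLe (mCard (mT c)) (BMul (BC 3) (mInter (mAdj v) (mT c)))))).
Definition mRank c v := BSum pn (fun w => BAnd (BLt w v) (mD c w)).
Definition mBase c v :=
  BAdd (BAdd (BC 2) pR) (BMul (BMod (mRank c v) pK) (BAdd pk (BC 1))).
Definition mHits c v :=
  BSum pk (fun j => mAdj v (mDig c (BAdd (mBase c v) (BAdd j (BC 1))))).
Definition mDec t (m : bexpr -> bexpr) c v :=
  BLt (BAdd (BAdd (BAdd (BMul (BMul pE pk) (mCard (mAdj v)))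
         (BMul (BMul (BMul (BC 2) pk) pE) (mCard (mK c))))
         (BMul (BMul (BMul (BC 2) (mDig c (mBase c v))) pk) pE))
         (BMul (BMul pk pn) (m v)))
      (BAdd (BAdd (BMul pk t) (BMul (BMul (BMul (BC 4) pk) pE) (mInter (mAdj v) (mK c))))
         (BMul (BMul (BMul (BC 4) pE) (mHits c v)) (mDig c (mBase c v)))).
Definition mS t m c v := BOr (mK c v) (BAnd (mD c v) (mDec t m c v)).
Definition mVal t m c := BAdd (BSum pn (fun u => BMul (mS t m c u)
    (BAdd (BMul pE (mDist (mAdj u) (mS t m c))) (BMul pn (m u)))))
  (BSub (BMul pn t) (BMul (mCard (mS t m c)) t)).
Definition mMin t m c := BAll pG (fun c' => BLe (mVal t m c) (mVal t m c')).
Definition mSel t m u := BEx pG (fun c =>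
  BAnd (mMin t m c) (BAnd (BNot (BEx c (mMin t m))) (mS t m c u))).
Definition mTrans := BAll pn (fun u => BAll pn (fun v => BAll pn (fun w =>
  BNot (BAnd (mAdj u v) (BAnd (mAdj v w) (BNot (mAdj u w))))))).
Definition mRow r u := BAnd (mAdj r u) (BAll r (fun r' => BNot (mAdj r r'))).
Definition mH r t m u := BOr (BAnd mTrans (mRow r u)) (BAnd (BNot mTrans) (mSel t m u)).

Section Denotations.
Variables (inp pw : nat -> bool) (g : params) (A : arr -> nat -> bool).
Notation base := (base inp pw g A).
Notation n := (gn g).

Lemma den_adj w u v u' v' : base w -> den A w u u' -> den A w v v' ->
  den A w (mAdj u v) (adjacent inp g u' v').
Proof. by move=> B *; rewrite /mAdj /adjacent; dn. Qed.

Lemma den_dig w c j c' j' : base w -> den A w c c' -> den A w j j' ->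
  den A w (mDig c j) (dig pw g c' j').
Proof. by move=> B *; rewrite /mDig /dig; dn. Qed.

Lemma den_card w f F : base w -> denP A w n f F -> den A w (mCard f) (vcard n F).
Proof. by move=> B H; apply: (den_sum (F := fun i => F i)) => //; dn. Qed.

Lemma den_inter w f F h H : base w -> denP A w n f F -> denP A w n h H ->
  den A w (mInter f h) (vinter n F H).
Proof. by move=> B *; apply: (den_sum (F := fun i => F i && H i)); dn. Qed.

Lemma den_dist w f F h H : base w -> denP A w n f F -> denP A w n h H ->
  den A w (mDist f h) (vdist n F H).
Proof. by move=> B *; apply: (den_sum (F := fun i => F i != H i)); dn. Qed.

Ltac dn_vertex :=
  lazymatch goal with
  | |- den _ _ (mAdj _ _) _ => eapply den_adj; [eassumption | | ]
  | |- den _ _ (mDig _ _) _ => eapply den_dig; [eassumption | | ]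
  | |- den _ _ (mCard _) _ => eapply den_card; [eassumption | ]
  | |- den _ _ (mInter _ _) _ => eapply den_inter; [eassumption | | ]
  | |- den _ _ (mDist _ _) _ => eapply den_dist; [eassumption | | ]
  end.
Ltac dn_ext ::= dn_vertex.

Lemma den_T w c v c' v' : base w -> den A w c c' -> den A w v v' ->
  den A w (mT c v) (fT inp pw g c' v').
Proof. by move=> B *; rewrite /mT /fT; dn. Qed.

Ltac dn_T :=
  lazymatch goal with
  | |- den _ _ (mT _ _) _ => eapply den_T; [eassumption | | ]
  | _ => dn_vertex
  end.
Ltac dn_ext ::= dn_T.

Lemma den_K w c v c' v' : base w -> den A w c c' -> den A w v v' ->
  den A w (mK c v) (fK inp pw g c' v').
Proof. by move=> B *; rewrite /mK /fK; dn. Qed.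

Ltac dn_K :=
  lazymatch goal with
  | |- den _ _ (mK _ _) _ => eapply den_K; [eassumption | | ]
  | _ => dn_T
  end.
Ltac dn_ext ::= dn_K.

Lemma den_D w c v c' v' : base w -> den A w c c' -> den A w v v' ->
  den A w (mD c v) (fD inp pw g c' v').
Proof. by move=> B *; rewrite /mD /fD; dn. Qed.

Ltac dn_D :=
  lazymatch goal with
  | |- den _ _ (mD _ _) _ => eapply den_D; [eassumption | | ]
  | _ => dn_K
  end.
Ltac dn_ext ::= dn_D.

Lemma den_base w c v c' v' : base w -> den A w c c' -> den A w v v' ->
  den A w (mBase c v) (fbase inp pw g c' v').
Proof. by move=> B *; rewrite /mBase /fbase /mRank /frank; dn. Qed.

Ltac dn_offset :=
  lazymatch goal with
  | |- den _ _ (mBase _ _) _ => eapply den_base; [eassumption | | ]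
  | _ => dn_D
  end.
Ltac dn_ext ::= dn_offset.

Lemma den_hits w c v c' v' : base w -> den A w c c' -> den A w v v' ->
  den A w (mHits c v) (fhits inp pw g c' v').
Proof. by move=> B *; rewrite /mHits /fhits; dn. Qed.

Ltac dn_hits :=
  lazymatch goal with
  | |- den _ _ (mHits _ _) _ => eapply den_hits; [eassumption | | ]
  | _ => dn_offset
  end.
Ltac dn_ext ::= dn_hits.

Lemma den_S w t m c v t' m' c' v' : base w -> den A w t t' -> denF A w n m m' ->
  den A w c c' -> den A w v v' -> v' < n -> den A w (mS t m c v) (fS inp pw g t' m' c' v').
Proof. by move=> B *; rewrite /mS /fS /mDec /fdec; dn. Qed.

Ltac dn_S :=
  lazymatch goal with
  | |- den _ _ (mS _ _ _ _) _ => eapply den_S; [eassumption | | | | | eassumption]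
  | _ => dn_hits
  end.
Ltac dn_ext ::= dn_S.

Lemma den_val w t m c t' m' c' : base w -> den A w t t' -> denF A w n m m' ->
  den A w c c' -> den A w (mVal t m c) (fval inp pw g t' m' c').
Proof. by move=> B *; rewrite /mVal /fval; dn. Qed.

Ltac dn_val :=
  lazymatch goal with
  | |- den _ _ (mVal _ _ _) _ => eapply den_val; [eassumption | | | ]
  | _ => dn_S
  end.
Ltac dn_ext ::= dn_val.

Lemma den_min w t m c t' m' c' : base w -> den A w t t' -> denF A w n m m' ->
  den A w c c' -> den A w (mMin t m c) (fmin inp pw g t' m' c').
Proof. by move=> B *; rewrite /mMin /fmin; dn. Qed.

Ltac dn_min :=
  lazymatch goal with
  | |- den _ _ (mMin _ _ _) _ => eapply den_min; [eassumption | | | ]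
  | _ => dn_val
  end.
Ltac dn_ext ::= dn_min.

Lemma den_sel w t m u t' m' u' : base w -> den A w t t' -> denF A w n m m' ->
  den A w u u' -> u' < n -> den A w (mSel t m u) (fsel inp pw g t' m' u').
Proof. by move=> B *; rewrite /mSel /fsel; dn. Qed.

Ltac dn_sel :=
  lazymatch goal with
  | |- den _ _ (mSel _ _ _) _ => eapply den_sel; [eassumption | | | | eassumption]
  | _ => dn_min
  end.
Ltac dn_ext ::= dn_sel.

Lemma den_H w r t m u r' t' m' u' : base w -> den A w r r' -> den A w t t' ->
  denF A w n m m' -> den A w u u' -> u' < n ->
  den A w (mH r t m u) (fH inp pw g r' t' m' u').
Proof. by move=> B *; rewrite /mH /fH /mTrans /ftransb /mRow /frow; dn. Qed.
End Denotations.

(** * Commands, array filling and output *)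

Definition BSeq (c1 c2 : bcom) : bcom := fun L => CSeq (c1 L) (c2 L).
Definition BFor (e : bexpr) (f : bexpr -> bcom) : bcom :=
  fun L => CFor L (e L) (f (BV L) L.+1).
Definition BIf (e : bexpr) (c : bcom) : bcom := fun L => CFor L (e L) (c L.+1).
Definition BSet a (x y : bexpr) : bcom := fun L => CSet a (x L) (y L).
Definition BEmit (x : bexpr) : bcom := fun L => CEmit (x L).

Definition cden (w : world) (c : bcom) (s s' : store) : Prop :=
  forall w', ext w w' -> evalC w'.2 (c w'.1) s = s'.

Definition emits (A : arr -> nat -> bool) (w : world) (c : bcom) (l : seq bool) : Prop :=
  forall w' o, ext w w' -> evalC w'.2 (c w'.1) (A, o) = (A, o ++ l).

Lemma emits_cden A w c l o : emits A w c l -> cden w c (A, o) (A, o ++ l).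
Proof. by move=> H w' X; apply: H. Qed.

Lemma cden_seq w c1 c2 s s1 s2 : cden w c1 s s1 -> cden w c2 s1 s2 ->
  cden w (BSeq c1 c2) s s2.
Proof. by move=> H K w' X; rewrite /= H // K. Qed.

Lemma cden_for w e f m (st : nat -> store) : den (st 0).1 w e m ->
  (forall w' y i, ext w w' -> i < m -> (forall A, den A w' y i) ->
     cden w' (f y) (st i) (st i.+1)) ->
  cden w (BFor e f) (st 0) (st m).
Proof.
move=> H K w' X; rewrite /= H //.
have : forall i, i <= m -> iterC (fun i => evalC (upd w'.2 w'.1 i) (f (BV w'.1) w'.1.+1)) i
   (st 0) = st i.
  elim=> [|i IH] lt //; rewrite iterC_S IH ?(ltnW lt) //.
  pose w2 : world := (w'.1.+1, upd w'.2 w'.1 i).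
  have X1 : ext w' w2 by split=> //= x ltx; rewrite /upd ltn_eqF.
  apply: (K w2 (BV w'.1) i (ext_trans X X1) lt _ w2 (ext_refl _)) => A.
  by move=> w3 [l3 h3]; rewrite /= h3 //= /upd eqxx.
by move/(_ m (leqnn m)).
Qed.

Lemma emits_seq A w c1 c2 l1 l2 : emits A w c1 l1 -> emits A w c2 l2 ->
  emits A w (BSeq c1 c2) (l1 ++ l2).
Proof. by move=> H K w' o X; rewrite /= H // K // catA. Qed.

Lemma emits_emit A w x v : den A w x v -> emits A w (BEmit x) [:: v != 0].
Proof. by move=> H w' o X; rewrite /= H // cats1. Qed.

Lemma emits_bool A w x (v : bool) : den A w x v -> emits A w (BEmit x) [:: v].
Proof. by move/emits_emit; case: v. Qed.

Lemma emits_const A w (v : bool) : emits A w (BEmit (BC v)) [:: v].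
Proof. exact: emits_bool (den_c A v). Qed.

Lemma emits_for A w e f m (h : nat -> seq bool) : den A w e m ->
  (forall w' y i, ext w w' -> i < m -> den A w' y i -> emits A w' (f y) (h i)) ->
  emits A w (BFor e f) (flatten [seq h i | i <- iota 0 m]).
Proof.
move=> H K w' o X.
pose st i : store := (A, o ++ flatten [seq h i | i <- iota 0 i]).
have -> : (A, o) = st 0 by rewrite /st /= cats0.
apply: (@cden_for w e f m st) => // w2 y i X2 lt Hy w3 X3.
rewrite (K w2 y i X2 lt (Hy A)) // /st -addn1 iotaD map_cat flatten_cat /= cats0 -catA //.
Qed.

Lemma emits_if A w e c (p : bool) l : den A w e p -> (p -> emits A w c l) ->
  emits A w (BIf e c) (if p then l else [::]).
Proof.
move=> H K w' o X; rewrite /= H //; case: p H K => H K; last by rewrite cats0.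
rewrite /iterC /=; pose w2 : world := (w'.1.+1, upd w'.2 w'.1 0).
apply: (K isT w2) => //; case: X => l1 h1; split=> [|x lt] /=.
  exact: leq_trans l1 (leqnSn _).
by rewrite /upd ltn_eqF ?h1 //; apply: leq_trans l1.
Qed.

Lemma cden_set w a x y A o i (v : bool) : den A w x i -> den A w y v ->
  cden w (BSet a x y) (A, o) (updA A a i v, o).
Proof. by move=> H K w' X; rewrite /= H // K //; case: (v). Qed.

(** Arrays are written in increasing order of positions, so each intermediate store is the old one
    with a prefix replaced. *)
Definition fillA (A : arr -> nat -> bool) (a : arr) (H : nat -> bool) (q : nat) :=
  fun a' x => if (atrk a' == atrk a) && (x < q) then H x else A a' x.

Lemma fillA0 A a H : fillA A a H 0 = A.
Proof.
apply: functional_extensionality => a'; apply: functional_extensionality => x.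
by rewrite /fillA andbF.
Qed.

Lemma fillA_next A a H q : updA (fillA A a H q) a q (H q) = fillA A a H q.+1.
Proof.
apply: functional_extensionality => a'; apply: functional_extensionality => x.
rewrite /updA /fillA ltnS; case: (atrk a' == atrk a) => //=.
by case: ltngtP => // ->.
Qed.

Lemma fillA_other A a H q a' : atrk a' != atrk a -> fillA A a H q a' = A a'.
Proof. by move=> /negPf ne; apply: functional_extensionality => x; rewrite /fillA ne. Qed.

Lemma fillA_same A a H q x : x < q -> fillA A a H q a x = H x.
Proof. by move=> lt; rewrite /fillA eqxx lt. Qed.

Lemma cden_row w a e ix f A o n q (H : nat -> bool) : (forall A, den A w e n) ->
  (forall w' y i, ext w w' -> i < n -> (forall A, den A w' y i) ->
     let B := fillA A a H (q + i) in
     den B w' (ix y) (q + i) /\ den B w' (f y) (H (q + i))) ->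
  cden w (BFor e (fun y => BSet a (ix y) (f y)))
    (fillA A a H q, o) (fillA A a H (q + n), o).
Proof.
move=> He Hb; pose st i : store := (fillA A a H (q + i), o).
have -> : (fillA A a H q, o) = st 0 by rewrite /st addn0.
apply: (@cden_for w e _ n st); first exact: He.
move=> w' y i X lt Hy; have [h1 h2] := Hb w' y i X lt Hy.
rewrite /st addnS -fillA_next; exact: cden_set.
Qed.

Section Emission.
Variables (inp pw : nat -> bool) (g : params).
Notation base := (base inp pw g).
Notation n := (gn g).
Notation N := (gN g).

(** Powers of two are recognised by having no odd divisor above 1. *)
Definition fpow2 (x : nat) : bool := (0 < x) && all (fun d =>
  ~~ ((bmod x d == 0) && ((bmod d 2 == 1) && (1 < d)))) (iota 0 (x + 1)).
Definition mPow2 x := BAnd (BLt (BC 0) x) (BAll (BAdd x (BC 1)) (fun d =>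
  BNot (BAnd (BEq (BMod x d) (BC 0)) (BAnd (BEq (BMod d (BC 2)) (BC 1)) (BLt (BC 1) d))))).

Lemma den_pow2 A w x x' : den A w x x' -> den A w (mPow2 x) (fpow2 x').
Proof. by move=> *; rewrite /mPow2 /fpow2; dn. Qed.

(** The powers of two up to [m], in increasing order, play the part of the bit positions, so neither
    logarithms nor a change of variables is needed. *)
Definition nat_code (m : nat) : seq bool :=
  flatten [seq if fpow2 x then [:: true; bmod (bdiv m x) 2 == 1] else [::] | x <- iota 0 (m + 1)]
  ++ [:: false].
Definition mNat m := BSeq (BFor (BAdd m (BC 1)) (fun x => BIf (mPow2 x)
   (BSeq (BEmit (BC 1)) (BEmit (BEq (BMod (BDiv m x) (BC 2)) (BC 1)))))) (BEmit (BC 0)).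

Lemma emits_nat A w m m' : den A w m m' -> emits A w (mNat m) (nat_code m').
Proof.
move=> Hm; apply: emits_seq; last exact: (emits_const A false).
apply: emits_for; first by dn.
move=> w' y i X lt Hy; weaken X; apply: emits_if; first exact: den_pow2.
move=> _; rewrite -[[:: true; _]]/([:: true] ++ [:: _]); apply: emits_seq.
  exact: (emits_const A true).
by apply: emits_bool; dn.
Qed.

Definition fcd (c d x : nat) : bool := (0 < x) && ((bmod c x == 0) && (bmod d x == 0)).
Definition mCd c d x := BAnd (BLt (BC 0) x)
  (BAnd (BEq (BMod c x) (BC 0)) (BEq (BMod d x) (BC 0))).
Definition fgcd (c d x : nat) : bool :=
  fcd c d x && all (fun y => ~~ (fcd c d y && (x < y))) (iota 0 (d + 1)).
Definition mGcd c d x := BAnd (mCd c d x)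
  (BAll (BAdd d (BC 1)) (fun y => BNot (BAnd (mCd c d y) (BLt x y)))).

Lemma den_gcd A w c d x c' d' x' : den A w c c' -> den A w d d' -> den A w x x' ->
  den A w (mGcd c d x) (fgcd c' d' x').
Proof. by move=> *; rewrite /mGcd /mCd /fgcd /fcd; dn. Qed.

(** The loop fires only at the greatest common divisor, by which both parts are reduced. The two
    [false] are the sign bits of numerator and denominator. *)
Definition rat_code (c d : nat) : seq bool :=
  flatten [seq if fgcd c d x then [:: false] ++ (nat_code (bdiv c x) ++
     ([:: false] ++ nat_code (bdiv d x))) else [::] | x <- iota 0 (d + 1)].
Definition mRat c d := BFor (BAdd d (BC 1)) (fun x => BIf (mGcd c d x)
  (BSeq (BEmit (BC 0)) (BSeq (mNat (BDiv c x)) (BSeq (BEmit (BC 0)) (mNat (BDiv d x)))))).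

Lemma emits_rat A w c d c' d' : den A w c c' -> den A w d d' ->
  emits A w (mRat c d) (rat_code c' d').
Proof.
move=> Hc Hd; apply: emits_for; first by dn.
move=> w' y i X lt Hy; weaken X; apply: emits_if; first exact: den_gcd.
move=> _; apply: emits_seq; first exact: (emits_const A false).
apply: emits_seq; first by apply: emits_nat; dn.
apply: emits_seq; first exact: (emits_const A false).
by apply: emits_nat; dn.
Qed.

Variable F : nat -> nat -> bool.

Definition holds (A : arr -> nat -> bool) (rows : nat) :=
  forall t u, t < rows -> u < n -> A AFin (t * n + u) = F t u.

Definition mFin t u := BA AFin (BAdd (BMul t pn) u).

Lemma den_fin A w t u t' u' rows : base A w -> holds A rows -> den A w t t' -> den A w u u' ->
  t' < rows -> u' < n -> den A w (mFin t u) (F t' u').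
Proof. by move=> B H *; rewrite -H // /mFin; dn. Qed.

Definition feqrow t t' : bool := all (fun u => F t u == F t' u) (iota 0 n).
Definition fnonempty t : bool := has (F t) (iota 0 n).
(** Rows may repeat but listed coordinates may not: a set is emitted at its first row only, with its
    multiplicity. *)
Definition ffirst t : bool := fnonempty t && all (fun t' => ~~ feqrow t' t) (iota 0 t).
Definition fcount rows t := sumf rows (fun t' => feqrow t' t).
Definition fcov rows u v := sumf rows (fun t => F t u && F t v).

Definition mEqrow t t' := BAll pn (fun u => BEq (mFin t u) (mFin t' u)).
Definition mNonempty t := BEx pn (mFin t).
Definition mFirst t := BAnd (mNonempty t) (BAll t (fun t' => BNot (mEqrow t' t))).
Definition mCount rows t := BSum rows (fun t' => mEqrow t' t).
Definition mCov rows u v := BSum rows (fun t => BAnd (mFin t u) (mFin t v)).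

Section Rows.
Variables (A : arr -> nat -> bool) (rows : nat).
Hypothesis HA : holds A rows.

Lemma den_eqrow w t t' i j : base A w -> den A w t i -> den A w t' j ->
  i < rows -> j < rows -> den A w (mEqrow t t') (feqrow i j).
Proof.
move=> B Ht Ht' lt lt'; apply: den_all; first by dn.
move=> w' y u X ltu Hy; weaken X.
by apply: den_eqb; apply: den_fin HA _ _ _ _.
Qed.

Lemma den_first w t i : base A w -> den A w t i -> i < rows ->
  den A w (mFirst t) (ffirst i).
Proof.
move=> B Ht lt; apply: den_and.
  apply: den_ex; first by dn.
  by move=> w' y u X ltu Hy; weaken X; apply: den_fin HA _ _ _ _.
apply: den_all => // w' y u X ltu Hy; weaken X; apply: den_not.
by apply: den_eqrow => //; apply: ltn_trans lt.
Qed.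

Lemma den_count w r t i : base A w -> den A w r rows -> den A w t i -> i < rows ->
  den A w (mCount r t) (fcount rows i).
Proof.
move=> B Hr Ht lt; apply: den_sum => // w' y u X ltu Hy; weaken X.
exact: den_eqrow.
Qed.

Lemma den_cov w r u v i j : base A w -> den A w r rows -> den A w u i -> den A w v j ->
  i < n -> j < n -> den A w (mCov r u v) (fcov rows i j).
Proof.
move=> B Hr Hu Hv lti ltj; apply: den_sum => // w' y t X ltt Hy; weaken X.
by apply: den_and; apply: den_fin HA _ _ _ _.
Qed.

Definition zcode : seq bool :=
  flatten [seq if ffirst t then [:: true] ++ (flatten [seq [:: F t u] | u <- iota 0 n] ++
      rat_code (fcount rows t) N) else [::] | t <- iota 0 rows] ++ [:: false].
Definition mZ r := BSeq (BFor r (fun t => BIf (mFirst t) (BSeq (BEmit (BC 1))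
   (BSeq (BFor pn (fun u => BEmit (mFin t u))) (mRat (mCount r t) pN))))) (BEmit (BC 0)).

Definition xcode : seq bool :=
  flatten [seq flatten [seq if (u < v) && (fcov rows u v < N) then
     [:: true] ++ (nat_code u ++ (nat_code v ++ rat_code (N - fcov rows u v) N)) else [::]
     | v <- iota 0 n] | u <- iota 0 n] ++ [:: false].
Definition mX r := BSeq (BFor pn (fun u => BFor pn (fun v =>
   BIf (BAnd (BLt u v) (BLt (mCov r u v) pN)) (BSeq (BEmit (BC 1))
   (BSeq (mNat u) (BSeq (mNat v) (mRat (BSub pN (mCov r u v)) pN))))))) (BEmit (BC 0)).

Lemma emits_Z w r : base A w -> den A w r rows -> emits A w (mZ r) zcode.
Proof.
move=> B Hr; apply: emits_seq; last exact: (emits_const A false).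
apply: emits_for => // w' t i X lt Ht; weaken X; apply: emits_if; first exact: den_first.
move=> _; apply: emits_seq; first exact: (emits_const A true).
apply: emits_seq; last by apply: emits_rat; [apply: den_count | dn].
apply: emits_for; first by dn.
by move=> w2 y u X2 ltu Hy; weaken X2; apply: emits_bool; apply: den_fin HA _ _ _ _.
Qed.

Lemma emits_X w r : base A w -> den A w r rows -> emits A w (mX r) xcode.
Proof.
move=> B Hr; apply: emits_seq; last exact: (emits_const A false).
apply: emits_for; first by dn.
move=> w1 u i X1 lti Hu; weaken X1; apply: emits_for; first by dn.
move=> w2 v j X2 ltj Hv; weaken X2.
have Hc : den A w2 (mCov r u v) (fcov rows i j) by apply: den_cov.
apply: emits_if; first by dn.
move=> _; apply: emits_seq; first exact: (emits_const A true).
apply: emits_seq; first exact: emits_nat.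
apply: emits_seq; first exact: emits_nat.
by apply: emits_rat; dn.
Qed.
End Rows.
End Emission.

(** * The main loops *)

Definition mCnt t u := BSum t (fun t' => BA AHist (BAdd (BMul t' pn) u)).
Definition pT := BMul pn pN.
Definition mTime r j := BAdd (BMul r pN) j.

(** Round [t = r N + j] is nested so that the quotient [r], used in the transitive case, is a loop
    variable. The second loop cuts every vertex off after [N] occurrences, and the third appends
    singletons for those covered too rarely. *)
Definition mLoop1 := BFor pn (fun r => BFor pN (fun j => BFor pn (fun u =>
  BSet AHist (BAdd (BMul (mTime r j) pn) u) (mH r (mTime r j) (mCnt (mTime r j)) u)))).
Definition mLoop2 := BFor pT (fun t => BFor pn (fun u =>
  BSet AFin (BAdd (BMul t pn) u)
    (BAnd (BA AHist (BAdd (BMul t pn) u)) (BLt (mCnt t u) pN)))).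
Definition mLoop3 := BFor pn (fun u => BFor pN (fun j => BFor pn (fun v =>
  BSet AFin (BAdd (BMul (BAdd pT (mTime u j)) pn) v)
    (BAnd (BEq v u) (BLt (BAdd (mCnt pT u) j) pN))))).
Definition mBody := BSeq mLoop1 (BSeq mLoop2 (BSeq mLoop3
  (BSeq (mZ (BAdd pT pT)) (mX (BAdd pT pT))))).

Lemma cden_fill w a H A o e f m q c : (forall A, den A w e m) ->
  (forall w' y i, ext w w' -> i < m -> (forall A, den A w' y i) ->
     cden w' (f y) (fillA A a H (q + i * c), o) (fillA A a H (q + i * c + c), o)) ->
  cden w (BFor e f) (fillA A a H q, o) (fillA A a H (q + m * c), o).
Proof.
move=> He Hb; pose st i : store := (fillA A a H (q + i * c), o).
have -> : (fillA A a H q, o) = st 0 by rewrite /st addn0.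
apply: (@cden_for w e f m st); first exact: He.
by move=> w' y i X lt Hy; rewrite /st mulSnr addnA; apply: Hb.
Qed.

Section Body.
Variables (inp pw : nat -> bool) (g : params).
Notation base := (base inp pw g).
Notation n := (gn g).
Notation N := (gN g).

Fixpoint fcnt (t : nat) : nat -> nat :=
  match t with
  | 0 => fun=> 0
  | t.+1 => fun u => fcnt t u + fH inp pw g (t %/ N) t (fcnt t) u
  end.
Definition fSel (t u : nat) : bool := fH inp pw g (t %/ N) t (fcnt t) u.

Lemma cnt_fSel t : cnt fSel t = fcnt t.
Proof.
apply: functional_extensionality => u; elim: t => [|t IH]; first by rewrite /cnt big_ord0.
by rewrite cntS IH.
Qed.

(** Beyond row [n N] each vertex owns [N] slots; the first [N - cnt] of them hold its singleton, and
    the others are empty. *)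
Definition fRow (t v : nat) : bool :=
  if t < n * N then trunc fSel N t v
  else (v == (t - n * N) %/ N) &&
       (cnt fSel (n * N) ((t - n * N) %/ N) + (t - n * N) %% N < N).

Lemma base_fill A w a H q : atrk a != atrk AIn -> atrk a != atrk APow ->
  base A w -> base (fillA A a H q) w.
Proof.
move=> h1 h2 [b1 b2 b3 b4].
by split; rewrite // fillA_other // eq_sym.
Qed.

Lemma den_any A C w x : base A w -> x < 8 ->
  den C w (BV x) (nth 0 [:: n; gb g; gG g; gK g; gR g; gE g; N; gk g] x).
Proof.
move=> [l8 _ _ h3] lt; rewrite -h3 (nth_map 0) ?size_iota // nth_iota //.
by apply: den_v; apply: leq_trans l8.
Qed.

Definition linear (F : nat -> nat -> bool) (x : nat) : bool := F (x %/ n) (x %% n).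

Lemma linearE F t u : u < n -> linear F (t * n + u) = F t u.
Proof.
move=> un; have n0 : 0 < n by apply: leq_ltn_trans un.
by rewrite /linear divnMDl // divn_small // addn0 modnMDl modn_small.
Qed.

Lemma den_cnt A w t t' : (forall i u, i < t' -> u < n -> A AHist (i * n + u) = fSel i u) ->
  base A w -> den A w t t' -> denF A w n (mCnt t) (cnt fSel t').
Proof.
move=> HA B Ht w' y u X lt Hy; weaken X.
have -> : cnt fSel t' u = sumf t' (fun i => A AHist (i * n + u)).
  by apply: eq_bigr => i _; rewrite HA.
by rewrite /mCnt; dn.
Qed.

Lemma loop1_ok A w : base A w ->
  cden w mLoop1 (A, [::]) (fillA A AHist (linear fSel) (n * N * n), [::]).
Proof.
move=> B; rewrite -{1}(fillA0 A AHist (linear fSel)) -[n * N * n]add0n -mulnA.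
have bs q w' : ext w w' -> base (fillA A AHist (linear fSel) q) w'.
  by move=> X; apply: base_fill => //; apply: base_mono X B.
have dpn C w' : ext w w' -> den C w' pn n by move=> X; apply: den_any (base_mono X B) (isT : 0 < 8).
have dpN C w' : ext w w' -> den C w' pN N by move=> X; apply: den_any (base_mono X B) (isT : 6 < 8).
apply: cden_fill => [C|w1 r i X1 lti Hr]; first exact/dpn/ext_refl.
apply: cden_fill => [C|w2 j l X2 ltl Hj]; first exact/dpN.
rewrite -addnA add0n; set t := i * N + l.
have -> : i * (N * n) + l * n = t * n by rewrite /t; nia.
apply: cden_row => [C|w3 u v X3 ltv Hu]; first exact/dpn/(ext_trans X1 X2).
set D := fillA _ _ _ _; have X := ext_trans X1 (ext_trans X2 X3).
have BD : base D w3 by apply: bs.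
have Hr3 : den D w3 r i by apply: den_mono (Hr D); apply: ext_trans X3.
have Hj3 : den D w3 j l by apply: den_mono (Hj D).
have Hu3 := Hu D.
have Ht : den D w3 (mTime r j) t by rewrite /mTime /t; dn.
split; first by dn.
rewrite linearE // /fSel.
have -> : t %/ N = i by rewrite /t divnMDl ?divn_small ?addn0 //; apply: leq_ltn_trans ltl.
apply: den_H => //; rewrite -cnt_fSel; apply: den_cnt => // i' u' lti' ltu'.
rewrite /D fillA_same ?linearE //.
by apply: (@leq_trans (i'.+1 * n)); [rewrite mulSn; lia | rewrite (leq_trans _ (leq_addr _ _)) // leq_mul2r lti' orbT].
Qed.

Section Loops23.
Variables (A : arr -> nat -> bool) (w : world).
Hypothesis B : base A w.
Hypothesis HA : forall i u, i < n * N -> u < n -> A AHist (i * n + u) = fSel i u.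
Notation fill q := (fillA A AFin (linear fRow) q).

Lemma fill_hist q i u : i < n * N -> u < n -> fill q AHist (i * n + u) = fSel i u.
Proof. by move=> *; rewrite fillA_other // HA. Qed.

Lemma fill_base q w' : ext w w' -> base (fill q) w'.
Proof. by move=> X; apply: base_fill => //; apply: base_mono X B. Qed.

Lemma any_pn C w' : ext w w' -> den C w' pn n.
Proof. by move=> X; apply: den_any (base_mono X B) (isT : 0 < 8). Qed.
Lemma any_pN C w' : ext w w' -> den C w' pN N.
Proof. by move=> X; apply: den_any (base_mono X B) (isT : 6 < 8). Qed.

Lemma loop2_ok : cden w mLoop2 (A, [::]) (fill (n * N * n), [::]).
Proof.
rewrite -{1}(fillA0 A AFin (linear fRow)) -[n * N * n]add0n.
apply: cden_fill => [C|w1 t i X1 lti Ht].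
  by apply: den_mul; [apply/any_pn/ext_refl | apply/any_pN/ext_refl].
rewrite add0n; apply: cden_row => [C|w2 u v X2 ltv Hu]; first exact: any_pn.
set D := fill _; have X := ext_trans X1 X2.
have BD : base D w2 by apply: fill_base.
have Ht2 : den D w2 t i by apply: den_mono (Ht D).
have Hu2 := Hu D.
split; first by dn.
rewrite linearE // /fRow lti /trunc -(fill_hist (i * n + v) lti ltv) -/D.
apply: den_and; first by dn.
apply: den_lt; last by dn.
have Hc : denF D w2 n (mCnt t) (cnt fSel i).
  by apply: den_cnt => // i' u' lti'; apply: fill_hist; apply: ltn_trans lti.
by dn.
Qed.

Lemma loop3_ok : cden w mLoop3 (fill (n * N * n), [::]) (fill (n * N * n + n * (N * n)), [::]).
Proof.
apply: cden_fill => [C|w1 u i X1 lti Hu]; first exact/any_pn/ext_refl.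
apply: cden_fill => [C|w2 j l X2 ltl Hj]; first exact: any_pN.
rewrite -addnA; have -> : n * N * n + (i * (N * n) + l * n) = (n * N + (i * N + l)) * n by nia.
apply: cden_row => [C|w3 v k X3 ltk Hv]; first exact/any_pn/(ext_trans X1).
set D := fill _; have X := ext_trans X1 (ext_trans X2 X3).
have BD : base D w3 by apply: fill_base.
have Hu3 : den D w3 u i by apply: den_mono (Hu D); apply: ext_trans X3.
have Hj3 : den D w3 j l by apply: den_mono (Hj D).
have Hv3 := Hv D.
split; first by rewrite /pT /mTime; dn.
rewrite linearE // /fRow ltnNge leq_addr /= addKn.
have N0 : 0 < N by apply: leq_ltn_trans ltl.
rewrite divnMDl // divn_small // addn0 modnMDl modn_small //.
have HT : den D w3 pT (n * N) by rewrite /pT; dn.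
have Hc : denF D w3 n (mCnt pT) (cnt fSel (n * N)).
  by apply: den_cnt => // i' u' lti'; apply: fill_hist.
by dn.
Qed.
End Loops23.

Lemma body_ok A w : base A w -> exists A',
  cden w mBody (A, [::]) (A', zcode g fRow (n * N + n * N) ++ xcode g fRow (n * N + n * N)).
Proof.
move=> B; set A1 := fillA A AHist (linear fSel) (n * N * n).
have B1 : base A1 w by apply: base_fill.
have H1 i u : i < n * N -> u < n -> A1 AHist (i * n + u) = fSel i u.
  move=> lti ltu; rewrite /A1 fillA_same ?linearE //.
  by apply: (@leq_trans (i.+1 * n)); [rewrite mulSn; lia | rewrite leq_mul2r lti orbT].
set A2 := fillA A1 AFin (linear fRow) (n * N * n + n * (N * n)).
have B2 : base A2 w by apply: base_fill.
have H2 : holds g fRow A2 (n * N + n * N).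
  move=> t u ltt ltu; rewrite /A2 fillA_same ?linearE //.
  by apply: (@leq_trans (t.+1 * n)); [rewrite mulSn; lia | nia].
exists A2; apply: cden_seq; first exact: loop1_ok.
apply: cden_seq; first exact: loop2_ok.
apply: cden_seq; first exact: loop3_ok.
have HT : den A2 w (BAdd pT pT) (n * N + n * N) by rewrite /pT; dn.
apply: cden_seq; first exact: emits_cden (emits_Z H2 B2 HT).
exact: emits_cden (emits_X H2 B2 HT).
Qed.
End Body.

(** * The program solves the linear program *)

Lemma encode_digits (b J : nat) (f : nat -> nat) : (forall j, f j < b) ->
  exists2 c, c < b ^ J & forall j, j < J -> (c %/ b ^ j) %% b = f j.
Proof.
move=> fb; have b0 : 0 < b by apply: leq_ltn_trans (fb 0).
elim: J f fb => [|J IH] f fb; first by exists 0.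
have [c cJ Hc] := IH (fun j => f j.+1) (fun j => fb j.+1).
exists (c * b + f 0) => [|[|j] lt].
- by rewrite expnS; have := fb 0; nia.
- by rewrite expn0 divn1 modnMDl modn_small.
- by rewrite expnS divnMA divnMDl // (divn_small (fb 0)) addn0 Hc.
Qed.

Lemma sumf_seq R (F : nat -> nat) (h : nat -> nat) :
  sumf R (fun j => F (h j)) = \sum_(w <- [seq h j | j <- iota 0 R]) F w.
Proof.
by rewrite /sumf -(big_mkord xpredT (fun j => F (h j))) /index_iota subn0 big_map.
Qed.

(** The base [n + 4] leaves room for sizes and fillers up to [n] and for the three kinds, however
    small [n] is. *)
Definition setting (n Q : nat) : params :=
  Params n (n + 4) ((n + 4) ^ ndigits Q) (kap Q) (nroots Q) (n ^ 3 * Q) (n ^ 5 * Q ^ 2) (kap Q ^ 2).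

Section Link.
Variables (inp pw : nat -> bool) (n Q : nat).
Hypothesis n0 : 0 < n.
Hypothesis Q0 : 0 < Q.
Notation g := (setting n Q).
Notation b := (n + 4).
Notation J := (ndigits Q).
Notation E := (n ^ 3 * Q).
Notation N := (n ^ 5 * Q ^ 2).
Notation K := (kap Q).
Notation k := (kap Q ^ 2).
Notation adj := (adjacent inp g).
Hypothesis asym : forall u v, u < n -> v < n -> adj u v = adj v u.
Hypothesis pwE : forall x, pw x = [exists j : 'I_J.+1, x == b ^ j].

Lemma adj_refl u : u < n -> adj u u. Proof. by rewrite /adjacent eqxx. Qed.

Lemma pw_pow j : j <= J -> pw (b ^ j).
Proof. by move=> le; rewrite pwE; apply/existsP; exists (inord j); rewrite inordK. Qed.

Lemma b_gt1 : 1 < b. Proof. by rewrite addn4. Qed.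

(** The number of marked powers below a power is its exponent; this is how [dig] finds the right
    position without a logarithm. *)
Lemma pw_count j : j <= J -> sumf (b ^ j) (fun y => pw y) = j.
Proof.
have b1 := b_gt1.
elim: j => [|j IH] le.
  rewrite expn0 /sumf big_ord1 pwE; apply/eqP; rewrite eqb0; apply/existsPn => i.
  by rewrite eq_sym expn_eq0 addn4.
have le' : b ^ j <= b ^ j.+1 by rewrite leq_exp2l.
rewrite /sumf -(big_mkord xpredT (fun y => pw y : nat)) (big_cat_nat (leq0n _) le') /=.
rewrite big_mkord -/(sumf _ (fun y => pw y)) IH ?(ltnW le) // big_ltn ?ltn_exp2l //.
rewrite pw_pow ?(ltnW le) // big_nat big1 ?addn0 ?addn1 // => x /andP[lx ux].
apply/eqP; rewrite eqb0 pwE; apply/existsPn => i; apply/eqP => e.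
by move: lx ux; rewrite e !ltn_exp2l // => h1 h2; lia.
Qed.

Lemma dig_ok c j : j < J -> dig pw g c j = (c %/ b ^ j) %% b.
Proof.
move=> lt; have b1 := b_gt1; have b0 : 0 < b by lia.
have ltG : b ^ j < b ^ J + 1 by rewrite addn1 ltnS leq_exp2l // ltnW.
rewrite /dig {1}/sumf /= (bigD1 (Ordinal ltG)) //= pw_pow ?(ltnW lt) // pw_count ?(ltnW lt) //.
rewrite eqxx mul1n bmodE // bdivE ?expn_gt0 ?b0 // big1 ?addn0 // => x ne.
case px: (pw x) => //=; case: eqP => // e; case/eqP: ne; apply: val_inj => /=.
move: px e; rewrite pwE => /existsP[i /eqP->]; rewrite pw_count; last by rewrite -ltnS.
by move=> ->.
Qed.

(** A candidate reads no digit from [J] on, so the [b ^ J] codes exhaust all candidates. *)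
Lemma cand_ext p dg dg' : (forall j, j < J -> dg j = dg' j) ->
  forall u, u < n -> cand n adj Q p dg u = cand n adj Q p dg' u.
Proof.
move=> H u un; have J2 : 2 + nroots Q <= J by rewrite /ndigits /base leq_addr.
have K0 := kap_gt0 Q0.
rewrite /cand H ?(H 1); try lia.
have -> : [seq dg j.+2 | j <- iota 0 (nroots Q)] = [seq dg' j.+2 | j <- iota 0 (nroots Q)].
  by apply/eq_in_map => j; rewrite mem_iota => /andP[_ lt]; apply: H; lia.
rewrite /candS /rounded; set D := Dset _ _ _ _ _; set ch := chunk _ _ _ _.
have lch : ch < K by rewrite /ch; apply: chunk_lt.
have base_lt j : j <= k -> digit_base Q ch + j < J.
  move=> lj; rewrite /ndigits /digit_base -addnA ltn_add2l.
  apply: (@leq_trans (ch.+1 * k.+1)); first by rewrite mulSn; lia.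
  by rewrite leq_mul2r lch orbT.
rewrite (H (digit_base Q ch)); last by have := base_lt 0 isT; rewrite addn0.
have -> // : [seq dg (digit_base Q ch + j.+1) | j <- iota 0 k] =
  [seq dg' (digit_base Q ch + j.+1) | j <- iota 0 k].
by apply/eq_in_map => j; rewrite mem_iota => /andP[_ lt]; apply/H/base_lt.
Qed.

Variable c : nat.
Notation dg := (fun j => dig pw g c j).
Notation roots := [seq dg j.+2 | j <- iota 0 (nroots Q)].

Lemma fTE : fT inp pw g c = Tset adj roots.
Proof.
apply: functional_extensionality => v; rewrite /fT /Tset; congr (0 < _).
rewrite -(sumf_seq _ (fun w => adj v w)) /sumf /=.
by apply: eq_bigr => j _; rewrite addn2.
Qed.

Lemma fKE : fK inp pw g c = Kset n adj (dg 0) (dg 1) roots.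
Proof.
apply: functional_extensionality => v; rewrite /fK fTE /Kset.
by case: (dig _ _ _ 0) => [|[|d]] //=; rewrite orbF.
Qed.

Lemma fDE : fD inp pw g c = Dset n adj (dg 0) (dg 1) roots.
Proof.
apply: functional_extensionality => v; rewrite /fD fTE fKE /Dset.
by case: (dig _ _ _ 0) => [|[|d]] //=; rewrite orbF.
Qed.

Lemma fbaseE v : fbase inp pw g c v = digit_base Q (chunk n K (fD inp pw g c) v).
Proof.
rewrite /fbase /digit_base /chunk /frank bmodE ?kap_gt0 //= addn1.
by congr (_ + _ * _).
Qed.

Lemma fSE t (S : nat -> nat -> bool) u : u < n ->
  fS inp pw g t (cnt S t) c u = cand n adj Q (price n S E t) dg u.
Proof.
move=> un; rewrite /fS /cand /candS /rounded -fKE -fDE; congr (_ || (_ && _)).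
rewrite /fdec /fhits /est fbaseE; set ch := chunk _ _ _ _.
set A := [seq _ | _ <- _].
have -> : sumf (gk g) (fun j => adj u (dig pw g c (digit_base Q ch + (j + 1)))) = hits adj u A.
  rewrite /hits /A -(sumf_seq _ (fun w => adj u w)) /sumf /=.
  by apply: eq_bigr => j _; rewrite addn1.
rewrite /=; set h := hits _ _ _; set t' := dig _ _ _ _.
set cu := vcard n (adj u); set cK := vcard n _; set iK := vinter n _ _.
have E0 : (0 < E)%N by rewrite muln_gt0 expn_gt0 n0.
have k0 : (0 < k)%N by rewrite expn_gt0 kap_gt0.
rewrite /price; set m := cnt S t u.
move: E0 k0; move: (n ^ 3 * Q) (kap Q ^ 2) => e kk e0 k0.
have e0' : (0 < e%:R :> rat)%R by rewrite ltr0n.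
have k0' : (0 < kk%:R :> rat)%R by rewrite ltr0n.
set est := (X in _ = (X < 0)%R).
have -> : (est < 0)%R = (est * (e%:R * kk%:R) < 0)%R.
  by rewrite pmulr_llt0 // mulr_gt0.
have -> : (est * (e%:R * kk%:R) =
  (e * kk * cu + 2 * kk * e * cK + 2 * t' * kk * e + kk * n * m)%:R -
  (kk * t + 4 * kk * e * iK + 4 * e * h * t')%:R)%R.
  rewrite /est !natrD !natrM; field.
  by rewrite !gt_eqF.
by rewrite subr_lt0 ltr_nat.
Qed.
End Link.

Section Total.
Variables (inp pw : nat -> bool) (n Q : nat).
Hypothesis n0 : 0 < n.
Hypothesis Q0 : 0 < Q.
Notation g := (setting n Q).
Notation b := (n + 4).
Notation J := (ndigits Q).
Notation E := (n ^ 3 * Q).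
Notation N := (n ^ 5 * Q ^ 2).
Notation T := (n * (n ^ 5 * Q ^ 2)).
Notation adj := (adjacent inp g).
Hypothesis asym : forall u v, u < n -> v < n -> adj u v = adj v u.
Hypothesis pwE : forall x, pw x = [exists j : 'I_J.+1, x == b ^ j].
Notation S := (fSel inp pw g).
Notation arefl := (@adj_refl inp n Q).

Lemma vcost_ext x y : (forall u, u < n -> x u = y u) -> vcost n adj x = vcost n adj y.
Proof.
move=> xy; apply: eq_bigr => u _; rewrite xy //; congr (_ * _).
by apply: eq_bigr => v _; rewrite xy.
Qed.

Lemma E_gt0 : 0 < E. Proof. by rewrite muln_gt0 expn_gt0 n0. Qed.

Lemma fval_pcost t c : ((fval inp pw g t (cnt S t) c)%:R =
  E%:R * vpcost n adj (price n S E t) (cand n adj Q (price n S E t) (fun j => dig pw g c j)) +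
  n%:R * t%:R :> rat)%R.
Proof.
rewrite -(@pcost_ext n adj (price n S E t) (fS inp pw g t (cnt S t) c)); last first.
  by move=> u un; apply: fSE.
set x := fS _ _ _ _ _ _; rewrite /fval -/x /sumf /=.
have := E_gt0; move: E => e e0; rewrite natrD natr_sum.
rewrite natrB; last by rewrite leq_mul2r vcard_le orbT.
rewrite pcost_sum mulr_sumr !natrM.
have -> : ((vcard n x)%:R * t%:R = \sum_(u < n) (x u)%:R * t%:R :> rat)%R.
  by rewrite -mulr_suml /vcard natr_sum.
rewrite addrCA addrC; congr (_ + _)%R; rewrite -sumrB; apply: eq_bigr => u _.
rewrite /price natrM natrD !natrM.
by field; rewrite pnatr_eq0 -lt0n.
Qed.

Lemma first_min t m : exists c, [/\ fmin inp pw g t m c &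
  forall u, fsel inp pw g t m u = fS inp pw g t m c u].
Proof.
have G0 : 0 < gG g by rewrite /= expn_gt0 addn4.
have [c0 _ H0] := arg_minnP (fun c : 'I_(gG g) => fval inp pw g t m c) (isT : xpredT (Ordinal G0)).
have m0 : fmin inp pw g t m c0.
  by apply/allP => c'; rewrite mem_iota => /andP[_ lt]; apply: (H0 (Ordinal lt)).
have ex : exists c, fmin inp pw g t m c by exists c0.
pose c := ex_minn ex; have [mc Hc] : fmin inp pw g t m c /\
    forall c', fmin inp pw g t m c' -> c <= c' by rewrite /c; case: ex_minnP.
exists c; split=> // u; apply/hasP/idP => [[c1]|Su].
  rewrite mem_iota => _ /andP[m1 /andP[/hasPn no Su]].
  suff -> : c = c1 by [].
  apply/eqP; rewrite eqn_leq Hc //= leqNgt; apply/negP => lt.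
  by have := no c; rewrite mem_iota lt mc => /(_ isT).
exists c; first by rewrite mem_iota /=; apply: leq_ltn_trans (Hc _ m0) (ltn_ord _).
rewrite mc Su andbT /=; apply/hasPn => c'; rewrite mem_iota => /andP[_ lt].
by apply/negP => /Hc; rewrite leqNgt lt.
Qed.

(** Any digit function agrees on its first [J] digits with some code below [b ^ J], and the chosen
    code minimises over these. *)
Lemma round_ok (c : {ffun 'I_n -> {set 'I_n}}) t : ~~ ftransb inp g ->
  (forall c' : {ffun 'I_n -> {set 'I_n}}, colcost adj c <= colcost adj c') ->
  (n%:R * vpcost n adj (price n S E t) (S t) <=
   (colcost adj c)%:R * (1 + Q%:R^-1) - \sum_(u < n) price n S E t u)%R.
Proof.
move=> nt opt; apply: (round_bound asym arefl opt Q0) => dg Hdg.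
have [d dG Hd] := @encode_digits b J dg Hdg.
have [c0 [mc Sc]] := first_min t (cnt S t).
rewrite (@pcost_ext n adj _ (S t) (cand n adj Q (price n S E t) (fun j => dig pw g c0 j))); last first.
  move=> u un; rewrite -fSE // -Sc cnt_fSel /fSel /fH (negbTE nt) //.
rewrite (@pcost_ext n adj _ (cand n adj Q (price n S E t) dg)
   (cand n adj Q (price n S E t) (fun j => dig pw g d j))); last first.
  by apply: cand_ext => // j lt; rewrite (dig_ok n0 Q0 pwE) ?Hd.
have le : fval inp pw g t (cnt S t) c0 <= fval inp pw g t (cnt S t) d.
  by move/allP: mc; apply; rewrite mem_iota.
have E0 : (0 < E%:R :> rat)%R by rewrite ltr0n E_gt0.
move: (fval_pcost t c0) (fval_pcost t d) le.
move: (fval _ _ _ _ _ c0) (fval _ _ _ _ _ d) => x y.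
by rewrite -(ler_nat rat) => -> ->; rewrite lerD2r (ler_pM2l E0).
Qed.

Lemma cost_single u : u < n -> vcost n adj (fun v => v == u) <= n.
Proof.
move=> un; rewrite /vcost (bigD1 (Ordinal un)) //= eqxx mul1n big1 ?addn0.
  rewrite -[X in _ <= X]card_ord -sum1_card; apply: leq_sum => v _.
  by case: (_ != _).
by move=> v; rewrite -val_eqE /= => /negPf->.
Qed.

Notation F := (fRow inp pw g).

Lemma sum_rows (h : nat -> nat) : \sum_(t < T + T) h t =
  \sum_(t < T) h t + \sum_(u < n) \sum_(j < N) h (T + (u * N + j)).
Proof.
rewrite big_split_ord /=; congr (_ + _).
have H m : \sum_(i < m * N) h (T + i) = \sum_(u < m) \sum_(j < N) h (T + (u * N + j)).
  elim: m => [|m IH]; first by rewrite !big_ord0.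
  by rewrite big_ord_recr /= -IH mulSnr big_split_ord.
exact: H.
Qed.

Lemma row_lo t v : t < T -> F t v = trunc S N t v.
Proof. by rewrite /fRow /= => ->. Qed.

Lemma row_hi u j v : j < N -> F (T + (u * N + j)) v = (v == u) && (cnt S T u + j < N).
Proof.
move=> lt; rewrite /fRow /= ltnNge leq_addr /= addKn.
have N0 : 0 < N by apply: leq_ltn_trans lt.
by rewrite divnMDl // divn_small // addn0 modnMDl modn_small.
Qed.

Lemma count_ltn m r : \sum_(j < r) (m + j < r) = r - m.
Proof.
elim: r => [|r IH]; first by rewrite big_ord0.
case: (leqP m r) => h; last first.
  rewrite big1 => [|j _]; first by lia.
  by apply/eqP; rewrite eqb0; lia.
rewrite big_ord_recl /=.
have -> : \sum_(i < r) (m + bump 0 i < r.+1) = \sum_(i < r) (m + i < r).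
  by apply: eq_bigr => i _; rewrite /bump /= add1n addnS ltnS.
by rewrite IH; lia.
Qed.

Lemma rows_cover v : v < n -> \sum_(t < T + T) F t v = N.
Proof.
move=> vn; rewrite (sum_rows (fun t => F t v : nat)).
under eq_bigr => t _ do rewrite row_lo //.
rewrite trunc_count (bigD1 (Ordinal vn)) //= [X in _ + (_ + X)]big1; last first.
  move=> u; rewrite -val_eqE /= => ne; rewrite big1 // => j _.
  by rewrite row_hi // eq_sym (negbTE ne).
rewrite addn0; under eq_bigr => j _ do rewrite row_hi // eqxx /=.
by rewrite count_ltn; lia.
Qed.

Lemma total_cost : \sum_(t < T + T) vcost n adj (F t) <=
  \sum_(t < T) vcost n adj (trunc S N t) + n * \sum_(u < n) (N - cnt S T u).
Proof.
rewrite (sum_rows (fun t => vcost n adj (F t))); apply: leq_add.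
  by apply: leq_sum => t _; rewrite (vcost_ext (y := trunc S N t)) // => u _; apply: row_lo.
rewrite big_distrr /=; apply: leq_sum => u _; rewrite -count_ltn big_distrr /=.
apply: leq_sum => j _; case lt: (cnt S T u + j < N).
  rewrite muln1 (vcost_ext (y := fun v => v == u)); first exact: cost_single.
  by move=> v vn; rewrite row_hi // lt andbT.
rewrite muln0 leqn0 /vcost big1 // => v _.
by rewrite row_hi // lt andbF.
Qed.

Lemma cost_general (c : {ffun 'I_n -> {set 'I_n}}) : ~~ ftransb inp g ->
  (forall c' : {ffun 'I_n -> {set 'I_n}}, colcost adj c <= colcost adj c') ->
  ((\sum_(t < T + T) vcost n adj (F t))%:R <=
    N%:R * ((colcost adj c)%:R * (1 + Q%:R^-1) + Q%:R^-1) :> rat)%R.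
Proof.
move=> nt opt; apply: le_trans (_ : (_ <= (_ : nat)%:R)%R) _; first by rewrite ler_nat; apply: total_cost.
apply: regret => // t _; exact: round_ok.
Qed.

Hypothesis trans : ftransb inp g.

Lemma adj_trans u v w : u < n -> v < n -> w < n -> adj u v -> adj v w -> adj u w.
Proof.
move=> un vn wn uv vw; move/allP: trans => /(_ u); rewrite mem_iota => /(_ un).
move/allP => /(_ v); rewrite mem_iota => /(_ vn).
move/allP => /(_ w); rewrite mem_iota => /(_ wn).
by rewrite uv vw /= negbK.
Qed.

Lemma SE t u : S t u = frow inp g (t %/ N) u.
Proof. by rewrite /fSel /fH trans /= orbF. Qed.

(** Only the least neighbour of [u] owns a row containing [u]: by transitivity, any other neighbour
    [r'] of [u] has it as a smaller neighbour, which empties the row of [r']. *)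
Lemma frow_count u : u < n -> \sum_(r < n) frow inp g r u = 1.
Proof.
move=> un; have ex : exists r, adj r u by exists u; apply: adj_refl.
pose r := ex_minn ex; have [ru Hr] : adj r u /\ forall r', adj r' u -> r <= r'.
  by rewrite /r; case: ex_minnP.
have rn : r < n by apply: leq_ltn_trans (Hr u (adj_refl _ _ un)) un.
rewrite (bigD1 (Ordinal rn)) //= big1 => [|r' ne].
  rewrite addn0; have -> : frow inp g r u; last by [].
  rewrite /frow ru /=; apply/allP => r'; rewrite mem_iota => /andP[_ lt].
  apply/negP => rr'; have r'n : r' < n by apply: ltn_trans rn.
  have := Hr r'; rewrite leqNgt lt => /(_ _)/negP; case=> //.
  by apply: (@adj_trans _ r) => //; rewrite asym.
apply/eqP; rewrite eqb0; apply/negP => /andP[r'u /allP H].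
have lt : r < r'.
  by rewrite ltn_neqAle (Hr _ r'u) andbT; apply: contraNneq ne => e; apply/eqP/val_inj.
have := H r; rewrite mem_iota lt => /(_ isT)/negP; apply.
by apply: (@adj_trans _ u) => //; rewrite asym.
Qed.

Lemma cnt_full u : u < n -> cnt S T u = N.
Proof.
move=> un; have H m : m <= n -> cnt S (m * N) u = \sum_(r < m) N * frow inp g r u.
  elim: m => [|m IH] lt; first by rewrite /cnt !big_ord0.
  rewrite big_ord_recr /= -IH ?(ltnW lt) // /cnt mulSnr big_split_ord /=; congr (_ + _).
  rewrite (eq_bigr (fun=> frow inp g m u : nat)); first by rewrite sum_nat_const card_ord.
  move=> j _; rewrite SE; have N0 : 0 < N by apply: leq_ltn_trans (ltn_ord j).
  by rewrite divnMDl // divn_small // addn0.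
by rewrite H // -big_distrr /= frow_count // muln1.
Qed.

(** Each class is chosen [N] times, so nothing is truncated and no singleton is added; and a class
    equal to the neighbourhood of each of its members costs 0. *)
Lemma cost_trans : \sum_(t < T + T) vcost n adj (F t) = 0.
Proof.
apply/eqP; rewrite -leqn0; apply: leq_trans total_cost _.
rewrite [X in _ + n * X]big1 ?muln0 ?addn0; last by move=> u _; rewrite cnt_full // subnn.
rewrite leqn0; apply/eqP; apply: big1 => t _.
have tE u : u < n -> trunc S N t u = S t u.
  move=> un; rewrite /trunc; case Stu: (S t u) => //=.
  suff : cnt S t u < cnt S T u by rewrite (cnt_full un).
  rewrite /cnt -!(big_mkord xpredT (fun t => S t u : nat)).
  rewrite [X in _ < X](big_cat_nat (leq0n t) (ltnW (ltn_ord t))) /=.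
  by rewrite (big_ltn (ltn_ord t)) Stu; lia.
rewrite (vcost_ext tE) /vcost; apply: big1 => u _; rewrite SE.
have rn : t %/ N < n.
  have N0 : 0 < N by rewrite muln_gt0 !expn_gt0 n0 Q0.
  by rewrite ltn_divLR // (leq_trans (ltn_ord t)).
case fu: (frow _ _ _ _) => //; rewrite mul1n; apply: big1 => v _.
rewrite SE; apply/eqP; rewrite eqb0 negbK; apply/eqP.
move/andP: (fu) => [ru Hr]; rewrite /frow Hr andbT.
apply/idP/idP => h; first by apply: (@adj_trans _ u).
by apply: (@adj_trans _ (t %/ N)) => //; rewrite asym.
Qed.
End Total.

(** * The emitted codes of numbers *)

Lemma flatten_if (T : Type) (U : Type) (p : pred T) (h : T -> seq U) s :
  flatten [seq if p x then h x else [::] | x <- s] = flatten [seq h x | x <- s & p x].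
Proof. by elim: s => //= x s ->; case: (p x). Qed.

Lemma fpow2P x : reflect (exists j, x = 2 ^ j) (fpow2 x).
Proof.
apply: (iffP andP) => [[x0 /allP H]|[j ->]].
  (* The odd part of [x] is an odd divisor, so by [H] it is 1. *)
  have xE := partnC 2 x0.
  have od : odd (x`_2^') by rewrite odd_2'nat part_pnat.
  exists (logn 2 x); rewrite -[LHS]xE -p_part.
  have -> : x`_2^' = 1; last by rewrite muln1.
  apply/eqP; apply/negPn/negP => ne1.
  have p0 : 0 < x`_2^' by apply: part_gt0.
  have dv : x`_2^' %| x by apply: dvdn_part.
  have := H (x`_2^'); rewrite mem_iota add0n addn1 ltnS (dvdn_leq x0 dv) => /(_ isT).
  rewrite !bmodE // -/(dvdn _ _) dv modn2 od /=.
  by move: ne1 p0; case: (x`_2^') => [|[|m]].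
split; first by rewrite expn_gt0.
apply/allP => d _; apply/negP => /and3P[+ + d1]; rewrite !bmodE ?modn2 //; last by lia.
move=> /(dvdn_pfactor _ _ (isT : prime 2)) [i _ di]; rewrite di in d1 *.
by case: i d1 {di} => [|i] d1; rewrite ?oddX.
Qed.

Lemma bits_fuelE f : forall k j, k <= f ->
  ((j < size (bits_fuel f k)) = (2 ^ j <= k)) /\
  (j < size (bits_fuel f k) -> nth false (bits_fuel f k) j = odd (k %/ 2 ^ j)).
Proof.
elim: f => [|f IH] k j le.
  by move: le; rewrite leqn0 => /eqP->; split=> //=; rewrite [RHS]leqNgt expn_gt0.
case: k le => [|k] le; first by split=> //=; rewrite [RHS]leqNgt expn_gt0.
have lh : (k.+1)./2 <= f by rewrite leq_half_double; lia.
rewrite /=; case: j => [|j] /=; first by rewrite expn0 divn1.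
have [h1 h2] := IH _ j lh; rewrite ltnS h1 -divn2 leq_divRL // expnS mulnC; split=> //.
move=> lt; rewrite h2 ?h1 -?divn2 ?leq_divRL //; last by rewrite mulnC.
by rewrite divnMA.
Qed.

Lemma bitsE m : bits m = [seq odd (m %/ 2 ^ j) | j <- iota 0 (size (bits m))].
Proof.
apply: (@eq_from_nth _ false); rewrite ?size_map ?size_iota // => j lt.
rewrite (nth_map 0) ?size_iota // nth_iota // add0n.
by have [_] := bits_fuelE j (leqnn m); apply.
Qed.

Lemma nat_codeE m : nat_code m = enc_nat m.
Proof.
rewrite /nat_code /enc_nat flatten_if; congr (_ ++ _).
have -> : [seq x <- iota 0 (m + 1) | fpow2 x] = [seq 2 ^ j | j <- iota 0 (size (bits m))].
  (* Two strictly increasing lists with the same members are equal. *)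
  apply: (irr_sorted_eq ltn_trans ltnn).
  - by apply: sorted_filter; [exact: ltn_trans | exact: iota_ltn_sorted].
  - rewrite sorted_map; apply: sub_sorted (iota_ltn_sorted 0 _) => i j /=.
    by rewrite ltn_exp2l.
  - move=> x; rewrite mem_filter mem_iota add0n addn1 ltnS.
    apply/andP/mapP => [[/fpow2P[j ->] le]|[j]].
      by exists j => //; rewrite mem_iota add0n; have [->] := bits_fuelE j (leqnn m).
    rewrite mem_iota add0n => /andP[_]; have [-> _] := bits_fuelE j (leqnn m).
    by move=> le ->; split=> //; apply/fpow2P; exists j.
rewrite -map_comp [in RHS]bitsE -map_comp; congr flatten; apply/eq_in_map => j _ /=.
by rewrite bmodE // bdivE ?expn_gt0 // modn2; case: odd.
Qed.

Lemma fgcdE c d x : 0 < d -> fgcd c d x = (x == gcdn c d).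
Proof.
move=> d0; have g0 : 0 < gcdn c d by rewrite gcdn_gt0 d0 orbT.
have cdE y : fcd c d y = (0 < y) && (y %| gcdn c d).
  by rewrite /fcd; case: (posnP y) => //= y0; rewrite !bmodE // dvdn_gcd.
rewrite /fgcd cdE; apply/idP/eqP => [/andP[/andP[x0 xg] /allP H]|->].
  apply/eqP; rewrite eqn_leq (dvdn_leq g0 xg) /=; rewrite leqNgt; apply/negP => lt.
  have := H (gcdn c d); rewrite mem_iota add0n addn1 ltnS /= cdE g0 dvdnn lt /=.
  by rewrite (dvdn_leq d0 (dvdn_gcdr _ _)) => /(_ isT).
rewrite g0 dvdnn /=; apply/allP => y _; rewrite cdE; apply/negP => /andP[/andP[y0 yg]].
by rewrite ltnNge (dvdn_leq g0 yg).
Qed.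

Lemma rat_codeE c d : 0 < d -> rat_code c d = enc_rat (c%:R / d%:R)%R.
Proof.
move=> d0; rewrite /rat_code flatten_if.
have g0 : 0 < gcdn c d by rewrite gcdn_gt0 d0 orbT.
have -> : [seq x <- iota 0 (d + 1) | fgcd c d x] = [:: gcdn c d].
  rewrite (eq_filter (a2 := pred1 (gcdn c d))); last by move=> x; rewrite /= fgcdE.
  apply: filter_pred1_uniq; first exact: iota_uniq.
  by rewrite mem_iota add0n addn1 ltnS (dvdn_leq d0 (dvdn_gcdr _ _)).
rewrite /= cats0 !nat_codeE !bdivE //.
set c' := c %/ _; set d' := d %/ _.
have cE : c = c' * gcdn c d by rewrite divnK ?dvdn_gcdl.
have dE : d = d' * gcdn c d by rewrite divnK ?dvdn_gcdr.
have d'0 : 0 < d' by rewrite divn_gt0 // dvdn_leq ?dvdn_gcdr.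
have co : coprime c' d'.
  rewrite /coprime -(eqn_pmul2r g0) mul1n muln_gcdl -cE -dE; exact: eqxx.
have -> : (c%:R / d%:R = (c' : int)%:~R / (d' : int)%:~R :> rat)%R.
  have E1 : (c%:R = c'%:R * (gcdn c d)%:R :> rat)%R by rewrite -natrM -cE.
  have E2 : (d%:R = d'%:R * (gcdn c d)%:R :> rat)%R by rewrite -natrM -dE.
  by rewrite E1 E2 -!pmulrn -mulf_div divff ?mulr1 // pnatr_eq0 -lt0n.
rewrite /enc_rat coprimeq_num // coprimeq_den //.
rewrite gtr0_sg ?ltz_nat // mul1r.
by case: (d') d'0.
Qed.

Lemma sum_sym (n : nat) (e : 'I_n -> 'I_n -> nat) : (forall u v, e u v = e v u) ->
  (forall u, e u u = 0) ->
  \sum_(u < n) \sum_(v < n) e u v = 2 * \sum_(u < n) \sum_(v < n | u < v) e u v.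
Proof.
move=> es e0; rewrite mul2n -addnn.
have -> : \sum_(u < n) \sum_(v < n) e u v =
   \sum_(u < n) \sum_(v < n | u < v) e u v + \sum_(u < n) \sum_(v < n | v < u) e u v.
  rewrite -big_split /=; apply: eq_bigr => u _.
  rewrite [in LHS](bigID (fun v : 'I_n => u < v)) /=; congr (_ + _).
  rewrite (bigID (fun v : 'I_n => v < u)) /= [X in _ + X]big1 ?addn0.
    by apply: eq_bigl => v; lia.
  move=> v /andP[h1 h2]; have -> : v = u by apply: val_inj => /=; lia.
  exact: e0.
congr (_ + _).
under eq_bigr => u _ do rewrite big_mkcond.
rewrite exchange_big /=; apply: eq_bigr => u _; rewrite [RHS]big_mkcond /=.
by apply: eq_bigr => v _; rewrite es.
Qed.

(** * From rows to a solution of the cluster LP *)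

Section Solution.
Variables (g : params) (F : nat -> nat -> bool) (rows : nat).
Notation n := (gn g).
Notation N := (gN g).
Hypothesis N0 : 0 < N.
Hypothesis cover : forall v, v < n -> \sum_(t < rows) F t v = N.

Definition rset (t : nat) : {set 'I_n} := [set i : 'I_n | F t i].

Lemma feqrowE t t' : feqrow g F t t' = (rset t == rset t').
Proof.
apply/allP/eqP => [H|/setP H u].
  by apply/setP => i; rewrite !inE; apply/eqP/H; rewrite mem_iota ltn_ord.
rewrite mem_iota add0n => /andP[_ un]; have := H (Ordinal un).
by rewrite !inE /= => ->.
Qed.

Lemma fnonemptyE t : fnonempty g F t = (rset t != set0).
Proof.
apply/hasP/set0Pn => [[u]|[i]].
  by rewrite mem_iota add0n => /andP[_ un] Fu; exists (Ordinal un); rewrite inE.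
by rewrite inE => Fi; exists (i : nat) => //; rewrite mem_iota ltn_ord.
Qed.

Lemma ffirstP t : reflect (rset t != set0 /\ forall t', t' < t -> rset t' != rset t)
  (ffirst g F t).
Proof.
rewrite /ffirst fnonemptyE; apply: (iffP andP) => -[h1 h2]; split=> //.
  move=> t' lt; rewrite -feqrowE; apply: (allP h2).
  by rewrite mem_iota.
by apply/allP => t'; rewrite mem_iota add0n feqrowE => /andP[_ /h2].
Qed.

Definition mult (S : {set 'I_n}) : nat := \sum_(t < rows) (rset t == S).

Lemma fcountE t : fcount g F rows t = mult (rset t).
Proof. by apply: eq_bigr => t' _; rewrite feqrowE. Qed.

Local Open Scope ring_scope.

Definition zl : seq ({set 'I_n} * rat) :=
  [seq (rset t, (fcount g F rows t)%:R / N%:R) | t <- iota 0 rows & ffirst g F t].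
Definition xl : seq ('I_n * 'I_n * rat) :=
  [seq (p, (N - fcov F rows p.1 p.2)%N%:R / N%:R) | p : 'I_n * 'I_n <-
    [seq (u, v) | u <- enum 'I_n, v <- enum 'I_n] &
    (p.1 < p.2)%N && (fcov F rows p.1 p.2 < N)%N].

Lemma zcodeE : zcode g F rows = enc_list [seq enc_zentry e | e <- zl].
Proof.
rewrite /zcode /enc_list flatten_if /zl -!map_comp; congr (flatten _ ++ _).
apply/eq_map => t /=; congr (_ :: (_ ++ _)); last exact: rat_codeE.
have -> : [seq [:: F t u] | u <- iota 0 n] = [seq [:: x] | x <- map (F t) (iota 0 n)].
  by rewrite -map_comp.
rewrite flatten_seq1 -val_enum_ord -map_comp.
by apply/eq_map => i; rewrite /= inE.
Qed.

Lemma flatten_pairs (U V W : Type) (s : seq U) (t : seq V) (h : U -> V -> seq W) :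
  flatten [seq flatten [seq h u v | v <- t] | u <- s] =
  flatten [seq h p.1 p.2 | p <- [seq (u, v) | u <- s, v <- t]].
Proof.
elim: s => //= u s IH; rewrite IH map_cat flatten_cat -map_comp.
by congr (flatten _ ++ _).
Qed.

Lemma xcodeE : xcode g F rows = enc_list [seq enc_xentry e | e <- xl].
Proof.
rewrite /xcode /enc_list; congr (_ ++ _); rewrite /xl -2!map_comp.
pose h (u v : nat) := if (u < v)%N && (fcov F rows u v < N)%N then
     [:: true] ++ (nat_code u ++ (nat_code v ++ rat_code (N - fcov F rows u v) N)) else [::].
rewrite -/(h _ _).
have -> : [seq flatten [seq h u v | v <- iota 0 n] | u <- iota 0 n] =
   [seq flatten [seq h u v | v : 'I_n <- enum 'I_n] | u : 'I_n <- enum 'I_n].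
  rewrite -val_enum_ord -map_comp; apply/eq_map => u /=.
  by rewrite -map_comp.
rewrite (flatten_pairs _ _ (fun u v : 'I_n => h u v)) /h flatten_if; congr flatten.
by apply/eq_map => -[u v] /=; rewrite /enc_xentry /= !nat_codeE rat_codeE.
Qed.

Lemma zl_nonzero : uniq [seq e.1 | e : {set 'I_n} * rat <- zl] /\
  all (fun e : {set 'I_n} * rat => (e.1 != set0) && (e.2 != 0)) zl.
Proof.
split.
  rewrite -map_comp map_inj_in_uniq ?filter_uniq ?iota_uniq // => t t'.
  rewrite !mem_filter => /andP[/ffirstP[_ h1] _] /andP[/ffirstP[_ h2] _] /= e.
  case: (ltngtP t t') => // lt; [have := h2 _ lt | have := h1 _ lt]; by rewrite e eqxx.
apply/allP => e /mapP[t]; rewrite mem_filter mem_iota add0n => /andP[/ffirstP[h1 _] lt] -> /=.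
rewrite h1 fcountE mulf_neq0 ?invr_eq0 ?pnatr_eq0 -?lt0n //.
by rewrite /mult (bigD1 (Ordinal lt)) //= eqxx.
Qed.

Lemma xl_nonzero : uniq [seq e.1 | e : 'I_n * 'I_n * rat <- xl] /\
  all (fun e : 'I_n * 'I_n * rat => (e.1.1 < e.1.2)%N && (e.2 != 0)) xl.
Proof.
split.
  rewrite -map_comp map_id filter_uniq // allpairs_uniq ?enum_uniq //.
  by move=> [u v] [u' v'].
apply/allP => e /mapP[p]; rewrite mem_filter => /andP[/andP[h1 h2] _] -> /=.
by rewrite h1 mulf_neq0 ?invr_eq0 ?pnatr_eq0 -?lt0n // subn_gt0.
Qed.

Lemma zvalE (S : {set 'I_n}) : S != set0 -> zval zl S = (mult S)%:R / N%:R.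
Proof.
move=> S0; rewrite /zval /zl big_map big_filter_cond /=.
case: (posnP (mult S)) => [m0|mpos].
  rewrite m0 mul0r big_seq_cond big1 // => t; rewrite mem_iota add0n.
  move=> /and3P[/andP[_ lt] _ /eqP e]; move/eqP: m0.
  by rewrite /mult sum_nat_eq0 => /forallP /(_ (Ordinal lt)); rewrite /= e eqxx.
have ex : exists t, rset t == S.
  move: mpos; rewrite lt0n sum_nat_eq0 => /forallPn[t]; rewrite eqb0 negbK => h.
  by exists (t : nat).
pose t0 := ex_minn ex; have [e0 H0] : rset t0 = S /\ forall t, rset t = S -> (t0 <= t)%N.
  by rewrite /t0; case: ex_minnP => m /eqP h1 h2; split=> // t /eqP /h2.
have t0r : (t0 < rows)%N.
  move: mpos; rewrite lt0n sum_nat_eq0 => /forallPn[t]; rewrite eqb0 negbK => /eqP /H0 h.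
  exact: leq_ltn_trans h (ltn_ord t).
have P t : (ffirst g F t && (rset t == S)) = (t == t0).
  apply/andP/eqP => [[/ffirstP[_ h] /eqP e]|->].
    case: (ltngtP t t0) => // lt; first by have := H0 _ e; rewrite leqNgt lt.
    by have := h _ lt; rewrite e0 e eqxx.
  split; last by rewrite e0.
  apply/ffirstP; rewrite e0; split=> // t' lt; apply/eqP => /H0.
  by rewrite leqNgt lt.
rewrite (eq_bigl (pred1 t0)); last by move=> t; rewrite /= P.
rewrite -big_filter filter_pred1_uniq ?iota_uniq ?mem_iota // big_seq1.
by rewrite fcountE e0.
Qed.

(** A sum of [z] over sets is a count of rows. Empty rows carry no coordinate, hence the restriction
    to properties that exclude [set0]. *)
Lemma sum_zval (P : pred {set 'I_n}) : (forall S, P S -> S != set0) ->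
  \sum_(S : {set 'I_n} | P S) zval zl S = (\sum_(t < rows) P (rset t))%N%:R / N%:R.
Proof.
move=> HP; rewrite (eq_bigr (fun S => (mult S)%:R / N%:R)); last by move=> S /HP; apply: zvalE.
rewrite -mulr_suml; congr (_ / _); rewrite -natr_sum; congr _%:R.
rewrite /mult exchange_big /=; apply: eq_bigr => t _.
rewrite big_mkcond (bigD1 (rset t)) //= eqxx big1 ?addn0; first by case: (P _).
by move=> S; rewrite eq_sym => /negPf ->; case: (P S).
Qed.

Lemma fcov_le u v : (v < n)%N -> (fcov F rows u v <= N)%N.
Proof.
move=> vn; rewrite -(cover vn); apply: leq_sum => t _.
by case: (F t u); case: (F t v).
Qed.

Lemma xvalE (u v : 'I_n) : (u < v)%N ->
  xval xl u v = (N - fcov F rows u v)%N%:R / N%:R.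
Proof.
move=> uv; rewrite /xval /xl big_map big_filter_cond /= big_mkcond big_allpairs /=.
rewrite big_enum /= (bigD1 u) //= big_enum /= [X in _ + X]big1 ?addr0; last first.
  by move=> u' /negPf ne; rewrite big1 // => v' _; rewrite ne andbF.
rewrite (bigD1 v) //= uv !eqxx /= andbT big1 ?addr0; last first.
  by move=> v' /negPf ne; rewrite ne !andbF.
case: ltnP => // h; have -> : (N - fcov F rows u v = 0)%N by lia.
by rewrite mul0r.
Qed.

Lemma feasible : cluster_LP_feasible zl xl.
Proof.
have N0' : N%:R != 0 :> rat by rewrite pnatr_eq0 -lt0n.
split; first by move=> S S0; rewrite zvalE // divr_ge0.
split=> [u|u v uv].
  rewrite sum_zval => [|S uS]; last by apply/set0Pn; exists u.
  rewrite (_ : (\sum_(t < rows) _)%N = N) ?divff // -(cover (ltn_ord u)).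
  by apply: eq_bigr => t _; rewrite inE.
rewrite (sum_zval (P := fun S => (u \in S) && (v \in S))); last first.
  by move=> S /andP[uS _]; apply/set0Pn; exists u.
rewrite xvalE // natrB ?fcov_le // mulrBl divff // subKr; congr (_%:R / _).
by apply: eq_bigr => t _; rewrite !inE.
Qed.

(** For an ordered pair one counts the rows that contain [u] and disagree with [a u] at [v]: there
    are [N - fcov] of them for a + pair and [fcov] for a - pair. The two orders of a pair give the
    factor 2. *)
Lemma objective (plus : 'I_n -> 'I_n -> bool) (a : nat -> nat -> bool) :
  (forall u v, plus u v = plus v u) ->
  (forall u v : 'I_n, a u v = (u == v) || plus u v) ->
  2 * N%:R * cc_obj plus xl = (\sum_(t < rows) vcost n a (F t))%N%:R.
Proof.
move=> sym aE; have N0' : N%:R != 0 :> rat by rewrite pnatr_eq0 -lt0n.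
pose e (u v : 'I_n) : nat := if a u v then (N - fcov F rows u v)%N else fcov F rows u v.
have cs u v : fcov F rows u v = fcov F rows v u.
  by apply: eq_bigr => t _; rewrite andbC.
have cd (u : 'I_n) : fcov F rows u u = N.
  by rewrite -(cover (ltn_ord u)); apply: eq_bigr => t _; rewrite andbb.
have -> : (\sum_(t < rows) vcost n a (F t) = \sum_(u < n) \sum_(v < n) e u v)%N.
  rewrite /vcost exchange_big /=; apply: eq_bigr => u _.
  under eq_bigr do rewrite /vdist big_distrr /=.
  rewrite exchange_big /=; apply: eq_bigr => v _; rewrite /e.
  case: (a u v).
    have : (\sum_(t < rows) F t u * (true != F t v) + fcov F rows u v = N)%N.
      rewrite -(cover (ltn_ord u)) -big_split /=; apply: eq_bigr => t _.
      by case: (F t u); case: (F t v).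
    by move=> <-; rewrite addnK.
  by apply: eq_bigr => t _; case: (F t u); case: (F t v).
rewrite sum_sym; last 2 first.
- by move=> u v; rewrite /e cs !aE sym eq_sym.
- by move=> u; rewrite /e aE eqxx cd subnn.
rewrite natrM -mulrA; congr (_ * _); rewrite /cc_obj mulr_sumr natr_sum.
apply: eq_bigr => u _; rewrite mulr_sumr natr_sum; apply: eq_bigr => v uv.
rewrite xvalE // /e aE; have -> : (u == v) = false by apply/eqP => h; rewrite h ltnn in uv.
rewrite /=; case: (plus u v); first by rewrite mulrC divfK.
by rewrite natrB ?fcov_le // mulrBr mulr1 mulrC divfK // subKr.
Qed.
End Solution.

Section Opt.
Variables (n : nat) (plus : 'I_n -> 'I_n -> bool) (a : nat -> nat -> bool).
Hypothesis sym : forall u v, plus u v = plus v u.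
Hypothesis aE : forall u v : 'I_n, a u v = (u == v) || plus u v.

Lemma opt_colouring (c : {ffun 'I_n -> {set 'I_n}}) :
  (forall c' : {ffun 'I_n -> {set 'I_n}}, colcost a c <= colcost a c') ->
  colcost a c <= 2 * cc_opt plus.
Proof.
move=> opt; rewrite /cc_opt; elim/big_ind: _ => [|x y hx hy|P _].
(* The default value [n * n] of the minimum has to be dominated as well; it already bounds the
   number of ordered pairs. *)
- apply: leq_trans (_ : _ <= n * n) _; last by lia.
  have -> : n * n = \sum_(u < n) \sum_(v < n) 1.
    by rewrite !sum_nat_const !card_ord muln1.
  by apply: leq_sum => u _; apply: leq_sum => v _; case: (_ != _).
- by rewrite /minn; case: ifP.
apply: leq_trans (opt [ffun u => pblock P u]) _.
rewrite /colcost; set c0 : {ffun _} := [ffun u => _].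
rewrite sum_sym /=; last 2 first.
- by move=> u v; rewrite !aE sym (eq_sym u v) (eq_sym (c0 u)).
- by move=> u; rewrite aE !eqxx.
rewrite leq_mul2l; apply: leq_sum => u _; apply: leq_sum => v uv.
rewrite !ffunE aE; have -> : (u == v) = false by apply/eqP => h; rewrite h ltnn in uv.
by case: (plus u v); case: (pblock P u == pblock P v).
Qed.
End Opt.

(** * Running time *)

(* Register 8 is the first one not holding a parameter of the main loop. *)
Definition EMul (e1 e2 : expr) : expr := ESum 8 e1 e2.

(** Exponentiation is unrolled in the program text, and register 2 ends as [(n + 4) ^ J]. The
    generic degree of this nest of [CLet] would grow with [J], so its cost is bounded separately,
    from the a priori bound on the powers. *)
Fixpoint pows (j : nat) (c : com) : com :=
  CSeq (CSet APow (EV 2) (EC 1))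
    (if j is j'.+1 then CLet 2 (EMul (EV 2) (EV 1)) (pows j' c) else c).

Definition eE Q := EMul (EMul (EMul (EV 0) (EV 0)) (EV 0)) (EC Q).
Definition eN Q := EMul (EMul (EMul (EMul (EMul (EMul (EV 0) (EV 0)) (EV 0)) (EV 0)) (EV 0))
  (EC Q)) (EC Q).
Definition params_then (K R k Q : nat) (body : com) : com :=
  CLet 3 (EC K) (CLet 4 (EC R) (CLet 5 (eE Q) (CLet 6 (eN Q) (CLet 7 (EC k) body)))).
Definition prog (J : nat) (c : com) : com :=
  CLet 1 (EOp false (EV 0) (EC 4)) (CLet 2 (EC 1) (pows J c)).

Definition env0 (n : nat) : nat -> nat := upd (fun=> 0) 0 n.
Definition envP (n i : nat) : nat -> nat := upd (upd (env0 n) 1 (n + 4)) 2 ((n + 4) ^ i).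
Definition envB (n J K R k Q : nat) : nat -> nat :=
  upd (upd (upd (upd (upd (envP n J) 3 K) 4 R) 5 (n ^ 3 * Q)) 6 (n ^ 5 * Q ^ 2)) 7 k.

(* The arrays once the first [i] powers of [n + 4] have been marked. *)
Definition arrP (inp : nat -> bool) (n i : nat) (a : arr) (x : nat) : bool :=
  match a with
  | AIn => inp x
  | APow => has (fun j => x == (n + 4) ^ j) (iota 0 i)
  | _ => false
  end.

Lemma degC_params K R k Q body : degC (params_then K R k Q body) = degC (params_then 0 0 0 0 body).
Proof. by []. Qed.

Lemma evalC_params n J K R k Q A o body :
  evalC (envP n J) (params_then K R k Q body) (A, o) = evalC (envB n J K R k Q) body (A, o).
Proof.
have vE : eval A (upd (upd (envP n J) 3 K) 4 R) (eE Q) = n ^ 3 * Q.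
  by rewrite /= /envP /env0 /upd /= !(sum_nat_const, card_ord) !expnS expn0; ring.
have vN : eval A (upd (upd (upd (envP n J) 3 K) 4 R) 5 (n ^ 3 * Q)) (eN Q) = n ^ 5 * Q ^ 2.
  by rewrite /= /envP /env0 /upd /= !(sum_nat_const, card_ord) !expnS expn0; ring.
by rewrite /params_then; cbn [evalC fst eval]; rewrite vE vN.
Qed.

Lemma upd_upd (env : nat -> nat) x v w : upd (upd env x v) x w = upd env x w.
Proof. by apply: functional_extensionality => y; rewrite /upd; case: eqP. Qed.

Lemma envP_next n i : upd (envP n i) 2 ((n + 4) ^ i * (n + 4)) = envP n i.+1.
Proof. by rewrite /envP upd_upd expnSr. Qed.

Lemma arrP_next inp n i : updA (arrP inp n i) APow ((n + 4) ^ i) true = arrP inp n i.+1.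
Proof.
apply: functional_extensionality => a; apply: functional_extensionality => x.
rewrite /updA; case: a => //; rewrite [RHS]/arrP -[i.+1]addn1 iotaD has_cat.
rewrite [has _ (iota (0 + i) 1)]/= orbF orbC /=.
by case: (x == _).
Qed.

Section Prelude.
Variables (n J B W : nat) (inp : seq bool) (c : com).
Notation X := B.+2.
Hypothesis J0 : 0 < J.
Hypothesis powJ : (n + 4) ^ J <= B.
Hypothesis HW : X ^ 7 <= W.
Notation A i := (arrP (nth false inp) n i).
Notation last_store := (A J.+1, @nil bool).
Hypothesis okc : okC W (envP n J) c last_store.

Lemma pow_le i : i <= J -> (n + 4) ^ i <= B.
Proof. by move=> le; apply: leq_trans powJ; rewrite leq_pexp2l ?addn4. Qed.

Lemma pows_ok j i : i + j = J ->
  [/\ evalC (envP n i) (pows j c) (A i, [::]) = evalC (envP n J) c last_store,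
      stepsC (envP n i) (pows j c) (A i, [::]) <=
        stepsC (envP n J) c last_store + j.+1 * (X ^ 7 + 7) &
      okC W (envP n i) (pows j c) (A i, [::])].
Proof.
have W1 : 1 <= W by apply: leq_trans HW; rewrite expn_gt0.
elim: j i => [|j IH] i ij.
  have {ij} -> : i = J by lia.
  cbn [pows evalC stepsC okC eval stepsE okE fst snd]; rewrite arrP_next; split=> //.
  by rewrite addnC leq_add2l; move: (X ^ 7) => y; lia.
have [e s o] := IH i.+1 ltac:(lia).
have le_env r : envP n i r <= B.
  have i_le : i <= J by lia.
  have := pow_le i_le; have := pow_le J0; rewrite expn1 /envP /env0 /upd.
  by do 3?[case: eqP => _]; lia.
(* The product of two variables has degree 7 by [degE], which is the origin of [X ^ 7]. *)
have [_ sM oM] := degE_ok (e := EMul (EV 2) (EV 1)) (A i.+1) le_env isT.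
cbn [pows]; rewrite -/(pows j c).
have E2 : eval (A i.+1) (envP n i) (EMul (EV 2) (EV 1)) = (n + 4) ^ i * (n + 4).
  by rewrite /= sum_nat_const card_ord.
have {}sM : stepsE (A i.+1) (envP n i) (EMul (EV 2) (EV 1)) <= X ^ 7 by exact: sM.
have {}oM : okE W (A i.+1) (envP n i) (EMul (EV 2) (EV 1)) by exact: oM.
move: (EMul (EV 2) (EV 1)) E2 sM oM => m E2 sM oM.
cbn [evalC stepsC okC eval stepsE okE fst snd].
have -> : envP n i 2 = (n + 4) ^ i by [].
rewrite arrP_next E2 envP_next; split=> //.
apply: leq_trans (leq_add (leqnn _) (leq_add (leq_add sM (leqnn 3)) s)) _.
by rewrite [j.+2 * _]mulSn; move: (X ^ 7) => y; lia.
Qed.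

Lemma prog_ok :
  [/\ evalC (env0 n) (prog J c) (init_store inp) = evalC (envP n J) c last_store,
      stepsC (env0 n) (prog J c) (init_store inp) <=
        stepsC (envP n J) c last_store + J.+1 * (X ^ 7 + 7) + 40 + 2 * n &
      okC W (env0 n) (prog J c) (init_store inp)].
Proof.
have W7 : 64 <= W.
  by apply: leq_trans HW; rewrite (@leq_trans (2 ^ 7)) // leq_exp2r.
have nB : n + 4 <= B by have := pow_le J0; rewrite expn1.
have nW : n + 4 <= W.
  apply: leq_trans HW; apply: leq_trans (_ : B.+2 ^ 1 <= _); last by rewrite leq_exp2l.
  by rewrite expn1; lia.
have E0 : init_store inp = (A 0, [::]).
  rewrite /init_store; congr pair; apply: functional_extensionality => -[] ;
    exact: functional_extensionality.

have [e s o] := @pows_ok J 0 (add0n J).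
rewrite E0 /prog; cbn [evalC stepsC okC eval stepsE okE fst snd].
have -> : upd (upd (env0 n) 1 (env0 n 0 + 4)) 2 1 = envP n 0 by [].
have -> : env0 n 0 = n by [].
rewrite e; split=> //; last by split; [split=> //; lia | split=> //; lia].
by move: s; move: (J.+1 * _) => y; lia.
Qed.
End Prelude.

Lemma nth_flatten_rows (T : Type) (x0 : T) (s : seq (seq T)) m u v : v < m ->
  all (fun r => size r == m) s -> nth x0 (flatten s) (u * m + v) = nth x0 (nth [::] s u) v.
Proof.
move=> vm; elim: s u => [|r s IH] [|u] //=; rewrite ?nth_nil // => /andP[/eqP rm sm].
  by rewrite nth_cat rm vm.
by rewrite nth_cat rm mulSn -addnA ltnNge leq_addr /= addKn IH.
Qed.

Section Instance.
Variables (n : nat) (plus : 'I_n -> 'I_n -> bool).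
Notation inp := (nth false (enc_instance plus)).

Lemma instance_unary i : i < n -> inp i.
Proof. by move=> lt; rewrite nth_cat size_nseq lt nth_nseq lt. Qed.

Lemma instance_stop : inp n = false.
Proof. by rewrite nth_cat size_nseq ltnn subnn. Qed.

Lemma instance_edge (u v : 'I_n) : inp (n + 1 + u * n + v) = plus u v.
Proof.
rewrite nth_cat size_nseq; have -> : (n + 1 + u * n + v < n) = false by lia.
have -> : n + 1 + u * n + v - n = (u * n + v).+1 by lia.
rewrite /= nth_flatten_rows //; last first.
  by apply/allP => r /mapP[w _ ->]; rewrite size_map size_enum_ord.
by rewrite (nth_map u) ?size_enum_ord // (nth_map v) ?size_enum_ord // !nth_ord_enum.
Qed.
End Instance.

Lemma leq_expn2 b i j : 1 < b -> i <= j -> b ^ i <= b ^ j.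
Proof. by move=> b1 ij; rewrite leq_exp2l. Qed.

Lemma ndigits_ge Q : 0 < Q -> [/\ Q ^ 2 <= ndigits Q, kap Q ^ 2 <= ndigits Q,
  kap Q <= ndigits Q & nroots Q <= ndigits Q].
Proof.
move=> Q0; have K0 := kap_gt0 Q0.
have R0 := nroots_gt0 Q0.
have QK : Q <= kap Q.
  rewrite /kap; have : 0 < (nroots Q * (9 * Q)) ^ 2 by rewrite expn_gt0 muln_gt0 R0 muln_gt0 Q0.
  by move: (_ ^ 2) => y y0; nia.
have RK : 0 < nroots Q by [].
rewrite /ndigits /digit_base; move: (kap Q) (nroots Q) K0 QK => K R K0 QK.
have QQ : Q ^ 2 <= K ^ 2 by rewrite leq_exp2r.
have KK : K ^ 2 <= K * (K ^ 2).+1 by rewrite mulnS; move: (K ^ 2) => y; nia.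
have K1 : K <= K * (K ^ 2).+1 by rewrite mulnS leq_addr.
by move: (K * _.+1) KK K1 => y KK K1; split; move: QQ KK; move: (Q ^ 2) (K ^ 2) => u w; lia.
Qed.

(** [kap] is of order [Q ^ 5], and the dominant share of the digits is [kap] chunks of [kap ^ 2]
    samples. *)
Lemma ndigits_poly : exists A, forall Q, 0 < Q -> ndigits Q <= A * Q ^ 15.
Proof.
exists (ndigits 1) => Q Q0.
have kE : kap Q = kap 1 * Q ^ 5.
  by rewrite /kap /nroots; move: 600 1200 => x y; ring.
have rE : nroots Q = nroots 1 * Q by rewrite /nroots; move: 1200 => y; ring.
rewrite /ndigits /digit_base kE rE; move: (kap 1) (nroots 1) => K R.
have Q15 i : i <= 15 -> Q ^ i <= Q ^ 15 by move=> le; rewrite leq_pexp2l.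
have -> : K * Q ^ 5 * ((K * Q ^ 5) ^ 2).+1 = K ^ 3 * Q ^ 15 + K * Q ^ 5 by ring.
have := Q15 0 isT; have := Q15 1 isT; have := Q15 5 isT; rewrite expn0 expn1.
have -> : (2 + R + K * (K ^ 2).+1) * Q ^ 15 = 2 * Q ^ 15 + R * Q ^ 15 + K ^ 3 * Q ^ 15 + K * Q ^ 15.
  by ring.
move: (Q ^ 15) (Q ^ 5) (K ^ 3) => y z x h1 h2 h3; nia.
Qed.

Lemma constC_params K R k Q body :
  constC (params_then K R k Q body) = maxn K (maxn R (maxn Q (maxn Q (maxn k (constC body))))).
Proof.
by rewrite /params_then; cbn [constC constE eE eN EMul]; rewrite !max0n ?maxnn.
Qed.

Notation bprog Q := (prog (ndigits Q) (params_then (kap Q) (nroots Q) (kap Q ^ 2) Q (mBody 8))).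

Lemma steps_bound X n J c t D : 6 <= X -> J < X -> n + 4 <= X -> c <= X ^ D ->
  t <= c + J.+1 * (X ^ 7 + 7) + 40 + 2 * n ->
  (t + 4) * (cW (X ^ (D + 7)) + 2) <= X ^ (D + 10 + (D + 10)).
Proof.
move=> X6 JX nX cX tX; have X1 : 1 < X by lia.
rewrite [X ^ (_ + (D + 10))]expnD; apply: leq_mul; last first.
  have -> : X ^ (D + 10) = X * X * X * X ^ (D + 7) by rewrite -!mulnA -!expnS !addnS.
  have : 0 < X ^ (D + 7) by rewrite expn_gt0; lia.
  have : 6 * 6 * 6 <= X * X * X by rewrite !leq_mul.
  by rewrite /cW; move: (X ^ (D + 7)) (X * X * X) => y x; nia.
have p1 : X ^ D <= X ^ (D + 9) by rewrite leq_expn2 // leq_addr.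
have p2 : X ^ 9 <= X ^ (D + 9) by rewrite leq_expn2 // leq_addl.
have p3 : J.+1 * (X ^ 7 + 7) <= X ^ 9.
  have : X ^ 1 <= X ^ 7 by rewrite leq_expn2.
  rewrite expn1 2!expnS; move: (X ^ 7) => y xy; apply: leq_mul => //.
  by nia.
have p4 : 44 + 2 * n <= X ^ 9.
  apply: leq_trans (_ : X ^ 3 <= _); last by rewrite leq_expn2.
  apply: leq_trans (_ : 6 * 6 * X <= _); first by lia.
  by rewrite !expnSr expn0 mul1n !leq_mul.
have -> : X ^ (D + 10) = X * X ^ (D + 9) by rewrite -expnS addnS.
have : 6 * X ^ (D + 9) <= X * X ^ (D + 9) by rewrite leq_mul2r X6 orbT.
move: p1 p2 tX p3 p4 cX; move: (X ^ (D + 9)) (X ^ D) (X ^ 9) (X * _) (J.+1 * _) => a b d e z.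
by lia.
Qed.

Section Time.
Variables (Q : nat).
Hypothesis Q0 : 0 < Q.
Notation J := (ndigits Q).

Lemma time_ok D c0 (body : com) : degC (params_then 0 0 0 0 body) = D -> constC body = c0 ->
  forall n (inp : seq bool), (forall i, i < n -> nth false inp i) -> nth false inp n = false ->
  exists t, [/\ tm_computes_within
      (machine (prog J (params_then (kap Q) (nroots Q) (kap Q ^ 2) Q body))) inp t
      (evalC (envB n J (kap Q) (nroots Q) (kap Q ^ 2) Q) body
        (arrP (nth false inp) n J.+1, [::])).2 &
     t <= n.+2 ^ (2 * ((J + 6 + c0) * (2 * D + 20)))].
Proof.
move=> dE cE n inp Hin Hn.
have [J1 J2 J3 J4] := ndigits_ge Q0.
have J0 : 0 < J by [].
(* [B] dominates every parameter and constant in sight: [(n + 4) ^ J], [n + 4], [c0], and also [J],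
   which bounds [Q], [kap ^ 2] and [nroots]. The time is then a power of [B + 2] whose exponent does
   not involve [Q]. *)
set B := (n + 4) ^ (J + 5 + c0); pose X := B.+2.
have b1 : 1 < n + 4 by rewrite addn4.
have JB : J <= B.
  apply: leq_trans (ltnW (ltn_expl J b1)) _; rewrite leq_expn2 //; lia.
have powJ : (n + 4) ^ J <= B by rewrite leq_expn2 //; lia.
have cB : c0 <= B.
  apply: leq_trans (ltnW (ltn_expl c0 b1)) _; rewrite leq_expn2 //; lia.
have nB : n + 4 <= B by apply: leq_trans powJ; rewrite -{1}[n + 4]expn1 leq_expn2.
have leE : forall r, envP n J r <= B.
  move=> r; rewrite /envP /env0 /upd; move: powJ nB; move: (_ ^ J) => p.
  by do 3?[case: (_ == _)]; lia.
set A := arrP (nth false inp) n J.+1.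
pose c := params_then (kap Q) (nroots Q) (kap Q ^ 2) Q body.
have QB : Q <= B.
  by apply: leq_trans JB; apply: leq_trans J1; rewrite -{1}[Q]expn1 leq_pexp2l.
have constB : constC c <= B.
  by rewrite constC_params cE !geq_max QB cB (leq_trans J2 JB) (leq_trans J3 JB) (leq_trans J4 JB).
have [_ sc oc] := degC_ok (A, [::] : seq bool) leE constB.
have degE : degC c = D by rewrite degC_params.
rewrite degE addn0 in sc oc.
have X1 : 1 < X by [].
pose W := X ^ (D + 7).
have okc : okC W (envP n J) c (A, [::]) by apply: oc; rewrite leq_expn2 // leq_addr.
have W6 : X ^ 7 <= W by rewrite leq_expn2 // leq_addl.
have [e s o] := prog_ok J0 powJ W6 okc.
have nW : n < W.
  apply: leq_trans W6; apply: leq_trans (_ : X ^ 1 <= _); last by rewrite leq_expn2.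
  by rewrite expn1 /X; lia.
have H := machine_ok nW Hin Hn o.
eexists; split.
  by rewrite -evalC_params -e; exact: H.
have X6 : 6 <= X by rewrite /X; lia.
have JX : J.+1 <= X by rewrite /X; lia.
have nX : n + 4 <= X by rewrite /X; lia.
apply: leq_trans (steps_bound X6 JX nX sc s) _.
have X2 : X <= (n + 4) ^ (J + 6 + c0).
  rewrite /X /B; have -> : J + 6 + c0 = (J + 5 + c0).+1 by lia.
  rewrite expnS; have : 0 < (n + 4) ^ (J + 5 + c0) by rewrite expn_gt0 addn4.
  move: (_ ^ _) => y y0; apply: (@leq_trans (4 * y)); first by lia.
  by rewrite leq_mul2r leq_addl orbT.
have n2 : n + 4 <= n.+2 ^ 2.
  by rewrite expnS expn1; apply: (@leq_trans (n.+2 * 2)); [lia | rewrite leq_mul2l].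
apply: leq_trans (_ : (n + 4) ^ ((J + 6 + c0) * (2 * D + 20)) <= _).
  rewrite expnM; have -> : 2 * D + 20 = D + 10 + (D + 10) by lia.
  by rewrite leq_exp2r //; lia.
rewrite [n.+2 ^ _]expnM leq_exp2r // muln_gt0; apply/andP; split; last by lia.
by move: (J) => j; lia.
Qed.
End Time.

(** * The approximation guarantee *)

Section Solver.
Variables (n Q : nat) (plus : 'I_n -> 'I_n -> bool).
Hypothesis Q0 : 0 < Q.
Hypothesis sym : forall u v, plus u v = plus v u.
Notation inp := (nth false (enc_instance plus)).
Notation pw := (arrP inp n (ndigits Q).+1 APow).
Notation g := (setting n Q).
Notation T := (n * (n ^ 5 * Q ^ 2)).
Notation F := (fRow inp pw g).
Notation a := (adjacent inp g).

Lemma aE (u v : 'I_n) : a u v = (u == v) || plus u v.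
Proof. by rewrite /adjacent instance_edge. Qed.

Lemma asym u v : u < n -> v < n -> a u v = a v u.
Proof.
move=> un vn; rewrite -[u]/(Ordinal un : nat) -[v]/(Ordinal vn : nat) !aE sym.
by rewrite (eq_sym (Ordinal un)).
Qed.

Lemma pwE x : pw x = [exists j : 'I_(ndigits Q).+1, x == (n + 4) ^ j].
Proof.
apply/hasP/existsP => [[j]|[j e]]; last by exists (j : nat); rewrite ?mem_iota ?ltn_ord.
by rewrite mem_iota add0n => /andP[_ lt] e; exists (Ordinal lt).
Qed.

(** A colouring of cost 0 would turn adjacency into equality of colours, which is transitive. *)
Lemma opt_gt0 (c : {ffun 'I_n -> {set 'I_n}}) : ~~ ftransb inp g ->
  colcost a c <= 2 * cc_opt plus -> 0 < cc_opt plus.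
Proof.
move=> ntr; rewrite lt0n; apply: contraTneq => ->; rewrite muln0 leqn0 sum_nat_eq0.
apply: contra ntr => /forallP c0.
have ac (u v : 'I_n) : a u v = (c u == c v).
  move: (c0 u); rewrite sum_nat_eq0 => /forallP/(_ v); rewrite eqb0 negbK => /eqP.
  exact.
apply/allP => u; rewrite mem_iota => /andP[_ un]; apply/allP => v; rewrite mem_iota => /andP[_ vn].
apply/allP => w; rewrite mem_iota => /andP[_ wn].
rewrite -[u]/(Ordinal un : nat) -[v]/(Ordinal vn : nat) -[w]/(Ordinal wn : nat) !ac.
by case: eqP => [->|] //=; case: eqP.
Qed.

Lemma output_code : exists zl xl,
  [/\ (evalC (envB n (ndigits Q) (kap Q) (nroots Q) (kap Q ^ 2) Q) (mBody 8)
        (arrP inp n (ndigits Q).+1, [::])).2 = enc_solution zl xl,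
      nonzero_list zl xl, cluster_LP_feasible zl xl &
      (cc_obj plus xl <= (cc_opt plus)%:R * (1 + 2 / Q%:R))%R].
Proof.
have b0 : base inp pw g (arrP inp n (ndigits Q).+1)
  (8, envB n (ndigits Q) (kap Q) (nroots Q) (kap Q ^ 2) Q).
  by split.
have [A' H] := body_ok b0.
have := H _ (ext_refl _); rewrite [(8, _).1]/fst [(8, _).2]/snd => ->; rewrite [(A', _).2]/snd.
(* For [n = 0] the regret bound does not apply, but there are no rows, and both coordinate lists are
   empty. *)
case: (posnP n) => [n00|n0].
  have T0 : gn g * gN g + gn g * gN g = 0 by rewrite /= n00.
  have noI (i : 'I_n) : False by have := leq_trans (ltn_ord i) (eq_leq n00).
  exists [::], [::]; split=> //.
  - rewrite T0 /enc_solution /zcode /xcode; have -> : gn g = 0 by []. by [].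
  - split=> [S _|]; first by rewrite /zval big_nil.
    by split=> u; have := noI u.
  - rewrite /cc_obj big1 => [|u]; last by have := noI u.
    by rewrite mulr_ge0 // addr_ge0 // divr_ge0.
have N0 : 0 < gN g by rewrite /= muln_gt0 !expn_gt0 n0 Q0.
have cov := @rows_cover inp pw n Q n0 Q0.
exists (zl g F (T + T)), (xl g F (T + T)); split.
- by rewrite /enc_solution zcodeE // xcodeE.
- have [h1 h2] := zl_nonzero F (T + T) N0.
  by have [h3 h4] := xl_nonzero F (T + T) N0.
- exact: feasible N0 cov.
have obj := objective N0 cov sym aE.
have Q1 : (0 < Q%:R :> rat)%R by rewrite ltr0n.
have N1 : (0 < (gN g)%:R :> rat)%R by rewrite ltr0n.
have opt0 : (0 <= (cc_opt plus)%:R :> rat)%R by [].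
case: (boolP (ftransb inp g)) => [tr|ntr].
  have := cost_trans pw n0 Q0 asym tr => c0.
  have o0 : cc_obj plus (xl g F (T + T)) = 0%R.
    move/eqP: obj; rewrite c0 !mulf_eq0 pnatr_eq0 /=.
    by rewrite (gt_eqF N1) => /eqP.
  by rewrite o0 mulr_ge0 // addr_ge0 // divr_ge0.
have [c copt] := best_colouring n a.
have k2 := opt_colouring sym aE copt.
have opt1 : 0 < cc_opt plus by exact: opt_gt0 ntr k2.
have := cost_general n0 Q0 asym pwE ntr copt.
rewrite -obj; have {}k2 : ((colcost a c)%:R <= 2 * (cc_opt plus)%:R :> rat)%R.
  by rewrite -natrM ler_nat.
have {}opt1 : (1 <= (cc_opt plus)%:R :> rat)%R by rewrite ler1n.
have i0 : (0 < Q%:R^-1 :> rat)%R by rewrite invr_gt0.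
have -> : (2 * (gN g)%:R * cc_obj plus (xl g F (T + T)) =
  (gN g)%:R * (2 * cc_obj plus (xl g F (T + T))))%R by rewrite mulrCA mulrA.
(* What remains is [2 x <= k (1 + i) + i] with [k <= 2 o] and [1 <= o]: the additive [i] is at most
   [o i], so [x <= o (1 + 3 i / 2)], within the claimed [1 + 2 i]. *)
rewrite (ler_pM2l N1); move: k2 opt1 i0.
move: ((colcost a c)%:R)%R ((cc_opt plus)%:R)%R (Q%:R^-1)%R (cc_obj _ _) => k o i x.
by move=> *; nra.
Qed.
End Solver.

Lemma solver : exists A, forall Q, 0 < Q -> exists M, forall n (plus : 'I_n -> 'I_n -> bool),
  (forall u v, plus u v = plus v u) -> exists zl xl,
  [/\ tm_computes_within M (enc_instance plus) (n.+2 ^ (A * Q ^ 15)) (enc_solution zl xl),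
      nonzero_list zl xl, cluster_LP_feasible zl xl &
      (cc_obj plus xl <= (cc_opt plus)%:R * (1 + 2 / Q%:R))%R].
Proof.
have [A JA] := ndigits_poly.
have [D [c0 H]] : exists D c0, forall Q, 0 < Q -> forall n (inp : seq bool),
    (forall i, i < n -> nth false inp i) -> nth false inp n = false -> exists t,
    [/\ tm_computes_within (machine (bprog Q)) inp t
          (evalC (envB n (ndigits Q) (kap Q) (nroots Q) (kap Q ^ 2) Q) (mBody 8)
            (arrP (nth false inp) n (ndigits Q).+1, [::])).2 &
        t <= n.+2 ^ (2 * ((ndigits Q + 6 + c0) * (2 * D + 20)))].
  by eexists; eexists => Q Q0; apply: time_ok.
exists (A * (2 * ((7 + c0) * (2 * D + 20)))) => Q Q0; exists (machine (bprog Q)) => n plus sym.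
have [t [Ht tle]] := H Q Q0 n _ (@instance_unary n plus) (instance_stop plus).
have [zl [xl [e h1 h2 h3]]] := output_code Q0 sym.
exists zl, xl; split=> //; rewrite e in Ht; have [r [rt hr]] := Ht.
exists r; split=> //; apply: leq_trans rt (leq_trans tle _); rewrite leq_exp2l //.
have := JA Q Q0; have : 0 < ndigits Q by [].
move: (ndigits Q) (Q ^ 15) (2 * D + 20) => J q d J0 JAq.
apply: leq_trans (_ : J * (2 * ((7 + c0) * d)) <= _).
  rewrite [J * _]mulnCA leq_mul2l /= mulnA leq_mul2r; apply/orP; right.
  by nia.
by rewrite mulnAC leq_mul2r JAq orbT.
Qed.

Local Open Scope ring_scope.

Theorem theorem1 (R : realType) :
  exists C : nat, exists eps0 : R, 0 < eps0 /\
  forall eps : R, 0 < eps -> eps < eps0 ->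
  exists M : TM,
  forall (n : nat) (plus : 'I_n -> 'I_n -> bool),
    (forall u v, plus u v = plus v u) ->
    exists (zl : seq ({set 'I_n} * rat)) (xl : seq ('I_n * 'I_n * rat)),
      tm_computes_within M (enc_instance plus)
        (n.+2 ^ (C * `|Num.ceil (eps^-1)| ^ C))%N (enc_solution zl xl) /\
      nonzero_list zl xl /\
      cluster_LP_feasible zl xl /\
      ratr (cc_obj plus xl) <= (1 + eps) * (cc_opt plus)%:R.
Proof.
have [A H] := solver.
(* With [Q = 2 c] the exponent [A Q ^ 15] is [A 2 ^ 15 c ^ 15], so this constant serves both as
   factor and as power of [c]. *)
exists (A * 2 ^ 15 + 15)%N, 1; split=> // eps e0 _.
have i0 : 0 < eps^-1 by rewrite invr_gt0.
set c := `|Num.ceil eps^-1|%N.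
have cE : c%:R = (Num.ceil eps^-1)%:~R :> R.
  by rewrite /c natr_absz ger0_norm // ltW // ceil_gt0.
have c0 : (0 < c)%N by rewrite absz_gt0 gt_eqF // ceil_gt0.
have c1 : eps^-1 <= c%:R by rewrite cE ceil_ge.
(* The solver loses [2 / Q = 1 / c], which is at most [eps] as [c] is at least [eps^-1]. *)
have [M HM] := H (2 * c)%N (ltac:(by rewrite muln_gt0)).
exists M => n plus sym; have [zl [xl [[t [tT hc]] h2 h3 h4]]] := HM n plus sym.
exists zl, xl; split.
  exists t; split=> //; apply: leq_trans tT _; rewrite leq_exp2l // expnMn mulnA.
  move: (2 ^ 15)%N => z.
  by apply: leq_mul; rewrite ?leq_addr // leq_pexp2l // leq_addl.
split=> //; split=> //.
apply: le_trans (_ : ratr ((cc_opt plus)%:R * (1 + 2 / (2 * c)%:R)) <= _).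
  by rewrite ler_rat.
rewrite rmorphM /= rmorphD /= rmorph1 fmorph_div /= !ratr_nat mulrC ler_wpM2r //.
rewrite lerD2l natrM invfM mulrA divff ?pnatr_eq0 // mul1r.
by rewrite invf_ple ?posrE // ltr0n.
Qed.
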